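(* Let $g,m,D,S,E\in\mathbb C$ and $C\in\mathbb C\setminus\{0\}$. Let $F(g)$ be the free generalized vertex algebra generated by $b$, and for $\mu\in\mathbb C$ let $\mathrm M(\mu)$ be the free generalized vertex algebra module of order $-\mu$ over $F(g)$, freely generated by $v_\mu$. There is a short exact sequence of $F(g)$-modules $$0\to \mathrm M(m+g)\xrightarrow{\ \iota\ }\mathrm M(m)\xrightarrow{\ \pi\ }\mathrm M(m+1)\to 0,$$ where the morphisms are given by $\iota(v_{m+g})=b(-m-1)v_m$ and $\pi(v_m)=v_{m+1}$. Moreover, it may be seen as a bigrading-preserving exact sequence $$0\to \mathrm M(m+g;S+C,E+m+D)\to \mathrm M(m;S,E)\to \mathrm M(m+1;S,E)\to 0$$ of bigraded $F(g;C,D)$-modules.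
   Context: All vector spaces are over $\mathbb C$. For a vector space $U$, $U\{z\}$ is the space of formal sums $\sum_{n\in\mathbb C}a_nz^n$ with $a_n\in U$, and $U[[z]]z^{c+\mathbb Z}=\{\sum_{n\ge N}a_nz^{n+c}: N\in\mathbb Z,\ a_n\in U\}$ for $c+\mathbb Z\in\mathbb C/\mathbb Z$. Powers $(x-y)^n$ are expanded in non-negative integer powers of the second variable $y$. Generalized vertex algebras (GVAs). Let $A$ be an abelian group with a bimultiplicative map $\eta:A\times A\to\mathbb C^\times$ (the phase), and let $\Delta:A\times A\to\mathbb C/\mathbb Z$ be the biadditive map with $\eta_{\gamma,\delta}\eta_{\delta,\gamma}=e^{-2\pi\sqrt{-1}\Delta(\gamma,\delta)}$. An $A$-graded GVA is an $A$-graded space $V=\bigoplus_{\gamma\in A} V^\gamma$ with a linear map $Y(\cdot,z):V\to\mathrm{End}(V)\{z\}$, $Y(u,z)=\sum_{n\in\mathbb C}u(n)z^{-n-1}$, a vector $\mathbf 1\in V^0$ and a grading-preserving operator $\partial$ such that for $u\in V^\gamma$, $v\in V^\delta$: $Y(\mathbf 1,z)=\mathrm{id}$, $Y(u,z)\mathbf 1\in u+zV[[z]]$, $\partial\mathbf 1=0$; $[\partial,Y(u,z)]=\partial_zY(u,z)$; $Y(u,z)v\in V^{\gamma+\delta}[[z]]z^{-\Delta(\gamma,\delta)}$; and there is $N\in\Delta(\gamma,\delta)$ with $(z-w)^NY(u,z)Y(v,w)=\eta_{\gamma,\delta}e^{\pi\sqrt{-1}N}(w-z)^NY(v,w)Y(u,z)$.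 Modules. Let $B$ be a set with a free (additively written) $A$-action and $\Delta_1:A\times B\to\mathbb C/\mathbb Z$ a biadditive map extending $\Delta$ (additive in the first variable, $\Delta_1(\gamma,\delta+\lambda)=\Delta(\gamma,\delta)+\Delta_1(\gamma,\lambda)$). A $B$-graded $V$-module is a space $M=\bigoplus_{\lambda\in B}M^\lambda$ with a linear map $Y:V\to\mathrm{End}(M)\{z\}$, $Y(u,z)=\sum_n u(n)z^{-n-1}$, such that for $u\in V^\gamma,v\in V^\delta,x\in M^\lambda$: $Y(\mathbf 1,z)=\mathrm{id}_M$; $Y(u,z)x\in M^{\gamma+\lambda}[[z]]z^{-\Delta_1(\gamma,\lambda)}$; and for all $n\in\Delta(\gamma,\delta)$, $(z-w)^nY(u,z)Y(v,w)x-\eta_{\gamma,\delta}e^{\pi\sqrt{-1}n}(w-z)^nY(v,w)Y(u,z)x=\sum_{j\ge0}\frac1{j!}\partial_w^j\delta(z,w)\,Y(u(n+j)v,w)x$ with $\delta(z,w)=\sum_{j\in\Delta_1(\gamma,\lambda)}z^{-j-1}w^j$. Homomorphisms are linear maps commuting with all modes $u(n)$ and compatible with gradings, where equivalent gradings (e.g. shifted ones) are identified. Free GVA. For $g\in\mathbb C$ let $\mathcal G(g)$ be the category of $\mathbb Z$-graded GVAs with phase $\eta_{r,s}=e^{\pi\sqrt{-1}grs}$ (so $\Delta(r,s)=-grs+\mathbb Z$) generated by a degree $1$ element $b$ with $(z-w)^{-g}Y(b,z)Y(b,w)=(w-z)^{-g}Y(b,w)Y(b,z)$; morphisms are grading-preserving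 GVA homomorphisms sending $b$ to $b$. $F(g)$ is the initial object of $\mathcal G(g)$. Free modules. The free GV module $\mathrm M(m)$ of order $-m$ over $F(g)$ is the universal $\mathbb Z$-graded module (with $\Delta_1(r,s)=-mr-grs+\mathbb Z$) generated by a vector $v_m\in\mathrm M(m)^0$ satisfying $b(-m+n)v_m=0$ for all $n\in\mathbb C\setminus\mathbb Z_{<0}$: any $\mathbb Z$-graded module generated by a degree $0$ vector satisfying these relations is the image of $\mathrm M(m)$ under a unique surjective homomorphism sending $v_m$ to that vector. Bigradings. $F(g;C,D)$ is $F(g)$ with the bigrading for which $b(-n_r)\cdots b(-n_1)\mathbf 1$ has bidegree $(Cr,\ n_1+\cdots+n_r-r+rD)$. $\mathrm M(m;S,E)$ is the $F(g;C,D)$-module $\mathrm M(m)$ with the bigrading for which $b(-n_r)\cdots b(-n_1)v_m$ has bidegree $(S+Cr,\ E+n_1+\cdots+n_r-r+rD)$. *)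

(* Defs.v *)
From HB Require Import structures.
From mathcomp Require Import all_boot all_order all_algebra.
From mathcomp Require Import complex.
From mathcomp Require Import boolp classical_sets functions cardinality fsbigop.
From mathcomp Require Import reals topology normedtype sequences exp trigo.

Set Implicit Arguments.
Unset Strict Implicit.
Unset Printing Implicit Defensive.

Import Order.TTheory GRing.Theory Num.Theory.
Local Open Scope classical_set_scope.
Local Open Scope ring_scope.

Section Complex.
Variable R : realType.
Local Notation K := R[i].

Definition expc (z : K) : K :=
  Complex (expR (complex.Re z) * cos (complex.Im z))
          (expR (complex.Re z) * sin (complex.Im z)).

(* e^{pi sqrt(-1) x} *)
Definition epi (x : K) : K := expc (Complex 0 pi * x).

Lemma expcD (x y : K) : expc (x + y) = expc x * expc y.
Proof.
case: x y => [a b] [c d]; rewrite /expc /= expRD cosD sinD.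
apply/eqP; rewrite eq_complex /=; apply/andP; split; apply/eqP.
- by rewrite mulrBr mulrACA [expR a * sin b * _]mulrACA.
- by rewrite mulrDr addrC mulrACA [expR a * sin b * _]mulrACA.
Qed.

Lemma expc0 : expc 0 = 1.
Proof. by rewrite /expc /= expR0 cos0 sin0 mulr1 mulr0. Qed.

Lemma epiD (x y : K) : epi (x + y) = epi x * epi y.
Proof. by rewrite /epi mulrDr expcD. Qed.

Lemma epi_neq0 (x : K) : epi x != 0.
Proof.
apply/eqP => x0; have := epiD x (- x).
rewrite x0 mul0r subrr /epi mulr0 expc0 => /eqP.
by rewrite oner_eq0.
Qed.

(* An element of C/Z is represented by any of its elements c, so that
   [eqmodZ n c] is also the membership of n in the coset c + Z. *)
Definition eqmodZ (x y : K) : Prop := exists k : int, x - y = k%:~R.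

Lemma eqmodZ_refl (x y : K) : x = y -> eqmodZ x y.
Proof. by move=> ->; exists 0; rewrite subrr. Qed.

Definition negZ (n : K) : Prop := exists k : nat, n = - k.+1%:R.

Definition gbin (n : K) (i : nat) : K :=
  (\prod_(j < i) (n - j%:R)) / (i`!)%:R.

End Complex.

Section LinearAlgebra.
Variables (K : fieldType) (V : lmodType K).

Definition subspace (W : set V) : Prop :=
  W 0 /\ forall a x y, W x -> W y -> W (a *: x + y).

Definition span (X : set V) : set V := smallest subspace X.

(* V is the internal direct sum of the W i *)
Definition direct_sum (I : Type) (W : I -> set V) : Prop :=
  [/\ forall i, subspace (W i),
      forall x, exists (k : nat) (i : 'I_k -> I) (f : 'I_k -> V),
        (forall j, W (i j) (f j)) /\ x = \sum_j f j
    & forall (k : nat) (i : 'I_k -> I) (f : 'I_k -> V),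
        injective i -> (forall j, W (i j) (f j)) ->
        \sum_j f j = 0 -> forall j, f j = 0].

End LinearAlgebra.

Section FormalSeries.
Variables (R : realType) (U : lmodType R[i]).
Local Notation K := R[i].

(* Series are given by their modes: [f] stands for the series
   sum_n f(n) z^{-n-1} over n in C, and [G] for
   sum_{p,q} G(p,q) z^{-p-1} w^{-q-1}. *)

(* f in W[[z]] z^{-c+Z} *)
Definition in_laurent (W : set U) (c : K) (f : K -> U) : Prop :=
  [/\ forall n, W (f n),
      forall n, ~ eqmodZ n c -> f n = 0
    & exists N : int, forall k : int, N <= k -> f (c + k%:~R) = 0].

(* (z - w)^n G and (w - z)^n G; the sums that occur below all have finite
   support, by the truncation axioms. *)
Definition zw_pow (n : K) (G : K -> K -> U) (p q : K) : U :=
  \sum_(i \in [set: nat]) ((-1) ^+ i * gbin n i) *: G (p + n - i%:R) (q + i%:R).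

Definition wz_pow (n : K) (G : K -> K -> U) (p q : K) : U :=
  \sum_(i \in [set: nat]) ((-1) ^+ i * gbin n i) *: G (p + i%:R) (q + n - i%:R).

(* (1/j!) d_w^j delta(z,w) f(w), where
   delta(z,w) = sum_{k in d+Z} z^{-k-1} w^k *)
Definition delta_mul (d : K) (j : nat) (f : K -> U) (p q : K) : U :=
  if `[< eqmodZ p d >] then gbin p j *: f (p + q - j%:R) else 0.

End FormalSeries.

Section GVA.
Variable R : realType.
Local Notation K := R[i].

Record phase (A : zmodType) := Phase {
  eta : A -> A -> K;
  Delta : A -> A -> K;
  eta_neq0 : forall a b, eta a b != 0;
  eta_Dl : forall a a' b, eta (a + a') b = eta a b * eta a' b;
  eta_Dr : forall a b b', eta a (b + b') = eta a b * eta a b';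
  Delta_Dl : forall a a' b, eqmodZ (Delta (a + a') b) (Delta a b + Delta a' b);
  Delta_Dr : forall a b b', eqmodZ (Delta a (b + b')) (Delta a b + Delta a b');
  eta_Delta : forall a b, eta a b * eta b a = epi (- 2 * Delta a b)
}.

Record gva (A : zmodType) (P : phase A) := Gva {
  gva_sort :> lmodType K;
  gva_gr : A -> set gva_sort;
  gva_Y : gva_sort -> K -> gva_sort -> gva_sort;
  vac : gva_sort;
  der : gva_sort -> gva_sort;
  gva_direct : direct_sum gva_gr;
  gva_linl : forall n v, linear (fun u => gva_Y u n v);
  gva_linr : forall u n, linear (gva_Y u n);
  der_lin : linear der;
  vac_gr : gva_gr 0 vac;
  der_gr : forall a u, gva_gr a u -> gva_gr a (der u);
  gva_vacl : forall n v, gva_Y vac n v = if n == -1 then v else 0;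
  gva_vacr : forall u, gva_Y u (-1) vac = u;
  gva_vacr0 : forall u n, ~ negZ n -> gva_Y u n vac = 0;
  der_vac : der vac = 0;
  der_Y : forall u n v,
    der (gva_Y u n v) - gva_Y u n (der v) = - n *: gva_Y u (n - 1) v;
  gva_laurent : forall a b u v, gva_gr a u -> gva_gr b v ->
    in_laurent (gva_gr (a + b)) (Delta P a b) (fun n => gva_Y u n v);
  gva_local : forall a b u v, gva_gr a u -> gva_gr b v ->
    exists2 N : K, eqmodZ N (Delta P a b) &
    forall x p q,
      zw_pow N (fun p q => gva_Y u p (gva_Y v q x)) p q =
      (eta P a b * epi N) *:
        wz_pow N (fun p q => gva_Y v q (gva_Y u p x)) p q
}.

Definition gva_hom (A : zmodType) (P : phase A) (V W : gva P) (f : V -> W) :=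
  [/\ linear f,
      f (vac V) = vac W,
      forall u n v, f (gva_Y u n v) = gva_Y (f u) n (f v)
    & forall a u, gva_gr a u -> gva_gr a (f u)].

Definition gva_generated (A : zmodType) (P : phase A) (V : gva P) (X : set V) :=
  smallest [set W : set V | [/\ subspace W, W (vac V)
    & forall u n v, W u -> W v -> W (gva_Y u n v)]] X = [set: V].

(* The A-set B together with Delta_1 *)
Record grading_set (A : zmodType) (P : phase A) := GradingSet {
  gs_sort :> Type;
  gs_act : A -> gs_sort -> gs_sort;
  Delta1 : A -> gs_sort -> K;
  gs_act0 : forall x, gs_act 0 x = x;
  gs_actD : forall a b x, gs_act (a + b) x = gs_act a (gs_act b x);
  gs_free : forall a x, gs_act a x = x -> a = 0;
  Delta1_D : forall a b x, eqmodZ (Delta1 (a + b) x) (Delta1 a x + Delta1 b x);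
  Delta1_act : forall a b x,
    eqmodZ (Delta1 a (gs_act b x)) (Delta P a b + Delta1 a x)
}.

Record gva_mod (A : zmodType) (P : phase A) (V : gva P) (B : grading_set P) :=
  GvaMod {
  mod_sort :> lmodType K;
  mod_gr : B -> set mod_sort;
  mod_Y : V -> K -> mod_sort -> mod_sort;
  mod_direct : direct_sum mod_gr;
  mod_linl : forall n x, linear (fun u => mod_Y u n x);
  mod_linr : forall u n, linear (mod_Y u n);
  mod_vac : forall n x, mod_Y (vac V) n x = if n == -1 then x else 0;
  mod_laurent : forall a l u x, gva_gr a u -> mod_gr l x ->
    in_laurent (mod_gr (gs_act a l)) (Delta1 a l) (fun n => mod_Y u n x);
  mod_borcherds : forall a b l u v x,
    gva_gr a u -> gva_gr b v -> mod_gr l x ->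
    forall n, eqmodZ n (Delta P a b) ->
    forall p q,
      zw_pow n (fun p q => mod_Y u p (mod_Y v q x)) p q -
      (eta P a b * epi n) *:
        wz_pow n (fun p q => mod_Y v q (mod_Y u p x)) p q =
      \sum_(j \in [set: nat]) delta_mul (Delta1 a l) j
        (fun k => mod_Y (gva_Y u (n + j%:R) v) k x) p q
}.

Definition grading_equiv (A : zmodType) (P : phase A) (B B' : grading_set P)
    (phi : B -> B') : Prop :=
  [/\ bijective phi,
      forall a x, phi (gs_act a x) = gs_act a (phi x)
    & forall a x, eqmodZ (Delta1 a (phi x)) (Delta1 a x)].

(* Compatibility with the gradings is up to equivalence of gradings, so that
   for instance maps shifting a Z-grading are allowed. *)
Definition mod_hom (A : zmodType) (P : phase A) (V : gva P)
    (B B' : grading_set P) (M : gva_mod V B) (M' : gva_mod V B')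
    (f : M -> M') : Prop :=
  [/\ linear f,
      forall u n x, f (mod_Y u n x) = mod_Y u n (f x)
    & exists2 phi : B -> B', grading_equiv phi &
        forall l x, mod_gr l x -> mod_gr (phi l) (f x)].

Definition mod_generated (A : zmodType) (P : phase A) (V : gva P)
    (B : grading_set P) (M : gva_mod V B) (X : set M) :=
  smallest [set W : set M | subspace W /\
    forall (u : V) n x, W x -> W (mod_Y u n x)] X = [set: M].

Definition short_exact (M1 M2 M3 : lmodType K)
    (i : M1 -> M2) (p : M2 -> M3) : Prop :=
  [/\ injective i, range i = p @^-1` [set 0] & range p = [set: M3]].

(* A bigrading by C x C with u(n) of bidegree (deg u, wt u - n - 1) *)
Definition bigraded_gva (A : zmodType) (P : phase A) (V : gva P)
    (W : K * K -> set V) : Prop :=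
  [/\ direct_sum W, W (0, 0) (vac V)
    & forall h k u n v, W h u -> W k v ->
        W (h.1 + k.1, h.2 + k.2 - n - 1) (gva_Y u n v)].

Definition bigraded_mod (A : zmodType) (P : phase A) (V : gva P)
    (W : K * K -> set V) (B : grading_set P) (M : gva_mod V B)
    (X : K * K -> set M) : Prop :=
  direct_sum X /\
  forall h k u n x, W h u -> X k x ->
    X (h.1 + k.1, h.2 + k.2 - n - 1) (mod_Y u n x).

End GVA.

Section Free.
Variable R : realType.
Local Notation K := R[i].

Section PhaseZ.
Variable g : K.

Definition etaZ (r s : int) : K := epi (g * r%:~R * s%:~R).
Definition DeltaZ (r s : int) : K := - (g * r%:~R * s%:~R).

Fact etaZ_neq0 a b : etaZ a b != 0. Proof. exact: epi_neq0. Qed.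
Fact etaZ_Dl a a' b : etaZ (a + a') b = etaZ a b * etaZ a' b.
Proof. by rewrite /etaZ intrD mulrDr mulrDl epiD. Qed.
Fact etaZ_Dr a b b' : etaZ a (b + b') = etaZ a b * etaZ a b'.
Proof. by rewrite /etaZ intrD mulrDr epiD. Qed.
Fact DeltaZ_Dl a a' b :
  eqmodZ (DeltaZ (a + a') b) (DeltaZ a b + DeltaZ a' b).
Proof. by apply: eqmodZ_refl; rewrite /DeltaZ intrD mulrDr mulrDl opprD. Qed.
Fact DeltaZ_Dr a b b' :
  eqmodZ (DeltaZ a (b + b')) (DeltaZ a b + DeltaZ a b').
Proof. by apply: eqmodZ_refl; rewrite /DeltaZ intrD mulrDr opprD. Qed.
Fact etaZ_DeltaZ a b : etaZ a b * etaZ b a = epi (- 2 * DeltaZ a b).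
Proof.
by rewrite /etaZ /DeltaZ -epiD mulrNN [g * b%:~R * _]mulrAC mulr_natl mulr2n.
Qed.

Definition phaseZ : phase R int := Phase etaZ_neq0 etaZ_Dl etaZ_Dr
  DeltaZ_Dl DeltaZ_Dr etaZ_DeltaZ.

Variable m : K.

Definition actZ (r s : int) : int := r + s.
Definition Delta1Z (r s : int) : K := - (m * r%:~R) - g * r%:~R * s%:~R.

Fact actZ_D a b x : actZ (a + b) x = actZ a (actZ b x).
Proof. exact/esym/addrA. Qed.
Fact actZ_free a x : actZ a x = x -> a = 0.
Proof. by move=> /eqP; rewrite -subr_eq0 /actZ addrK => /eqP. Qed.
Fact Delta1Z_D a b x :
  eqmodZ (Delta1Z (a + b) x) (Delta1Z a x + Delta1Z b x).
Proof.
by apply: eqmodZ_refl; rewrite /Delta1Z intrD !mulrDr mulrDl !opprD addrACA.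
Qed.
Fact Delta1Z_act a b x :
  eqmodZ (Delta1Z a (actZ b x)) (Delta phaseZ a b + Delta1Z a x).
Proof.
apply: eqmodZ_refl; rewrite /Delta1Z /actZ /= /DeltaZ intrD mulrDr opprD.
by rewrite addrCA.
Qed.

Definition gradingZ : grading_set phaseZ := GradingSet (@add0r int)
  actZ_D actZ_free Delta1Z_D Delta1Z_act.

End PhaseZ.

(* (V, b) is an object of G(g) *)
Definition gva_cat (g : K) (V : gva (phaseZ g)) (b : V) : Prop :=
  [/\ gva_gr (1 : int) b,
      gva_generated [set b]
    & forall x p q,
        zw_pow (- g) (fun p q => gva_Y b p (gva_Y b q x)) p q =
        wz_pow (- g) (fun p q => gva_Y b q (gva_Y b p x)) p q].

Definition free_gva (g : K) (F : gva (phaseZ g)) (b : F) : Prop :=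
  gva_cat b /\
  forall (V : gva (phaseZ g)) (b' : V), gva_cat b' ->
    exists! f : F -> V, gva_hom f /\ f b = b'.

Definition mod_of_order (g m : K) (F : gva (phaseZ g)) (b : F)
    (M : gva_mod F (gradingZ g m)) (v : M) : Prop :=
  [/\ @mod_gr _ _ _ _ _ M (0 : int) v,
      mod_generated [set v]
    & forall n, ~ negZ n -> mod_Y b (- m + n) v = 0].

Definition free_mod (g m : K) (F : gva (phaseZ g)) (b : F)
    (M : gva_mod F (gradingZ g m)) (v : M) : Prop :=
  mod_of_order b v /\
  forall (N : gva_mod F (gradingZ g m)) (w : N), mod_of_order b w ->
    exists! f : M -> N, [/\ mod_hom f, range f = [set: N] & f v = w].

(* The bigrading in which b(-n_r)...b(-n_1) x, written here with
   s = [:: n_r; ...; n_1] and Yb n = b(n), has bidegree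
   (S + C r, E + n_1 + ... + n_r - r + r D). *)
Definition monomial (M : lmodType K) (Yb : K -> M -> M) (x : M) (s : seq K) :=
  foldr (fun n y => Yb (- n) y) x s.

Definition bigr (M : lmodType K) (Yb : K -> M -> M) (x : M) (C D S E : K)
    (h : K * K) : set M :=
  span [set monomial Yb x s | s in [set s : seq K |
    h = (S + C * (size s)%:R,
         E + \sum_(n <- s) n - (size s)%:R + (size s)%:R * D)]].

Definition bigrF (g : K) (F : gva (phaseZ g)) (b : F) (C D : K) :=
  bigr (gva_Y b) (vac F) C D 0 0.

Definition bigrM (g m : K) (F : gva (phaseZ g)) (b : F)
    (M : gva_mod F (gradingZ g m)) (v : M) (C D S E : K) :=
  bigr (mod_Y b) v C D S E.

End Free.

(* Main.v *)
Require Import Defs.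
From HB Require Import structures.
From mathcomp Require Import all_boot all_order all_algebra.
From mathcomp Require Import complex classical_sets reals.
From mathcomp Require Import boolp functions fsbigop exp trigo.
From mathcomp Require Import finmap monalg.
From mathcomp Require Import ring zify.
Set Implicit Arguments. Unset Strict Implicit. Unset Printing Implicit Defensive.
Import GRing.Theory Num.Theory.
Local Open Scope ring_scope.

(** All the free objects are identified with one explicit space, on which the
    exact sequence is the division of polynomials by a variable.

    Let V be the polynomial ring in t_0, t_1, ..., with t(z) = sum_a t_a z^a, let
    E^c(z) be the algebra endomorphism of V with E^c(z) t(x) = (1 - x/z)^c t(x), and
    E = E^g.  For a scalar mu, vertex operators Y_mu(u, z) with u in V are defined
    recursively: Y_mu(1, z) = id, and Y_mu(t_a u, z) is obtained from Y_mu(u, z) by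
    taking the normally ordered product with the a-th divided derivative of
    z^mu t(z) E(z).  In particular b = t_0 acts by z^mu t(z) E(z).  The module Mod(m)
    is V, where on polynomials of degree s the operators with mu = m + g s are used.

    These operators satisfy the Borcherds identity (fld_borcherds).  As V is
    generated from 1 by multiplication by t_0 and by the derivation D with
    D t(z) = t'(z), it is proved by induction on the first vector u: the case u = 1
    is the residue theorem for z^P (z - w)^N, the case D u is differentiation, and the
    case t_0 u follows from two rules for exchanging E(z) and t(z) with a vertex
    operator (ann_fld, fld_cre_exchange).  Hence Mod(0) is a generalized vertex
    algebra of the category G(g), over which Mod(m) is a module.

    Conversely b(z) can be solved for t(z) = z^{-mu} b(z) E^{-g}(z).  In any graded
    space with a vector of order -m and operators b(n) local with exponent -g, this
    formula defines by recursion a map theta from V commuting with b: locality makes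
    it symmetric in the variables, and the order condition kills the negative powers
    of z (fock_universal).  For the free algebra F, theta is inverse to the morphism
    F -> V given by freeness: it respects all products by a uniqueness argument in
    which the locality needed in F is the one of the fields of F itself
    (free_gva_model).  For a free module, theta commutes with the modes of b, hence by
    the Borcherds identity with those of all of F, and it is inverse to the universal
    morphism (free_mod_model).  So F = V and M(m) = Mod(m).

    Since E(z) fixes t_0, multiplication by t_0 commutes with every vertex operator;
    it raises the degree by 1, so it is a morphism from Mod(m + g) to Mod(m) sending 1
    to t_0 = b(-m-1)1.  The quotient of V by t_0 becomes V again through t_a |-> t_{a-1},
    that is t(z) |-> z t(z), which changes m to m + 1.  Exactness is then clear.

    Give a monomial of degree r and weight w (t_a having weight a) the bidegree
    (S + C r, E + w + m r + g r (r - 1)/2 + r D).  The monomials form a basis, so this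
    is a bigrading, and the vertex operators are homogeneous by their definition
    (wgt_fld).  The products of modes of b applied to 1 are homogeneous of the
    prescribed bidegrees and span V, so it is the bigrading of the statement
    (bigr_model), and both maps visibly preserve it. *)

(** * Binomial coefficients *)

Section Binomials.
Variable K : numFieldType.
Implicit Types (a b n : K) (i k : nat).

Definition fbin (n : K) (i : nat) : K := (\prod_(j < i) (n - j%:R)) / (i`!)%:R.
(** The coefficient of x^i in (1 - x)^n. *)
Definition sbin (n : K) (i : nat) : K := (-1) ^+ i * fbin n i.

Lemma fbin0 n : fbin n 0 = 1.
Proof. by rewrite /fbin big_ord0 divr1. Qed.

Lemma sbin0 n : sbin n 0 = 1.
Proof. by rewrite /sbin fbin0 mulr1. Qed.

Lemma fact_neq0 i : (i`!)%:R != 0 :> K.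
Proof. by rewrite pnatr_eq0 -lt0n fact_gt0. Qed.

Lemma fbinS n i : i.+1%:R * fbin n i.+1 = (n - i%:R) * fbin n i.
Proof.
rewrite /fbin big_ord_recr /= factS natrM; move: (fact_neq0 i).
have k1 : i.+1%:R != 0 :> K by rewrite pnatr_eq0.
move: (\prod_(j < i) _) (_`!%:R) (i.+1%:R) k1 => p f k k1 f1.
by field; rewrite ?k1 ?f1.
Qed.

Lemma fbinS1 n i : i.+1%:R * fbin n i.+1 = n * fbin (n - 1) i.
Proof.
rewrite /fbin big_ord_recl /= subr0 factS natrM invfM.
have -> : \prod_(j < i) (n - (bump 0 j)%:R) = \prod_(j < i) (n - 1 - j%:R) :> K.
  by apply: eq_bigr => j _; rewrite /bump /= natrD opprD addrA.
have k1 : i.+1%:R != 0 :> K by rewrite pnatr_eq0.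
move: (fact_neq0 i).
move: (\prod_(j < i) _) (_`!%:R) (i.+1%:R) k1 => p f k k1 f1.
by field; rewrite ?k1 ?f1.
Qed.

Lemma sbinS n i : i.+1%:R * sbin n i.+1 = - (n - i%:R) * sbin n i.
Proof. rewrite /sbin mulrCA fbinS exprS; ring. Qed.

Lemma sbinS1 n i : i.+1%:R * sbin n i.+1 = - n * sbin (n - 1) i.
Proof. rewrite /sbin mulrCA fbinS1 exprS; ring. Qed.

(** Induction on k, multiplying by k.+1 to let the absorption rules act. *)
Lemma fbin_vandermonde a b k :
  \sum_(i < k.+1) fbin a i * fbin b (k - i) = fbin (a + b) k.
Proof.
elim: k => [|k IH].
  by rewrite big_ord_recl big_ord0 addr0 !fbin0 mulr1.
have k1 : k.+1%:R != 0 :> K by rewrite pnatr_eq0.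
apply: (mulfI k1); rewrite fbinS -IH !mulr_sumr.
have -> : \sum_(i < k.+2) k.+1%:R * (fbin a i * fbin b (k.+1 - i)) =
  \sum_(i < k.+2) i%:R * fbin a i * fbin b (k.+1 - i) +
  \sum_(i < k.+2) fbin a i * ((k.+1 - i)%N%:R * fbin b (k.+1 - i)).
  rewrite -big_split /=; apply: eq_bigr => i _.
  by rewrite -{1}(subnKC (ltnSE (ltn_ord i))) natrD; ring.
rewrite [X in X + _ = _]big_ord_recl /= mul0r mul0r add0r.
rewrite [X in _ + X = _]big_ord_recr /= subnn mul0r mulr0 addr0.
rewrite -big_split /=; apply: eq_bigr => i _.
rewrite fbinS /bump /= add1n subSS subSn; last by rewrite -ltnS.
rewrite fbinS natrB; last by rewrite -ltnS.
by ring.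
Qed.

Lemma sbin_vandermonde a b k :
  \sum_(i < k.+1) sbin a i * sbin b (k - i) = sbin (a + b) k.
Proof.
rewrite /sbin -fbin_vandermonde mulr_sumr; apply: eq_bigr => i _.
rewrite mulrACA -exprD subnKC //; exact: ltnSE.
Qed.

Lemma fbin0n k : fbin 0 k = (k == 0)%:R.
Proof.
case: k => [|k]; first by rewrite fbin0.
by rewrite /fbin big_ord_recl subr0 mul0r mul0r.
Qed.

Lemma sbin0n k : sbin 0 k = (k == 0)%:R.
Proof. by rewrite /sbin fbin0n; case: k => [|k]; rewrite ?mulr0 ?mulr1. Qed.

Lemma fbin_nat (n k : nat) : fbin n%:R k = 'C(n, k)%:R.
Proof.
elim: k n => [|k IH] [|n]; rewrite ?fbin0 ?bin0 ?bin0n //.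
  by rewrite fbin0n.
have k1 : k.+1%:R != 0 :> K by rewrite pnatr_eq0.
apply: (mulfI k1); rewrite fbinS1 -[n.+1%:R - 1]/(n.+1%:R - 1%:R) -natrB // subn1.
by rewrite IH -!natrM mul_bin_diag.
Qed.

Lemma sbin_neg (n k : nat) : sbin (- n.+1%:R) k = 'C(n + k, k)%:R.
Proof.
elim: k n => [|k IH] n; first by rewrite sbin0 bin0.
have k1 : k.+1%:R != 0 :> K by rewrite pnatr_eq0.
apply: (mulfI k1); rewrite sbinS1 opprK.
rewrite -opprD -[X in _ + X]/(1%:R) -natrD addn1 IH -!natrM; congr (_%:R).
by rewrite -[(n + k.+1)%N]addSnnS mul_bin_left addnK.
Qed.

(** e^{pi i N} for an integer N. *)
Definition sgnz (N : int) : K := (-1) ^+ `|N|%N.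

Lemma sgnzD N (j : nat) : sgnz (N - j%:Z) = (-1) ^+ j * sgnz N.
Proof.
rewrite /sgnz -(signr_odd _ `|N - j|%N) -(signr_odd _ j) -(signr_odd _ `|N|%N).
rewrite -signr_addb.
by congr (_ ^+ nat_of_bool _); lia.
Qed.

(** The residues of the rational function z^P (z - w)^N of z: the first two
    terms come from its expansions in |z| > |w| and |z| < |w|, and their difference
    is the residue at z = w, present only when N < 0.  It is the whole content of
    the Borcherds identity for the vacuum. *)
Lemma residue_binomial (N P : int) :
  (if (0 <= P + N + 1)%R then sbin N%:~R (absz (P + N + 1)) else 0) -
  sgnz N * (if (P < 0)%R then sbin N%:~R (absz (P + 1)) else 0) =
  (if (N < 0)%R then fbin P%:~R (absz (N + 1)) else 0).
Proof.
case: N P => [N|N] [P|P].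
- have -> : (0 <= Posz P + Posz N + 1)%R by lia.
  have -> : (Posz P < 0)%R = false by lia.
  have -> : (Posz N < 0)%R = false by lia.
  by rewrite mulr0 subr0 /sbin -pmulrn fbin_nat bin_small ?mulr0 //; lia.
- have -> : (Posz N < 0)%R = false by lia.
  have -> : (Negz P < 0)%R by lia.
  rewrite /sbin -!pmulrn !fbin_nat /sgnz /=.
  case: ifP => h; last by rewrite [X in _ * (_ * X)]
    (_ : _ = 0) ?mulr0 ?subr0 // bin_small //; lia.
  have -> : absz (Negz P + Posz N + 1) = (N - P)%N by lia.
  have -> : absz (Negz P + 1) = P by lia.
  have PN : (P <= N)%N by lia.
  rewrite bin_sub // mulrA -exprD -signr_odd -[in X in _ - X]signr_odd.
  by rewrite oddB // oddD addbC subrr.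
- have -> : (Posz P < 0)%R = false by lia.
  have -> : (Negz N < 0)%R by lia.
  rewrite mulr0 subr0 -pmulrn fbin_nat.
  have -> : (Negz N)%:~R = - (N.+1)%:R :> K by rewrite NegzE mulrNz.
  have -> : absz (Negz N + 1) = N by lia.
  case: ifP => h; last by rewrite bin_small //; lia.
  have -> : absz (Posz P + Negz N + 1) = (P - N)%N by lia.
  have NP : (N <= P)%N by lia.
  by rewrite sbin_neg subnKC // bin_sub.
- have -> : (0 <= Negz P + Negz N + 1)%R = false by lia.
  have -> : (Negz P < 0)%R by lia.
  have -> : (Negz N < 0)%R by lia.
  have -> : absz (Negz P + 1) = P by lia.
  have -> : absz (Negz N + 1) = N by lia.
  have E M : (Negz M)%:~R = - (M.+1)%:R :> K by rewrite NegzE mulrNz.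
  rewrite !E sbin_neg.
  have <- : sbin (- P.+1%:R) N * (-1) ^+ N = fbin (- P.+1%:R) N :> K.
    by rewrite /sbin mulrC mulrA -expr2 sqrr_sign mul1r.
  rewrite sbin_neg [in RHS]addnC -[in RHS]bin_sub ?leq_addr // addKn.
  by rewrite sub0r /sgnz /= exprS !mulN1r mulNr opprK mulrC.
Qed.

End Binomials.

(** * Sums of finite support and two-variable distributions *)

(** The modes of an abstract module come as functions with a proof of linearity;
    these are the usual rules for them. *)
Section LinearFunctions.
Variables (K : fieldType) (U W : lmodType K) (L : U -> W).
Hypothesis L_lin : linear L.

Let L' : {linear U -> W} := HB.pack L (GRing.isLinear.Build K U W *:%R L L_lin).

Lemma linear_0 : L 0 = 0. Proof. exact: (linear0 L'). Qed.
Lemma linear_D x y : L (x + y) = L x + L y. Proof. exact: (linearD L'). Qed.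
Lemma linear_B x y : L (x - y) = L x - L y. Proof. exact: (linearB L'). Qed.
Lemma linear_Z c x : L (c *: x) = c *: L x. Proof. exact: (linearZ_LR L'). Qed.
Lemma linear_sumr I (r : seq I) (P : pred I) (F : I -> U) :
  L (\sum_(i <- r | P i) F i) = \sum_(i <- r | P i) L (F i).
Proof. exact: (linear_sum L'). Qed.
End LinearFunctions.

(** All infinite sums have finite support because the fields are truncated; outside
    that case the sum has value 0, so each rearrangement below asks for an explicit
    bound on the support. *)
Definition nsum (U : zmodType) (F : nat -> U) : U := \sum_(i \in [set: nat]) F i.

Lemma big_ord_shift (U : nmodType) (j n : nat) (F : nat -> U) : (j <= n)%N ->
  \sum_(i < n.+1 | (j <= i)%N) F i = \sum_(i < (n - j).+1) F (i + j)%N.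
Proof.
move=> jn; rewrite -(big_mkord (fun i => j <= i)%N F).
rewrite -(big_mkord xpredT (fun i => F (i + j)%N)).
rewrite (@big_cat_nat _ _ _ j) ?leqW //= [X in X + _ = _]big1_seq ?add0r; last first.
  by move=> i; rewrite mem_index_iota => /andP[h /andP[_ h']]; lia.
rewrite -subSn // -{1}[j]add0n big_addn big_nat_cond [RHS]big_nat_cond.
by apply: eq_bigl => i; rewrite leq_addl andbT.
Qed.

Section InfiniteSums.
Variable U : zmodType.
Implicit Types f g : nat -> U.

Definition evz f := exists N, forall i, (N <= i)%N -> f i = 0.

Lemma nsumE N f : (forall i, (N <= i)%N -> f i = 0) -> nsum f = \sum_(i < N) f i.
Proof.
move=> f0; rewrite /nsum (fsbigE (index_iota 0 N)) ?iota_uniq //; last first.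
  by move=> i _; rewrite mem_index_iota /= -leqNgt; exact: f0.
by rewrite -(big_mkord xpredT f); apply: eq_bigl => i; rewrite in_setT.
Qed.

Lemma eq_nsum f g : f =1 g -> nsum f = nsum g.
Proof. by move=> /funext ->. Qed.

Lemma nsum0 f : (forall i, f i = 0) -> nsum f = 0.
Proof. by move=> f0; rewrite (@nsumE 0) ?big_ord0. Qed.

Lemma nsum1 j f : (forall i, i != j -> f i = 0) -> nsum f = f j.
Proof.
move=> f0; rewrite (@nsumE j.+1) => [|i ji]; last first.
  by apply: f0; rewrite neq_ltn ji orbT.
rewrite big_ord_recr /= big1 ?add0r // => i _.
by apply: f0; rewrite neq_ltn ltn_ord.
Qed.

Lemma nsum_recl f : evz f -> nsum f = f 0%N + nsum (fun i => f i.+1).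
Proof.
move=> [N f0]; rewrite (@nsumE N.+1) ?(@nsumE N) => [|i Ni|i Ni].
- by rewrite big_ord_recl.
- exact/f0/leqW.
- exact/f0/ltnW.
Qed.

Lemma nsum_add f g : evz f -> evz g -> nsum (fun i => f i + g i) = nsum f + nsum g.
Proof.
move=> [N f0] [M g0].
rewrite !(@nsumE (N + M)%N) ?big_split //= => i NMi; rewrite ?f0 ?g0 ?addr0 //; lia.
Qed.

Lemma evz_add f g : evz f -> evz g -> evz (fun i => f i + g i).
Proof.
by move=> [N f0] [M g0]; exists (N + M)%N => i NMi; rewrite f0 ?g0 ?addr0 //; lia.
Qed.

Lemma evz_S f : evz f -> evz (fun i => f i.+1).
Proof. by move=> [N f0]; exists N => i Ni; apply: f0; exact: leqW.
Qed.

Lemma evz0 f : (forall i, f i = 0) -> evz f.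
Proof. by move=> f0; exists 0%N. Qed.

Lemma evz_sum I (r : seq I) (F : I -> nat -> U) :
  (forall k, evz (F k)) -> evz (fun l => \sum_(k <- r) F k l).
Proof.
move=> F0; elim: r => [|i r IH]; first by apply: evz0 => l; rewrite big_nil.
have -> : (fun l => \sum_(k <- i :: r) F k l) = (fun l => F i l + \sum_(k <- r) F k l).
  by apply/funext => l; rewrite big_cons.
exact: evz_add.
Qed.

Lemma nsum_exchange_big I (r : seq I) (F : I -> nat -> U) :
  (forall k, evz (F k)) ->
  \sum_(k <- r) nsum (F k) = nsum (fun l => \sum_(k <- r) F k l).
Proof.
move=> F0; elim: r => [|i r IH].
  by rewrite big_nil nsum0 // => l; rewrite big_nil.
rewrite big_cons IH -nsum_add //; last exact: evz_sum.
by apply: eq_nsum => l; rewrite big_cons.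
Qed.

Lemma nsum_exchange N (F : nat -> nat -> U) :
  (forall i j, (N <= i)%N || (N <= j)%N -> F i j = 0) ->
  nsum (fun i => nsum (F i)) = nsum (fun j => nsum (F^~ j)).
Proof.
move=> F0; rewrite (@nsumE N) => [|i Ni]; last by apply: nsum0 => j; rewrite F0 ?Ni.
rewrite (@nsumE N) => [|j Nj]; last by apply: nsum0 => i; rewrite F0 ?Nj ?orbT.
transitivity (\sum_(i < N) \sum_(j < N) F i j).
  by apply: eq_bigr => i _; apply: nsumE => j Nj; rewrite F0 ?Nj ?orbT.
rewrite exchange_big; apply: eq_bigr => j _.
by apply/esym/nsumE => i Ni; rewrite F0 ?Ni.
Qed.

Lemma nsum_antidiag N (F : nat -> nat -> U) :
  (forall i j, (N <= i + j)%N -> F i j = 0) ->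
  nsum (fun k => \sum_(i < k.+1) F i (k - i)%N) = nsum (fun i => nsum (F i)).
Proof.
move=> F0; rewrite (@nsumE N) => [|k Nk]; last first.
  by apply: big1 => i _; rewrite F0 // subnKC // -ltnS.
rewrite [RHS](@nsumE N) => [|i Ni]; last by apply: nsum0 => j; rewrite F0 //; lia.
transitivity (\sum_(i < N) \sum_(j < N) F i j); last first.
  by apply: eq_bigr => i _; apply/esym/nsumE => j Nj; rewrite F0 //; lia.
have E (m : nat) : \sum_(k < m) \sum_(i < k.+1) F i (k - i)%N =
    \sum_(i < m) \sum_(j < m - i) F i j.
  elim: m => [|m IH]; first by rewrite !big_ord0.
  rewrite big_ord_recr /= IH [in RHS]big_ord_recr /= subSnn big_ord1.
  rewrite big_ord_recr /= subnn addrA -big_split /=; congr (_ + _).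
  apply: eq_bigr => i _; rewrite subSn; last exact: ltnW.
  by rewrite big_ord_recr.
rewrite E; apply: eq_bigr => i _.
rewrite -!(big_mkord xpredT (F i)) [RHS](@big_cat_nat _ _ _ (N - i)) ?leq_subr //=.
rewrite [X in _ + X]big_nat_cond [X in _ + X]big1 ?addr0 // => j.
by rewrite andbT => /andP[h _]; apply: F0; lia.
Qed.

End InfiniteSums.

Section InfiniteLinear.
Variables (K : numFieldType) (U W : lmodType K).

Lemma nsumZ c (f : nat -> U) : evz f -> nsum (fun i => c *: f i) = c *: nsum f.
Proof.
move=> [N f0]; rewrite !(@nsumE _ N) ?scaler_sumr // => i Ni.
by rewrite f0 ?scaler0.
Qed.

Lemma evzZ (c : nat -> K) (f : nat -> U) : evz f -> evz (fun i => c i *: f i).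
Proof. by move=> [N f0]; exists N => i Ni; rewrite f0 ?scaler0. Qed.

Lemma nsumP c (f h : nat -> U) : evz f -> evz h ->
  nsum (fun i => c *: f i + h i) = c *: nsum f + nsum h.
Proof.
move=> f0 h0; rewrite -nsumZ //; apply: nsum_add => //.
exact: (@evzZ (fun _ => c)).
Qed.

Lemma linear_nsum (L : U -> W) (f : nat -> U) :
  linear L -> evz f -> L (nsum f) = nsum (fun i => L (f i)).
Proof.
move=> Ll [N f0]; rewrite !(@nsumE _ N) ?(linear_sumr Ll) // => i Ni.
by rewrite f0 ?(linear_0 Ll).
Qed.

(** Generating functions multiply: (1 - x)^a (1 - x)^b = (1 - x)^{a+b} for c = sbin,
    and similarly for c = fbin, both covered by the hypothesis on c. *)
Lemma nsum_vandermonde (c : K -> nat -> K) a b (X : nat -> U) :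
  (forall k, \sum_(i < k.+1) c a i * c b (k - i)%N = c (a + b) k) ->
  evz X ->
  nsum (fun i => nsum (fun j => (c a i * c b j) *: X (i + j)%N)) =
  nsum (fun k => c (a + b) k *: X k).
Proof.
move=> cD [N X0]; rewrite -(@nsum_antidiag _ N) => [|i j Nij]; last first.
  by rewrite X0 ?scaler0.
apply: eq_nsum => k; rewrite -cD scaler_suml; apply: eq_bigr => i _.
by rewrite subnKC // -ltnS.
Qed.

Lemma sum_vandermonde (c : K -> nat -> K) a b n (F : nat -> U) :
  (forall k, \sum_(i < k.+1) c a i * c b (k - i)%N = c (a + b) k) ->
  \sum_(i < n.+1) \sum_(j < (n - i).+1) (c a i * c b j) *: F (i + j)%N =
  \sum_(k < n.+1) c (a + b) k *: F k.
Proof.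
move=> cD.
transitivity (\sum_(i < n.+1) \sum_(k < n.+1 | (i <= k)%N)
   (c a i * c b (k - i)%N) *: F k).
  apply: eq_bigr => i _.
  rewrite (@big_ord_shift _ i n (fun k => (c a i * c b (k - i)%N) *: F k)).
    by apply: eq_bigr => j _; rewrite addnK addnC.
  by rewrite -ltnS.
rewrite (exchange_big_dep xpredT) //=; apply: eq_bigr => k _.
rewrite -scaler_suml -cD; congr (_ *: _).
rewrite -(big_mkord (fun i => i <= k)%N (fun i => c a i * c b (k - i)%N)).
rewrite (@big_cat_nat _ _ _ k.+1) //= [X in _ + X]big1_seq ?addr0; last first.
  by move=> i; rewrite mem_index_iota => /andP[h /andP[h' _]]; lia.
by rewrite big_mkord; apply: eq_bigl => i; rewrite -ltnS ltn_ord.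
Qed.

End InfiniteLinear.

Section Distributions.
Variables (K : numFieldType) (U : lmodType K).
Implicit Types (G : K -> K -> U) (n c p q : K).

(** (z - w)^n G and (w - z)^n G, over any field of characteristic zero. *)
Definition zwp n G p q : U :=
  nsum (fun i => sbin n i *: G (p + n - i%:R) (q + i%:R)).
Definition wzp n G p q : U :=
  nsum (fun i => sbin n i *: G (p + i%:R) (q + n - i%:R)).

Definition trunc (f : K -> U) :=
  forall n, exists N, forall i : nat, (N <= i)%N -> f (n + i%:R) = 0.

(** Truncation in one variable, uniform in the other. *)
Definition truncr G :=
  forall q, exists N, forall (i : nat) p, (N <= i)%N -> G p (q + i%:R) = 0.
Definition truncl G :=
  forall p, exists N, forall (i : nat) q, (N <= i)%N -> G (p + i%:R) q = 0.

Lemma wzpE n G p q : wzp n G p q = zwp n (fun p q => G q p) q p.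
Proof. by []. Qed.

Lemma zwp_comp n c G p q : truncr G ->
  zwp n (zwp c G) p q = zwp (n + c) G p q.
Proof.
move=> /(_ q) [N G0].
rewrite /zwp -(@nsum_vandermonde _ _ (@sbin K) n c
  (fun k => G (p + (n + c) - k%:R) (q + k%:R))); first last.
- by exists N => i Ni; rewrite G0.
- exact: sbin_vandermonde.
apply: eq_nsum => i; rewrite -nsumZ; last first.
  by exists N => j Nj; rewrite -[q + _ + _]addrA -natrD G0 ?scaler0 //; lia.
apply: eq_nsum => j; rewrite scalerA natrD; congr (_ *: G _ _); ring.
Qed.

Lemma wzp_comp n c G p q : truncl G ->
  wzp n (wzp c G) p q = wzp (n + c) G p q.
Proof. move=> h; rewrite wzpE; exact: (@zwp_comp n c (fun p q => G q p)). Qed.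

Lemma zwp_evz n G p q : truncr G ->
  evz (fun i => sbin n i *: G (p + n - i%:R) (q + i%:R)).
Proof. by move=> /(_ q) [N G0]; exists N => i Ni; rewrite G0 ?scaler0. Qed.

Lemma wzp_evz n G p q : truncl G ->
  evz (fun i => sbin n i *: G (p + i%:R) (q + n - i%:R)).
Proof. by move=> /(_ p) [N G0]; exists N => i Ni; rewrite G0 ?scaler0. Qed.

End Distributions.

(** * The polynomial ring in infinitely many variables *)

(** Sorted sequences index the monomials; their free module is the polynomial ring. *)
Definition part := {s : seq nat | sorted leq s}.
HB.instance Definition _ := Choice.on part.

Definition mkpart (s : seq nat) : part := exist _ (sort leq s) (sort_sorted leq_total s).

Lemma mkpart_perm s s' : perm_eq s s' -> mkpart s = mkpart s'.
Proof.
move=> ss'; apply: val_inj => /=.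
by apply/perm_sortP => //; [exact: leq_total|exact: leq_trans|exact: anti_leq].
Qed.

Lemma mkpart_val (k : part) : mkpart (val k) = k.
Proof. by apply: val_inj => /=; apply: sorted_sort (valP k); exact: leq_trans. Qed.

Section LinearClosure.
Variable K : numFieldType.

(** Statements about vectors are proved on a spanning set, and this is the
    condition that lets them pass to linear combinations. *)
Definition lclosed (U : lmodType K) (P : U -> Prop) :=
  P 0 /\ forall c x y, P x -> P y -> P (c *: x + y).

Lemma lclosed_sum (U : lmodType K) (P : U -> Prop) I (r : seq I) (c : I -> K)
    (F : I -> U) :
  lclosed P -> (forall i, P (F i)) -> P (\sum_(i <- r) c i *: F i).
Proof.
move=> [P0 PD] PF; elim: r => [|i r IH]; first by rewrite big_nil.
by rewrite big_cons; apply: PD.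
Qed.

Lemma lclosedD (U : lmodType K) (P : U -> Prop) x y :
  lclosed P -> P x -> P y -> P (x + y).
Proof. by move=> [_ PD] Px Py; rewrite -[x]scale1r; apply: PD. Qed.

Lemma lclosedZ (U : lmodType K) (P : U -> Prop) c x :
  lclosed P -> P x -> P (c *: x).
Proof. by move=> [P0 PD] Px; rewrite -[_ *: _]addr0; apply: PD. Qed.

Lemma lclosed_bigsum (U : lmodType K) (P : U -> Prop) I (r : seq I) (Q : pred I)
    (F : I -> U) :
  lclosed P -> (forall i, Q i -> P (F i)) -> P (\sum_(i <- r | Q i) F i).
Proof.
move=> lP PF; elim/big_ind: _ => //; first by case: lP.
by move=> x y; apply: lclosedD.
Qed.

Lemma lclosed_nsum (U : lmodType K) (P : U -> Prop) (F : nat -> U) :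
  lclosed P -> evz F -> (forall i, P (F i)) -> P (nsum F).
Proof. by move=> lP [N F0] PF; rewrite (nsumE F0); apply: lclosed_bigsum. Qed.

End LinearClosure.

Section FockConstruction.
Variable K : numFieldType.
Local Notation fock := {malg K[part]}.

Definition malg_mon (s : seq nat) : fock := mkmalgU (mkpart s) 1.

Lemma malg_monE (x : fock) : x = \sum_(k <- msupp x) x@_k *: malg_mon (val k).
Proof.
rewrite {1}[x]monalgE; apply: eq_bigr => k _; rewrite /malg_mon mkpart_val.
by apply/malgP => k'; rewrite mcoeffZ !mcoeffU mulrnAr mulr1.
Qed.

Variables (U : lmodType K) (h : seq nat -> U).

Definition malg_ext (x : fock) : U := \sum_(k <- msupp x) x@_k *: h (val k).

Lemma malg_extEw (d : {fset part}) (x : fock) : (msupp x `<=` d)%fset ->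
  malg_ext x = \sum_(k <- d) x@_k *: h (val k).
Proof.
move=> xd; rewrite /malg_ext (big_fset_incl _ xd) // => k _ kx.
by rewrite mcoeff_outdom ?scale0r.
Qed.

Lemma malg_ext_is_linear : linear malg_ext.
Proof.
move=> c x y; pose d := (msupp (c *: x + y) `|` msupp x `|` msupp y)%fset.
rewrite !(@malg_extEw d) /d ?fsubsetUr //; first last.
- by rewrite -fsetUA fsubsetUl.
- by rewrite [X in (X `|` _)%fset]fsetUC -fsetUA fsubsetUl.
rewrite scaler_sumr -big_split /=; apply: eq_bigr => k _.
by rewrite mcoeffD mcoeffZ scalerDl scalerA.
Qed.

Lemma malg_ext_sorted s : sorted leq s -> malg_ext (malg_mon s) = h s.
Proof.
move=> ss; rewrite /malg_ext /malg_mon msuppU oner_eq0 big_seq_fset1 mcoeffUU.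
by rewrite scale1r /= sorted_sort //; exact: leq_trans.
Qed.

End FockConstruction.

(** The polynomials in variables t_0, t_1, ...: [fmon s] is the product of the
   t_a for a in s, and the sorted monomials form a basis. *)
Record fock_space (K : numFieldType) := FockSpace {
  fock_sort :> lmodType K;
  fmon : seq nat -> fock_sort;
  flinext : forall U : lmodType K, (seq nat -> U) -> fock_sort -> U;
  fmon_perm : forall s s', perm_eq s s' -> fmon s = fmon s';
  fmon_ind : forall P : fock_sort -> Prop,
    lclosed P -> (forall s, P (fmon s)) -> forall x, P x;
  flinext_linear : forall (U : lmodType K) (h : seq nat -> U), linear (flinext h);
  flinext_sorted : forall (U : lmodType K) (h : seq nat -> U) s,
    sorted leq s -> flinext h (fmon s) = h s
}.

(** Closed with Qed: from here on the ring is known only by its universal property. *)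
Definition fock_model (K : numFieldType) : fock_space K.
Proof.
apply: (@FockSpace K {malg K[part]} (malg_mon K) (@malg_ext K)).
- by move=> s s' ss'; rewrite /malg_mon (mkpart_perm ss').
- by move=> P lP Pm x; rewrite [x]malg_monE; apply: lclosed_sum.
- exact: malg_ext_is_linear.
- exact: malg_ext_sorted.
Qed.

Section Fock.
Variable K : numFieldType.

Definition fock : lmodType K := fock_model K.
Definition mon (s : seq nat) : fock := fmon (fock_model K) s.
(** Linear extension of a function on monomials; only its values on sorted sequences
    count, so it agrees with h on all of them when h is symmetric (linext_mon). *)
Definition linext (U : lmodType K) (h : seq nat -> U) : fock -> U := flinext h.
HB.instance Definition _ (U : lmodType K) (h : seq nat -> U) :=
  GRing.isLinear.Build K fock U _ (linext h) (flinext_linear h).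

Lemma mon_perm s s' : perm_eq s s' -> mon s = mon s'.
Proof. exact: fmon_perm. Qed.

Lemma fock_ind (P : fock -> Prop) : lclosed P -> (forall s, P (mon s)) -> forall x, P x.
Proof. exact: fmon_ind. Qed.

Lemma linext_sorted (U : lmodType K) (h : seq nat -> U) s :
  sorted leq s -> linext h (mon s) = h s.
Proof. exact: flinext_sorted. Qed.

Lemma linext_mon (U : lmodType K) (h : seq nat -> U) s :
  (forall s s', perm_eq s s' -> h s = h s') -> linext h (mon s) = h s.
Proof.
move=> hp; rewrite (@mon_perm s (sort leq s)); last by rewrite perm_sym perm_sort.
rewrite linext_sorted; last exact/sort_sorted/leq_total.
by apply: hp; rewrite perm_sort.
Qed.

(** Creation operators: multiplication by the variable t_a. *)
Definition cre (a : nat) : fock -> fock := linext (fun s => mon (a :: s)).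
HB.instance Definition _ a := GRing.Linear.on (cre a).

Lemma cre_mon a s : cre a (mon s) = mon (a :: s).
Proof.
apply: linext_mon => s1 s2 h; apply: mon_perm; by rewrite perm_cons.
Qed.

Lemma creC a b x : cre a (cre b x) = cre b (cre a x).
Proof.
move: x; apply: fock_ind => [|s].
  split=> [|c x y hx hy]; first by rewrite !linear0.
  by rewrite !linearP /= hx hy.
rewrite !cre_mon; apply: mon_perm.
by rewrite -cat1s -[in X in perm_eq _ X]cat1s -!(cat1s _ s) perm_catCA.
Qed.

(** Adjacent transpositions generate the permutations: move the head of s' to the
    front of s. *)
Lemma perm_cons_ind (U : Type) (h : seq nat -> U) :
  (forall a s s', h s = h s' -> perm_eq s s' -> h (a :: s) = h (a :: s')) ->
  (forall a b s, h [:: a, b & s] = h [:: b, a & s]) ->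
  forall s s', perm_eq s s' -> h s = h s'.
Proof.
move=> hc hs s; have [n] := ubnP (size s); elim: n s => // n IH [|a s] /= sn s'.
  by rewrite perm_sym => /perm_nilP ->.
rewrite ltnS in sn.
case: s' => [|b s']; first by move=> /perm_nilP.
have [->|ab] := eqVneq a b.
  by rewrite perm_cons => ss'; apply: hc => //; apply: IH.
move=> ss'.
have bs : b \in s.
  by have := perm_mem ss' b; rewrite !inE eqxx /= eq_sym (negPf ab).
have sb := perm_to_rem bs.
have ssz := perm_size ss'.
have s'a : perm_eq s' (a :: rem b s).
  rewrite -(perm_cons b) perm_sym.
  apply: (perm_trans _ ss').
  by rewrite -(cat1s b) -(cat1s a) perm_catCA /= perm_cons perm_sym.
have e1 : h (a :: s) = h [:: a, b & rem b s] by apply: hc => //; apply: IH.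
have e2 : h (b :: s') = h [:: b, a & rem b s].
  apply: hc => //; apply: IH => //.
  by move: ssz => /= [<-].
by rewrite e1 e2 hs.
Qed.

(** Maps out of the polynomial ring defined one variable at a time: O a x y is the
    value at t_a x in terms of x and the value y at x.  The exchange condition OC
    makes this independent of the order of the variables.  It bears on the values
    satisfying P, since the fields to which it is applied commute thanks to their
    truncation. *)
Section Recursion.
Variables (U : lmodType K) (u0 : U) (O : nat -> fock -> U -> U) (P : U -> Prop).

Fixpoint frec_seq (s : seq nat) : U :=
  if s is a :: s' then O a (mon s') (frec_seq s') else u0.
Definition frec (x : fock) : U := linext frec_seq x.
HB.instance Definition _ :=
  GRing.isLinear.Build K fock U _ frec (flinext_linear frec_seq).

Hypotheses (Pl : lclosed P) (P0 : P u0)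
  (PO : forall a x y, P y -> P (O a x y))
  (Ol : forall a c x x' y y', P y -> P y' ->
     O a (c *: x + x') (c *: y + y') = c *: O a x y + O a x' y')
  (OC : forall a b x y, P y -> O a (cre b x) (O b x y) = O b (cre a x) (O a x y)).

Let P_seq s : P (frec_seq s).
Proof. by elim: s => //= a s IH; apply: PO. Qed.

Let frec_perm s s' : perm_eq s s' -> frec_seq s = frec_seq s'.
Proof.
apply: perm_cons_ind => [a s1 s2 /= -> /mon_perm -> //|a b s1 /=].
by rewrite -!cre_mon OC.
Qed.

Lemma frec_closed x : P (frec x).
Proof.
move: x; apply: fock_ind => [|s]; last by rewrite /frec linext_mon.
split=> [|c x y hx hy]; first by rewrite linear0; case: Pl.
by rewrite linearP; apply: Pl.2.
Qed.

Lemma frec_nil : frec (mon [::]) = u0.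
Proof. by rewrite /frec linext_sorted. Qed.

Lemma frec_cre a x : frec (cre a x) = O a x (frec x).
Proof.
move: x; apply: fock_ind => [|s]; last first.
  by rewrite cre_mon /frec !linext_mon.
have O0 : O a 0 0 = 0.
  have := @Ol a 1 0 0 0 0 Pl.1 Pl.1; rewrite !scaler0 !addr0 scale1r => h.
  by apply: (@addrI _ (O a 0 0)); rewrite -h addr0.
split=> [|c x y hx hy]; first by rewrite !linear0.
by rewrite !linearP /= hx hy Ol //; exact: frec_closed.
Qed.

End Recursion.
End Fock.

(** * Lowering modes and the derivation *)

Section Gradings.
Variable K : numFieldType.
Local Notation fock := (fock K).
Implicit Types (x y : fock) (Q : pred (seq nat)).

(** A record rather than a bare product, so that unification does not unfold it. *)
Record supported Q x : Prop := Supported { supported_ind :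
  forall P : fock -> Prop, lclosed P -> (forall s, Q s -> P (mon K s)) -> P x }.

Lemma supported_lclosed Q : lclosed (supported Q).
Proof.
split=> [|c x y xQ yQ]; split=> P lP PQ; first by case: lP.
by apply: lP.2; [apply: (supported_ind xQ)|apply: (supported_ind yQ)].
Qed.

Lemma supported_mon Q s : Q s -> supported Q (mon K s).
Proof. by move=> Qs; split=> P _; apply. Qed.

(** The projection onto the monomials in Q, for Q invariant under permutations. *)
Definition proj Q : fock -> fock := linext (fun s => if Q s then mon K s else 0).
HB.instance Definition _ Q := GRing.Linear.on (proj Q).

Lemma proj_mon Q s : (forall s s', perm_eq s s' -> Q s = Q s') ->
  proj Q (mon K s) = if Q s then mon K s else 0.
Proof.
move=> Qp; rewrite /proj linext_mon // => s1 s2 h.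
by rewrite (Qp _ _ h) (mon_perm _ h).
Qed.

Definition fdeg (r : nat) x := supported (fun s => size s == r) x.

Lemma fdeg_lclosed r : lclosed (fdeg r). Proof. exact: supported_lclosed. Qed.

Lemma fdeg_mon s : fdeg (size s) (mon K s).
Proof. by apply: supported_mon. Qed.

Lemma fdeg0 r : fdeg r 0. Proof. by case: (fdeg_lclosed r). Qed.

Lemma fdeg_ind r (P : fock -> Prop) : lclosed P ->
  (forall s, size s = r -> P (mon K s)) -> forall x, fdeg r x -> P x.
Proof. by move=> lP Pm x [h]; apply: h => // s /eqP; apply: Pm. Qed.

Lemma fdeg_linear (L : fock -> fock) r r' : linear L ->
  (forall s, size s = r -> fdeg r' (L (mon K s))) ->
  forall x, fdeg r x -> fdeg r' (L x).
Proof.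
move=> Ll; apply: fdeg_ind; split=> [|c x y hx hy].
  by rewrite (linear_0 Ll); apply: fdeg0.
by rewrite Ll; apply: (fdeg_lclosed r').2.
Qed.

Lemma fdeg_cre r a x : fdeg r x -> fdeg r.+1 (cre a x).
Proof.
apply: fdeg_linear => [|s <-]; first exact: linearP.
by rewrite cre_mon; exact: (fdeg_mon (a :: s)).
Qed.

Lemma fdeg_bigsum r I (s : seq I) (P : pred I) (F : I -> fock) :
  (forall i, fdeg r (F i)) -> fdeg r (\sum_(i <- s | P i) F i).
Proof. by move=> h; exact: (@lclosed_bigsum K _ _ I s P F (fdeg_lclosed r) (fun i _ => h i)). Qed.

Lemma fdegZ r c x : fdeg r x -> fdeg r (c *: x).
Proof. by move=> h; apply: (lclosedZ c (fdeg_lclosed r) h). Qed.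

Lemma fdegD r x y : fdeg r x -> fdeg r y -> fdeg r (x + y).
Proof. by move=> h1 h2; apply: (lclosedD (fdeg_lclosed r) h1 h2). Qed.

End Gradings.

Section Lowering.
Variable K : numFieldType.
Local Notation fock := (fock K).
Implicit Types (x y : fock).

(** The variable t_{a-i}, with t_b = 0 for b < 0: multiplying t(x) by x^i shifts
    the indices of its coefficients. *)
Definition low (a i : nat) x : fock := if (i <= a)%N then cre (a - i) x else 0.
Fact low_is_linear a i : linear (low a i).
Proof. by move=> c x y; rewrite /low; case: ifP; rewrite ?scaler0 ?addr0 // linearP. Qed.
HB.instance Definition _ a i :=
  GRing.isLinear.Build K fock fock _ (low a i) (low_is_linear a i).

Lemma low0 a x : low a 0 x = cre a x. Proof. by rewrite /low subn0. Qed.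

Lemma low_cre a i b x : low a i (cre b x) = cre b (low a i x).
Proof. by rewrite /low; case: ifP => _; rewrite ?linear0 // creC. Qed.

Lemma lowC a i b j x : low a i (low b j x) = low b j (low a i x).
Proof.
have [jb|jb] := boolP (j <= b)%N; first by rewrite /(low b j) jb low_cre.
by rewrite /(low b j) (negPf jb) linear0.
Qed.

Lemma fdeg_low r a i x : fdeg r x -> fdeg r.+1 (low a i x).
Proof. by rewrite /low; case: ifP => _ h; [apply: fdeg_cre|apply: fdeg0]. Qed.

Section Annihilation.
Variable c : K.

Definition ann_step (a : nat) (_ : fock) (f : nat -> fock) : nat -> fock :=
  fun k => \sum_(i < k.+1) sbin c i *: low a i (f (k - i)%N).

Definition ann_init : nat -> fock := fun k => if k == 0%N then mon K [::] else 0.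

(** The modes of the algebra endomorphism E^c(z) = sum_k E^c_k z^{-k} with
    E^c(z) t(x) = (1 - x/z)^c t(x). *)
Definition ann (k : nat) (x : fock) : fock := frec ann_init ann_step x k.

Fact ann_is_linear k : linear (ann k).
Proof. by move=> d x y; rewrite /ann linearP. Qed.
HB.instance Definition _ k :=
  GRing.isLinear.Build K fock fock _ (ann k) (ann_is_linear k).

Lemma ann_nil k : ann k (mon K [::]) = if k == 0%N then mon K [::] else 0.
Proof. by rewrite /ann frec_nil. Qed.

Lemma ann_cre k a x :
  ann k (cre a x) = \sum_(i < k.+1) sbin c i *: low a i (ann (k - i) x).
Proof.
rewrite /ann (@frec_cre K (nat -> fock) ann_init ann_step (fun _ => True)); first by [].
- by split.
- by [].
- by [].
- move=> b d x1 x2 f1 f2 _ _; apply/funext => n.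
  transitivity (d *: ann_step b x1 f1 n + ann_step b x2 f2 n) => [|//].
  rewrite /ann_step scaler_sumr -big_split; apply: eq_bigr => i _ /=.
  transitivity (sbin c i *: low b i (d *: f1 (n - i)%N + f2 (n - i)%N)) => [//|].
  by rewrite linearP scalerDr !scalerA mulrC.
- move=> a1 a2 z f _; apply/funext => n; rewrite /ann_step.
  have E b1 b2 : \sum_(i < n.+1) sbin c i *: low b1 i
      (\sum_(j < (n - i).+1) sbin c j *: low b2 j (f (n - i - j)%N)) =
    \sum_(i < n.+1) \sum_(j < n.+1) (if (i + j <= n)%N then
      (sbin c i * sbin c j) *: low b1 i (low b2 j (f (n - (i + j))%N)) else 0).
    apply: eq_bigr => i _; rewrite linear_sum scaler_sumr /=.
    have hi : (n - i < n.+1)%N by lia.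
    rewrite (big_ord_widen _ (fun j => sbin c i *: low b1 i (sbin c j *:
       low b2 j (f (n - i - j)%N))) hi) big_mkcond /=; apply: eq_bigr => j _.
    have -> : (j < (n - i).+1)%N = (i + j <= n)%N by have := ltn_ord i; lia.
    by case: ifP => // _; rewrite linearZ /= scalerA subnDA.
  rewrite !E exchange_big /=; apply: eq_bigr => i _; apply: eq_bigr => j _.
  by rewrite addnC mulrC lowC.
Qed.

Lemma ann_cre0 k x : ann k (cre 0 x) = cre 0 (ann k x).
Proof.
rewrite ann_cre big_ord_recl big1 => [|i _]; last by rewrite /low /= scaler0.
by rewrite addr0 sbin0 scale1r low0 subn0.
Qed.

Lemma fdeg_ann k r x : fdeg r x -> fdeg r (ann k x).
Proof.
move: x; apply: fdeg_linear => [|s <-]; first exact: linearP.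
elim: s k => [|a s IH] k.
  by rewrite ann_nil; case: ifP => _; [apply: fdeg_mon|apply: fdeg0].
rewrite -cre_mon ann_cre; apply: fdeg_bigsum => i.
by apply/fdegZ/fdeg_low/IH.
Qed.

Lemma ann_low k a j x :
  ann k (low a j x) = \sum_(i < k.+1) sbin c i *: low a (j + i) (ann (k - i) x).
Proof.
rewrite {1}/low; case: ifP => ja; last first.
  rewrite linear0 big1 // => i _; rewrite /low ifF ?scaler0 //; lia.
rewrite ann_cre; apply: eq_bigr => i _; congr (_ *: _).
rewrite /low; have -> : (i <= a - j)%N = (j + i <= a)%N by lia.
by rewrite subnDA.
Qed.

Lemma ann_id x : ann 0 x = x.
Proof.
move: x; apply: fock_ind => [|s].
  by split=> [|d x y hx hy]; rewrite ?linear0 // linearP /= hx hy.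
elim: s => [|a s IH]; first by rewrite ann_nil.
by rewrite -cre_mon ann_cre big_ord1 subnn IH sbin0 scale1r low0.
Qed.

End Annihilation.

(** Uniform in c, since the number of modes that can act on a polynomial is
    bounded by its weight. *)
Definition annle N x := forall c k, (N <= k)%N -> ann c k x = 0.

Lemma annle_leq N M x : (N <= M)%N -> annle N x -> annle M x.
Proof. move=> NM h c k Mk; apply: h; lia. Qed.

Lemma annle_cre N a x : annle N x -> annle (N + a) (cre a x).
Proof.
move=> h c k Nk; rewrite ann_cre big1 // => i _; rewrite /low.
case: ifP => ia; rewrite ?scaler0 // h ?linear0 ?scaler0 //.
have := ltn_ord i; lia.
Qed.

Lemma annle_ex x : exists N, annle N x.
Proof.
move: x; apply: fock_ind => [|s].
  split=> [|d x y [N hx] [M hy]]; first by exists 0%N => c k _; rewrite linear0.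
  by exists (N + M)%N => c k h; rewrite linearP /= hx ?hy ?scaler0 ?addr0 //; lia.
elim: s => [|a s [N IH]].
  by exists 1%N => c [|k] // _; rewrite ann_nil.
by exists (N + a)%N; rewrite -cre_mon; apply: annle_cre.
Qed.

(** Both orders give the algebra endomorphism multiplying t(x) by a product of two
    scalar series. *)
Lemma annC c d i j x : ann c i (ann d j x) = ann d j (ann c i x).
Proof.
move: x; apply: fock_ind => [|s].
  by split=> [|e x y hx hy]; rewrite ?linear0 // !linearP /= hx hy.
elim: s i j => [|a s IH] i j.
  by rewrite !ann_nil; case: i j => [|i] [|j] /=; rewrite ?linear0 ?ann_nil.
rewrite -cre_mon !ann_cre !linear_sum /=.
transitivity (\sum_(k < j.+1) \sum_(l < i.+1) (sbin d k * sbin c l) *: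
    low a (k + l) (ann c (i - l) (ann d (j - k) (mon K s)))).
  apply: eq_bigr => k _; rewrite linearZ /= ann_low scaler_sumr.
  by apply: eq_bigr => l _; rewrite scalerA.
rewrite exchange_big /=; apply: eq_bigr => l _; rewrite linearZ /= ann_low scaler_sumr.
by apply: eq_bigr => k _; rewrite scalerA mulrC addnC IH.
Qed.

Lemma annle_ann N c k x : annle N x -> annle N (ann c k x).
Proof. by move=> h d j Nj; rewrite annC h ?linear0. Qed.

Section Generating.
Variables (U : lmodType K).
Implicit Type Phi : nat -> fock -> U.

Lemma ann_evz c x Phi : (forall k, linear (Phi k)) -> evz (fun k => Phi k (ann c k x)).
Proof.
move=> Pl; have [N h] := annle_ex x.
by exists N => k Nk; rewrite h ?(linear_0 (Pl k)).
Qed.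

(** The rule E^c(z) t(x) = (1 - x/z)^c t(x) E^c(z), tested against an arbitrary
    linear function Phi of the modes; in this form it is used under the infinite sums
    of the vertex operators. *)
Lemma nsum_ann_cre c a x Phi : (forall k, linear (Phi k)) ->
  nsum (fun k => Phi k (ann c k (cre a x))) =
  \sum_(i < a.+1) sbin c i *: nsum (fun k => Phi (k + i)%N (cre (a - i) (ann c k x))).
Proof.
move=> Pl; have [N h] := annle_ex x.
transitivity (nsum (fun k => \sum_(i < k.+1) sbin c i *: Phi (k - i + i)%N
    (low a i (ann c (k - i) x)))).
  apply: eq_nsum => k; rewrite ann_cre (linear_sumr (Pl k)).
  by apply: eq_bigr => i _; rewrite (linear_Z (Pl k)) subnK // -ltnS.
rewrite (@nsum_antidiag _ (N + a.+1) (fun i j =>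
  sbin c i *: Phi (j + i)%N (low a i (ann c j x)))); last first.
  move=> i j Nij; case: (leqP i a) => ia.
    by rewrite h ?linear0 ?(linear_0 (Pl _)) ?scaler0 //; lia.
  by rewrite /low leqNgt ia /= (linear_0 (Pl _)) scaler0.
rewrite (@nsumE _ a.+1) => [|i ai]; last first.
  by apply: nsum0 => j; rewrite /low leqNgt ai /= (linear_0 (Pl _)) scaler0.
apply: eq_bigr => i _; rewrite nsumZ; last first.
  by exists N => j Nj; rewrite h ?linear0 ?(linear_0 (Pl _)).
by congr (_ *: _); apply: eq_nsum => j; rewrite /low -ltnS ltn_ord.
Qed.

(** E^c(z) E^d(z) = E^{c+d}(z), since both are algebra endomorphisms. *)
Lemma nsum_ann_comp c d x Phi : (forall k, linear (Phi k)) ->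
  nsum (fun i => nsum (fun j => Phi (i + j)%N (ann c i (ann d j x)))) =
  nsum (fun k => Phi k (ann (c + d) k x)).
Proof.
move=> Pl; have Pl1 i e : linear (fun y => Phi i (ann c e y)).
  by move=> t y y'; rewrite linearP /= (Pl i).
move: Phi Pl Pl1; pattern x; move: x; apply: fock_ind => [|s].
  split=> [|t x y hx hy] Phi Pl Pl1.
    by rewrite !nsum0 // => i; rewrite ?nsum0 // => *; rewrite !linear0 (linear_0 (Pl _)).
  have lin (g : nat -> fock -> fock) : (forall k, linear (g k)) ->
      forall k, linear (fun y => Phi k (g k y)).
    by move=> gl k t' y1 y2; rewrite gl Pl.
  have [N Nx] := annle_ex x; have [M My] := annle_ex y.
  have fin e z Q : annle Q z -> nsum (fun i => nsum (fun j =>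
      Phi (i + j)%N (ann c i (ann d j z)))) = \sum_(i < Q + e) \sum_(j < Q + e)
      Phi (i + j)%N (ann c i (ann d j z)).
    move=> hz; rewrite (@nsumE _ (Q + e)) => [|i Qi]; last first.
      by apply: nsum0 => j; rewrite (annle_ann _ _ hz) ?(linear_0 (Pl _)) //; lia.
    apply: eq_bigr => i _; apply: nsumE => j Qj.
    by rewrite hz ?linear0 ?(linear_0 (Pl _)) //; lia.
  have fin' e z Q : annle Q z -> nsum (fun k => Phi k (ann (c + d) k z)) =
      \sum_(k < Q + e) Phi k (ann (c + d) k z).
    by move=> hz; apply: nsumE => j Qj; rewrite hz ?(linear_0 (Pl _)) //; lia.
  have Nxy : annle (N + M) (t *: x + y).
    by move=> e k h; rewrite linearP /= Nx ?My ?scaler0 ?addr0 //; lia.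
  have := hx _ Pl Pl1; rewrite (fin M _ _ Nx) (fin' M _ _ Nx) => hx'.
  have := hy _ Pl Pl1; rewrite (fin N _ _ My) (fin' N _ _ My) addnC => hy'.
  rewrite (fin 0%N _ _ Nxy) (fin' 0%N _ _ Nxy) addn0.
  transitivity (t *: \sum_(k < N + M) Phi k (ann (c + d) k x) +
      \sum_(k < N + M) Phi k (ann (c + d) k y)).
    rewrite -hx' -hy' scaler_sumr -big_split; apply: eq_bigr => i _.
    rewrite scaler_sumr -big_split; apply: eq_bigr => j _.
    by rewrite !linearP /= Pl.
  by rewrite scaler_sumr -big_split; apply: eq_bigr => i _; rewrite linearP /= Pl.
elim: s => [|a s IH] Phi Pl Pl1.
  rewrite (@nsum1 _ 0%N) => [|i]; last first.
    move=> /negPf i0; apply: nsum0 => j; rewrite ann_nil; case: ifP => _.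
      by rewrite ann_nil i0 (linear_0 (Pl _)).
    by rewrite linear0 (linear_0 (Pl _)).
  rewrite (@nsum1 _ 0%N) => [|i /negPf i0]; last first.
    by rewrite ann_nil i0 linear0 (linear_0 (Pl _)).
  rewrite [RHS](@nsum1 _ 0%N) => [|i /negPf i0]; last first.
    by rewrite ann_nil i0 (linear_0 (Pl _)).
  by rewrite !ann_nil.
rewrite -cre_mon nsum_ann_cre //; have [N Ns] := annle_ex (mon K s).
transitivity (nsum (fun i => \sum_(j' < a.+1) sbin d j' *: nsum (fun j =>
   Phi (i + j + j')%N (ann c i (cre (a - j') (ann d j (mon K s))))))).
  apply: eq_nsum => i; rewrite (@nsum_ann_cre _ _ _ (fun k y => Phi (i + k)%N (ann c i y))) //.
  by apply: eq_bigr => j' _; congr (_ *: _); apply: eq_nsum => j; rewrite addnA.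
have bnd : forall (i j j' : nat), (N + a <= i)%N ->
    ann c i (cre (a - j') (ann d j (mon K s))) = 0.
  move=> i j j' h; apply: (annle_cre (annle_ann d j Ns)); lia.
rewrite -nsum_exchange_big => [|j']; last first.
  apply: (@evzZ _ _ (fun _ => _)); exists (N + a)%N => i Ni; apply: nsum0 => j.
  by rewrite bnd // (linear_0 (Pl _)).
transitivity (\sum_(j' < a.+1) sbin d j' *: nsum (fun j => \sum_(i' < (a - j').+1)
   sbin c i' *: nsum (fun i => Phi (i + j + (i' + j'))%N
       (cre (a - j' - i') (ann c i (ann d j (mon K s))))))).
  apply: eq_bigr => j' _; rewrite nsumZ; last first.
    exists (N + a)%N => i Ni; apply: nsum0 => j; by rewrite bnd // (linear_0 (Pl _)).
  congr (_ *: _); rewrite (@nsum_exchange _ (N + a)) => [|i j /orP[Ni|Nj]]; last first.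
  - by rewrite Ns ?linear0 ?(linear_0 (Pl _)) //; lia.
  - by rewrite bnd // (linear_0 (Pl _)).
  apply: eq_nsum => j.
  rewrite (@nsum_ann_cre c (a - j') (ann d j (mon K s)) (fun k y => Phi (k + j + j')%N y)) //.
  apply: eq_bigr => i' _; congr (_ *: _); apply: eq_nsum => i; congr (Phi _ _); lia.
transitivity (\sum_(j' < a.+1) \sum_(i' < (a - j').+1) (sbin d j' * sbin c i') *:
   nsum (fun k => Phi (k + (i' + j'))%N (cre (a - j' - i') (ann (c + d) k (mon K s))))).
  apply: eq_bigr => j' _; rewrite -nsum_exchange_big => [|i']; last first.
    apply: (@evzZ _ _ (fun _ => _)); exists N => j Nj; apply: nsum0 => i.
    by rewrite Ns ?linear0 ?(linear_0 (Pl _)).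
  rewrite scaler_sumr; apply: eq_bigr => i' _; rewrite nsumZ; last first.
    by exists N => j Nj; apply: nsum0 => i; rewrite Ns ?linear0 ?(linear_0 (Pl _)).
  rewrite scalerA; congr (_ *: _).
  rewrite -(IH (fun k y => Phi (k + (i' + j'))%N (cre (a - j' - i') y))) //; first last.
  - by move=> k e t y y'; rewrite !linearP /= Pl.
  - by move=> k t y y'; rewrite linearP /= Pl.
  apply: (@nsum_exchange _ N) => i j /orP[h|h].
    by rewrite Ns ?linear0 ?(linear_0 (Pl _)).
  by rewrite (annle_ann _ _ Ns) ?linear0 ?(linear_0 (Pl _)).
pose G n := nsum (fun k => Phi (k + n)%N (cre (a - n) (ann (c + d) k (mon K s)))).
transitivity (\sum_(i < a.+1) sbin (d + c) i *: G i); last by rewrite addrC.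
rewrite -(@sum_vandermonde _ _ (@sbin K)); last exact: sbin_vandermonde.
apply: eq_bigr => j' _; apply: eq_bigr => i' _; rewrite /G; congr (_ *: _).
by apply: eq_nsum => k; rewrite [(i' + j')%N]addnC subnDA.
Qed.

End Generating.

Lemma ann0 k x : ann 0 k x = if k == 0%N then x else 0.
Proof.
move: x; apply: fock_ind => [|s].
  split=> [|d x y hx hy]; first by rewrite linear0; case: ifP.
  by rewrite linearP /= hx hy; case: ifP; rewrite ?scaler0 ?addr0.
elim: s k => [|a s IH] k; first by rewrite ann_nil.
rewrite -cre_mon ann_cre big_ord_recl big1 => [|i _]; last first.
  by rewrite sbin0n scale0r.
by rewrite addr0 sbin0 scale1r subn0 IH low0; case: ifP; rewrite ?linear0.
Qed.

Lemma nsum_ann_inv (U : lmodType K) c x (Phi : nat -> fock -> U) :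
  (forall k, linear (Phi k)) ->
  nsum (fun i => nsum (fun j => Phi (i + j)%N (ann c i (ann (- c) j x)))) = Phi 0%N x.
Proof.
move=> Pl; rewrite nsum_ann_comp // subrr (@nsum1 _ 0%N) ?ann0 // => i /negPf i0.
by rewrite ann0 i0 (linear_0 (Pl _)).
Qed.

Definition tder_step (a : nat) x y : fock := a.+1%:R *: cre a.+1 x + cre a y.
(** The derivation with D t(x) = t'(x), which becomes the translation operator. *)
Definition tder : fock -> fock := frec 0 tder_step.
HB.instance Definition _ := GRing.Linear.on tder.

Lemma tder_nil : tder (mon K [::]) = 0. Proof. exact: frec_nil. Qed.

Lemma tder_cre a x : tder (cre a x) = a.+1%:R *: cre a.+1 x + cre a (tder x).
Proof.
rewrite /tder (@frec_cre K fock 0 tder_step (fun _ => True)); [by []|by split|by []|by []| |] => [b c x1 x2 y1 y2 _ _|b b' y z _].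
  rewrite /tder_step (linearP (cre b.+1)) (linearP (cre b)) /= !scalerDr addrACA.
  by congr (_ + _ + _); rewrite !scalerA mulrC.
rewrite /tder_step !linearD !linearZ /= addrCA; congr (_ + _); first by rewrite creC.
by congr (_ + _); rewrite creC.
Qed.

Lemma fdeg_tder r x : fdeg r x -> fdeg r (tder x).
Proof.
move: x; apply: fdeg_linear => [|s <-]; first exact: linearP.
elim: s => [|a s IH]; first by rewrite tder_nil; apply: fdeg0.
rewrite -cre_mon tder_cre; apply: fdegD.
  by apply/fdegZ/fdeg_cre/fdeg_mon.
exact: fdeg_cre.
Qed.

Lemma tder_low a i x :
  tder (low a i x) = (a.+1%:R - i%:R) *: low a.+1 i x + low a i (tder x).
Proof.
rewrite /low; case: ifP => ia.
  by rewrite tder_cre leqW // -natrB ?leqW // subSn.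
rewrite linear0 addr0; case: ifP => ia'; last by rewrite scaler0.
have -> : i = a.+1 by apply/eqP; rewrite eqn_leq ia' ltnNge ia.
by rewrite subrr scale0r.
Qed.

Lemma low_S a i x : low a.+1 i.+1 x = low a i x. Proof. by []. Qed.

(** In degree r, [D, E^c(z)] = (c r / z + d/dz) E^c(z): both sides obey the Leibniz rule
    relative to E^c(z), and they agree on t(x). *)
Lemma tder_ann c r k x : fdeg r x ->
  tder (ann c k.+1 x) - ann c k.+1 (tder x) = (c * r%:R - k%:R) *: ann c k x.
Proof.
move=> xr; move: x xr k; apply: fdeg_ind => [|s <-].
  split=> [|d x y hx hy] k; first by rewrite !linear0 ?subr0 ?addr0.
  rewrite (linearP (ann c k.+1)) !(linearP tder) (linearP (ann c k)).
  rewrite (linearP (ann c k.+1)) /= opprD addrACA -scalerBr hx hy.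
  by rewrite scalerDr !scalerA mulrC.
elim: s => [|a s IH] k.
  rewrite tder_nil !ann_nil /= !linear0 mulr0 sub0r ?subr0 ?addr0.
  by case: k => [|k] /=; rewrite ?oppr0 ?scale0r ?scaler0.
rewrite -cre_mon tder_cre linearD (linearZ_LR (ann c k.+1)) /= !ann_cre.
rewrite linear_sum /=; set y := mon K s.
transitivity (\sum_(i < k.+2) (- (i%:R * sbin c i) *: low a.+1 i (ann c (k.+1 - i) y) +
   sbin c i *: low a i (tder (ann c (k.+1 - i) y) - ann c (k.+1 - i) (tder y)))).
  rewrite scaler_sumr -big_split -sumrB; apply: eq_bigr => i _ /=.
  rewrite (linearZ_LR tder) /= tder_low linearB /=.
  rewrite scalerBr scalerDr opprD addrACA; congr (_ + _).
  by rewrite !scalerA -scalerBl; congr (_ *: _); ring.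
rewrite big_split /= big_ord_recl /= mul0r oppr0 scale0r add0r.
rewrite [X in _ + X]big_ord_recr /= subnn !ann_id subrr linear0 scaler0 addr0.
rewrite -big_split scaler_sumr; apply: eq_bigr => i _ /=.
have ik : (i <= k)%N by rewrite -ltnS.
rewrite /y (subSn ik) IH (linearZ_LR (low a i)) /= !scalerA.
rewrite /bump leq0n add1n subSS low_S -scalerDl; congr (_ *: _).
rewrite sbinS natrB //=; ring.
Qed.

Lemma ann_tder c r k x : fdeg r x ->
  ann c k.+1 (tder x) = tder (ann c k.+1 x) - (c * r%:R - k%:R) *: ann c k x.
Proof. by move=> xr; rewrite -(tder_ann c k xr) opprB addrC subrK. Qed.

(** The polynomials are generated from 1 by multiplication by t_0 and D, because
    D raises t_a to (a+1) t_{a+1}.  The defining formulas of the vertex operators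
    are simplest for these two operations, so the main identities are proved by this
    induction. *)
Lemma fock_t0D_ind (Q : nat -> fock -> Prop) :
  (forall r, lclosed (Q r)) -> Q 0%N (mon K [::]) ->
  (forall r x, fdeg r x -> Q r x -> Q r.+1 (cre 0 x)) ->
  (forall r x, fdeg r x -> Q r x -> Q r (tder x)) ->
  forall r x, fdeg r x -> Q r x.
Proof.
move=> Ql Q1 Q0 QD.
elim=> [|r IH]; first by apply: fdeg_ind => // s /size0nil ->.
suff H a x : fdeg r x -> Q r.+1 (cre a x).
  apply: fdeg_ind => // -[//|a s] /= [sr].
  by rewrite -cre_mon; apply: H; rewrite -sr; apply: fdeg_mon.
elim: a x => [|a IHa] x xr; first by apply: Q0 => //; apply: IH.
have -> : cre a.+1 x = a.+1%:R^-1 *: ((-1) *: cre a (tder x) + tder (cre a x)).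
  rewrite tder_cre addrCA scaleN1r addNr addr0 scalerA mulVf ?scale1r //.
  by rewrite pnatr_eq0.
apply: (lclosedZ _ (Ql r.+1)); apply: (Ql r.+1).2.
  by apply: IHa; apply: fdeg_tder.
by apply: QD; [apply: fdeg_cre|apply: IHa].
Qed.
End Lowering.

(** * Vertex operators on polynomials *)

Lemma nsum2E (U : zmodType) N (F : nat -> nat -> U) :
  (forall k l, (N <= k)%N || (N <= l)%N -> F k l = 0) ->
  nsum (fun k => nsum (F k)) = \sum_(k < N) \sum_(l < N) F k l.
Proof.
move=> F0; rewrite (@nsumE _ N) => [|k Nk]; last first.
  by apply: nsum0 => l; rewrite F0 ?Nk.
by apply: eq_bigr => k _; apply: nsumE => l Nl; rewrite F0 ?Nl ?orbT.
Qed.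

Lemma common_bound (P : nat -> nat -> Prop) :
  (forall k, exists N, forall m, (N <= m)%N -> P k m) ->
  forall M, exists N, forall k m, (k < M)%N -> (N <= m)%N -> P k m.
Proof.
move=> h; elim=> [|M [N IH]]; first by exists 0%N.
have [N' hN'] := h M; exists (N + N')%N => k m; rewrite ltnS leq_eqVlt.
by case/predU1P => [->|kM] Nm; [apply: hN'|apply: IH]; lia.
Qed.

Section Fields.
Variables (K : numFieldType) (g : K).
Local Notation fock := (fock K).
Implicit Types (x y u v : fock) (A : K -> fock -> fock) (mu n : K).

(** The values of the recursion defining the vertex operators: their truncation makes
    the sums finite, and so the defining step commutative. *)
Definition is_field A :=
  (forall n, linear (A n)) /\ (forall x, trunc (fun n => A n x)).

Lemma is_field_lclosed : lclosed is_field.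
Proof.
split=> [|c A B [Al At] [Bl Bt]].
  split=> [n d x y|x n]; first by rewrite scaler0 addr0.
  by exists 0%N.
split=> [n d x y|x n].
  transitivity (c *: A n (d *: x + y) + B n (d *: x + y)) => //.
  transitivity (d *: (c *: A n x + B n x) + (c *: A n y + B n y)) => [|//].
  by rewrite Al Bl !scalerDr !scalerA [c * d]mulrC addrACA.
have [N hN] := At x n; have [M hM] := Bt x n; exists (N + M)%N => i h.
transitivity (c *: A (n + i%:R) x + B (n + i%:R) x) => //.
by rewrite hN ?hM ?scaler0 ?addr0 //; lia.
Qed.

Lemma is_field_bound A n x : is_field A -> exists N, forall k m : nat,
  (N <= k)%N || (N <= m)%N -> A (n + m%:R - k%:R) (ann g k x) = 0.
Proof.
move=> [Al At]; have [M hM] := annle_ex x.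
have hk k : exists N, forall m : nat, (N <= m)%N -> A (n + m%:R - k%:R) (ann g k x) = 0.
  have [N hN] := At (ann g k x) (n - k%:R); exists N => m Nm.
  by rewrite addrAC hN.
have [N hN] := common_bound hk M; exists (M + N)%N => k m h.
have [kM|kM] := ltnP k M; first by apply: hN => //; lia.
by rewrite hM // (linear_0 (Al _)).
Qed.

Lemma is_field_bound2 A n x : is_field A -> exists N, forall k k' m : nat,
  [|| (N <= k)%N, (N <= k')%N | (N <= m)%N] ->
  A (n + m%:R - k%:R - k'%:R) (ann g k' (ann g k x)) = 0.
Proof.
move=> fA; have [M hM] := annle_ex x.
have hk k : exists N, forall m : nat, (N <= m)%N -> forall k',
    A (n + m%:R - k%:R - k'%:R) (ann g k' (ann g k x)) = 0.
  have [N hN] := is_field_bound (n - k%:R) (ann g k x) fA; exists N => m Nm k'.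
  by rewrite -[RHS](hN k' m) ?Nm ?orbT //; congr (A _ _); ring.
have [N hN] := common_bound hk M; exists (M + N)%N => k k' m h.
have [kM|kM] := ltnP k M; last by rewrite hM // linear0 (linear_0 (fA.1 _)).
have [kM'|kM'] := ltnP k' M; last first.
  by rewrite (annle_ann g k hM) // (linear_0 (fA.1 _)).
by apply: hN => //; lia.
Qed.

Section Step.
Variable mu : K.

(** The normally ordered product of A(z) with the field of t_a: the a-th divided
    derivative of z^mu t(z) E^g(z), with t(z) placed to the left of A(z) and E^g(z)
    to the right.  The binomial comes from differentiating z^{mu+l-k}. *)
Definition fld_step (a : nat) (_ : fock) A : K -> fock -> fock := fun n x =>
  nsum (fun k => nsum (fun l => fbin (mu + l%:R - k%:R) a *:
    cre l (A (n + mu - a%:R + l%:R - k%:R) (ann g k x)))).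

Lemma fld_stepE N a u A n x :
  (forall k m : nat, (N <= k)%N || (N <= m)%N ->
     A (n + mu - a%:R + m%:R - k%:R) (ann g k x) = 0) ->
  fld_step a u A n x = \sum_(k < N) \sum_(l < N) fbin (mu + l%:R - k%:R) a *:
    cre l (A (n + mu - a%:R + l%:R - k%:R) (ann g k x)).
Proof.
move=> h; rewrite /fld_step (@nsum2E _ N) // => k l kl.
by rewrite h ?linear0 ?scaler0.
Qed.

Lemma fld_step_field a u A : is_field A -> is_field (fld_step a u A).
Proof.
move=> fA; split=> [n d x y|x n].
  have [N1 h1] := is_field_bound (n + mu - a%:R) x fA.
  have [N2 h2] := is_field_bound (n + mu - a%:R) y fA.
  have [N3 h3] := is_field_bound (n + mu - a%:R) (d *: x + y) fA.
  rewrite !(@fld_stepE (N1 + N2 + N3)); [|by move=> k m h; rewrite ?h1 ?h2 ?h3 //; lia..].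
  rewrite scaler_sumr -big_split; apply: eq_bigr => k _.
  rewrite scaler_sumr -big_split; apply: eq_bigr => l _ /=.
  by rewrite (linearP (ann g k)) fA.1 (linearP (cre l)) scalerDr !scalerA mulrC.
have [N h] := is_field_bound (n + mu - a%:R) x fA.
exists N => i Ni; rewrite /fld_step nsum0 // => k; apply: nsum0 => l.
have := h k (l + i)%N; rewrite natrD addrA => h'.
have -> : n + i%:R + mu - a%:R + l%:R - k%:R = n + mu - a%:R + l%:R + i%:R - k%:R by ring.
by rewrite h' ?linear0 ?scaler0 //; lia.
Qed.

Lemma fld_step_linear a c x x' A B : is_field A -> is_field B ->
  fld_step a (c *: x + x') (c *: A + B) = c *: fld_step a x A + fld_step a x' B.
Proof.
move=> fA fB; apply/funext => n; apply/funext => y.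
transitivity (c *: fld_step a x A n y + fld_step a x' B n y) => [|//].
have [N1 h1] := is_field_bound (n + mu - a%:R) y fA.
have [N2 h2] := is_field_bound (n + mu - a%:R) y fB.
have [N3 h3] := is_field_bound (n + mu - a%:R) y (is_field_lclosed.2 c A B fA fB).
rewrite !(@fld_stepE (N1 + N2 + N3)); [|by move=> k m h; rewrite ?h1 ?h2 ?h3 //; lia..].
rewrite scaler_sumr -big_split; apply: eq_bigr => k _.
rewrite scaler_sumr -big_split; apply: eq_bigr => l _ /=.
transitivity (fbin (mu + l%:R - k%:R) a *: cre l
   (c *: A (n + mu - a%:R + l%:R - k%:R) (ann g k y) +
    B (n + mu - a%:R + l%:R - k%:R) (ann g k y))) => [//|].
by rewrite (linearP (cre l)) scalerDr !scalerA mulrC.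
Qed.

(** Creation operators commute among themselves, and so do the E^g_k, which stand on
    the other side of A: the two orders give the same quadruple sum. *)
Lemma fld_stepC a b x x' y y' A : is_field A ->
  fld_step a x (fld_step b y A) = fld_step b x' (fld_step a y' A).
Proof.
suff H a1 b1 n z (fA : is_field A) : exists N0, forall N u1 u2, (N0 <= N)%N ->
  fld_step a1 u1 (fld_step b1 u2 A) n z =
  \sum_(k < N) \sum_(l < N) \sum_(k' < N) \sum_(l' < N)
  (fbin (mu + l%:R - k%:R) a1 * fbin (mu + l'%:R - k'%:R) b1) *:
  cre l (cre l' (A (n + (mu - a1%:R) + (mu - b1%:R) + l%:R - k%:R + l'%:R - k'%:R)
     (ann g k' (ann g k z)))).
  move=> fA; apply/funext => n; apply/funext => z.
  have [N1 h1] := H a b n z fA; have [N2 h2] := H b a n z fA.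
  rewrite (h1 (N1 + N2)%N) ?(h2 (N1 + N2)%N) ?leq_addr ?leq_addl //.
  set N := (N1 + N2)%N.
  transitivity (\sum_(k < N) \sum_(k' < N) \sum_(l' < N) \sum_(l < N)
  (fbin (mu + l%:R - k%:R) a * fbin (mu + l'%:R - k'%:R) b) *:
  cre l (cre l' (A (n + (mu - a%:R) + (mu - b%:R) + l%:R - k%:R + l'%:R - k'%:R)
     (ann g k' (ann g k z))))).
    apply: eq_bigr => k _; rewrite exchange_big /=; apply: eq_bigr => k' _.
    exact: exchange_big.
  rewrite exchange_big /=; apply: eq_bigr => k' _; rewrite exchange_big /=.
  apply: eq_bigr => l' _; apply: eq_bigr => k _; apply: eq_bigr => l _.
  rewrite mulrC creC [ann g k' _]annC; congr (_ *: cre _ (cre _ (A _ _))); ring.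
have [N0 h0] := is_field_bound2 (n + (mu - a1%:R) + (mu - b1%:R)) z fA.
have E k l k' l' : A (n + mu - a1%:R + l%:R - k%:R + mu - b1%:R + l'%:R - k'%:R)
      (ann g k' (ann g k z)) =
    A (n + (mu - a1%:R) + (mu - b1%:R) + l%:R - k%:R + l'%:R - k'%:R)
      (ann g k' (ann g k z)) by congr (A _ _); ring.
have E' k l k' l' : [|| (N0 <= k)%N, (N0 <= k')%N, (N0 <= l)%N | (N0 <= l')%N] ->
    A (n + mu - a1%:R + l%:R - k%:R + mu - b1%:R + l'%:R - k'%:R)
      (ann g k' (ann g k z)) = 0.
  move=> h; rewrite -[RHS](h0 k k' (l + l')%N); last by lia.
  by congr (A _ _); rewrite natrD; ring.
exists N0 => N u1 u2 hN; rewrite (@fld_stepE N) => [|k m h]; last first.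
  rewrite /fld_step nsum0 // => k'; apply: nsum0 => l'.
  by rewrite E' ?linear0 ?scaler0 //; lia.
apply: eq_bigr => k _; apply: eq_bigr => l _; rewrite (@fld_stepE N) => [|k' l' h].
  rewrite linear_sum scaler_sumr; apply: eq_bigr => k' _ /=.
  rewrite linear_sum scaler_sumr; apply: eq_bigr => l' _ /=.
  by rewrite (linearZ_LR (cre l)) scalerA E.
by apply: E'; lia.
Qed.

Definition fld_init : K -> fock -> fock := fun n x => if n == -1 then x else 0.

Lemma fld_init_field : is_field fld_init.
Proof.
split=> [n d x y|x n]; rewrite /fld_init; first by case: ifP; rewrite ?scaler0 ?addr0.
have [[N hN]|h] := pselect (exists N : nat, n + N%:R = -1); last first.
  by exists 0%N => i _; case: eqP => // hi; case: h; exists i.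
exists N.+1 => i Ni; rewrite ifF //; apply/negP; rewrite -hN.
by move=> /eqP/addrI/eqP; rewrite eqr_nat => /eqP h; rewrite h ltnn in Ni.
Qed.

(** The modes of the vertex operator Y_mu(u, z). *)
Definition fld (u : fock) (n : K) (x : fock) : fock := frec fld_init fld_step u n x.

Lemma fld_nil n x : fld (mon K [::]) n x = if n == -1 then x else 0.
Proof. by rewrite /fld frec_nil. Qed.

Lemma fld_field u : is_field (fld u).
Proof.
apply: frec_closed.
- exact: is_field_lclosed.
- exact: fld_init_field.
- by move=> a x A; apply: fld_step_field.
- by move=> a b x A fA; apply: fld_stepC.
Qed.

Lemma fld_creE a u : fld (cre a u) = fld_step a u (fld u).
Proof.
apply: (@frec_cre K (K -> fock -> fock) fld_init fld_step is_field).
- exact: is_field_lclosed.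
- exact: fld_init_field.
- by move=> b x A; apply: fld_step_field.
- by move=> b c x x' A B fA fB; apply: fld_step_linear.
- by move=> b c x A fA; apply: fld_stepC.
Qed.

Fact fld_is_linear u n : linear (fld u n). Proof. exact: (fld_field u).1. Qed.
HB.instance Definition _ u n :=
  GRing.isLinear.Build K fock fock _ (fld u n) (fld_is_linear u n).

Lemma fld_linearl n x : linear (fun u => fld u n x).
Proof. by move=> c u v; rewrite /fld (linearP (frec _ _)). Qed.

Lemma fld_trunc u x : trunc (fun n => fld u n x).
Proof. exact: (fld_field u).2. Qed.

End Step.

Lemma fld_bound mu u n x : exists N, forall k m : nat,
  (N <= k)%N || (N <= m)%N -> fld mu u (n + m%:R - k%:R) (ann g k x) = 0.
Proof. exact/is_field_bound/fld_field. Qed.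

Lemma fld_cre mu a u n x : fld mu (cre a u) n x =
  nsum (fun k => nsum (fun l => fbin (mu + l%:R - k%:R) a *:
    cre l (fld mu u (n + mu - a%:R + l%:R - k%:R) (ann g k x)))).
Proof. by rewrite fld_creE. Qed.

Lemma fld_cre0 mu u n x : fld mu (cre 0 u) n x =
  nsum (fun k => nsum (fun l =>
    cre l (fld mu u (n + mu + l%:R - k%:R) (ann g k x)))).
Proof.
rewrite fld_cre; apply: eq_nsum => k; apply: eq_nsum => l.
by rewrite fbin0 scale1r subr0.
Qed.

(** Translation covariance Y(D u, z) = d/dz Y(u, z), by the Leibniz rule for divided
    derivatives of the outer factors. *)
Lemma fld_tder mu u n x : fld mu (tder u) n x = - n *: fld mu u (n - 1) x.
Proof.
have L m y := @fld_linearl mu m y.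
move: u n x; apply: fock_ind => [|s].
  split=> [|c u v hu hv] n x; first by rewrite linear0 !(linear_0 (L _ _)) scaler0.
  by rewrite linearP !L hu hv scalerDr !scalerA mulrC.
elim: s => [|a s IH] n x.
  rewrite tder_nil (linear_0 (L _ _)) fld_nil subr_eq addNr.
  by case: eqP => [->|_]; rewrite ?oppr0 ?scale0r ?scaler0.
rewrite -cre_mon tder_cre L !fld_cre; set u := mon K s.
have [N h] := fld_bound mu u (n + mu - a.+1%:R) x.
have e (k l : nat) : n + mu - a%:R + l%:R - k%:R - 1 = n + mu - a.+1%:R + l%:R - k%:R.
  by rewrite -[a.+1]addn1 natrD; ring.
have e' (k l : nat) : n - 1 + mu - a%:R + l%:R - k%:R = n + mu - a.+1%:R + l%:R - k%:R.
  by rewrite -[a.+1]addn1 natrD; ring.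
rewrite !(@nsum2E _ N) => [||k l kl|k l kl]; first last.
- by rewrite h // linear0 scaler0.
- by rewrite IH e h // scaler0 linear0 scaler0.
- by move=> k l kl; rewrite e' h // linear0 scaler0.
rewrite !scaler_sumr -big_split; apply: eq_bigr => k _.
rewrite !scaler_sumr -big_split; apply: eq_bigr => l _ /=.
rewrite IH e e' (linearZ_LR (cre l)) !scalerA -scalerDl; congr (_ *: _).
rewrite fbinS; ring.
Qed.

Lemma fdeg_fld mu r s u x n : fdeg r u -> fdeg s x -> fdeg (r + s)%N (fld mu u n x).
Proof.
move=> ur; move: s n x; move: r u ur; apply: fock_t0D_ind.
- move=> r; split=> [s n x _|c u v hu hv s n x xs].
    by rewrite (linear_0 (@fld_linearl mu n x)); apply: fdeg0.
  rewrite (@fld_linearl mu n x).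
  by apply: fdegD; [apply/fdegZ/hu|apply: hv].
- by move=> s n x xs; rewrite fld_nil; case: ifP => // _; apply: fdeg0.
- move=> r u _ IH s n x xs; rewrite fld_cre0 addSn.
  have [N h] := fld_bound mu u (n + mu) x.
  rewrite (@nsum2E _ N) => [|k l kl]; last by rewrite h ?linear0.
  apply: fdeg_bigsum => k; apply: fdeg_bigsum => l.
  by apply/fdeg_cre/IH/fdeg_ann.
- by move=> r u _ IH s n x xs; rewrite fld_tder; apply/fdegZ/IH.
Qed.

(** The factor z^mu occurs once for each variable of u. *)
Lemma fld_support mu r u n x : fdeg r u ->
  (forall j : int, n <> j%:~R - mu * r%:R) -> fld mu u n x = 0.
Proof.
move=> ur; move: n x; move: r u ur; apply: fock_t0D_ind.
- move=> r; split=> [n x _|c u v hu hv n x h].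
    by rewrite (linear_0 (@fld_linearl mu n x)).
  by rewrite (@fld_linearl mu n x) hu // hv // scaler0 addr0.
- move=> n x h; rewrite fld_nil; case: eqP => // n1.
  by case: (h (-1)); rewrite n1 mulr0 subr0.
- move=> r u _ IH n x h; rewrite fld_cre0 nsum0 // => k; apply: nsum0 => l.
  rewrite IH ?linear0 // => j hj; apply: (h (j - l%:Z + k%:Z)).
  rewrite intrD intrB -!pmulrn -[r.+1]addn1 natrD mulrDr mulr1.
  by rewrite opprD addrA -(addrK mu n) -[n + mu](addrK l%:R) -[n + mu + _](subrK k%:R) hj; ring.
- move=> r u _ IH n x h; rewrite fld_tder IH ?scaler0 // => j hj.
  by apply: (h (j + 1)); rewrite intrD -[n](subrK 1) hj; ring.
Qed.

End Fields.

(** * Exchange rules *)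

Lemma fin_bound (I : finType) (P : I -> nat -> Prop) :
  (forall i, exists N, forall m, (N <= m)%N -> P i m) ->
  exists N, forall i m, (N <= m)%N -> P i m.
Proof.
move=> /choice[f hf]; exists (\max_i f i)%N => i m h; apply: hf.
exact: leq_trans (leq_bigmax i) h.
Qed.

Lemma evz_linear (K : numFieldType) (U W : lmodType K) (L : U -> W) (f : nat -> U) :
  linear L -> evz f -> evz (fun i => L (f i)).
Proof. by move=> Ll [N f0]; exists N => i Ni; rewrite f0 // (linear_0 Ll). Qed.

Section LinearSums.
Variables (K : numFieldType) (U : lmodType K).
Variable g : K.
Local Notation fock := (fock K).

Lemma nsum_ann_linear (Phi : nat -> fock -> U) : (forall k, linear (Phi k)) ->
  linear (fun y => nsum (fun k => Phi k (ann g k y))).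
Proof.
move=> Pl c x y /=; rewrite -nsumP; [|exact: ann_evz..].
by apply: eq_nsum => k; rewrite linearP Pl.
Qed.

Lemma sum_linear I (r : seq I) (F : I -> fock -> U) :
  (forall i, linear (F i)) -> linear (fun y => \sum_(i <- r) F i y).
Proof.
move=> Fl c x y /=; rewrite scaler_sumr -big_split; apply: eq_bigr => i _.
exact: Fl.
Qed.

Lemma nsum_linear (F : nat -> fock -> U) :
  (forall i, linear (F i)) -> (forall y, evz (fun i => F i y)) ->
  linear (fun y => nsum (fun i => F i y)).
Proof.
move=> Fl F0 c x y /=; rewrite -nsumP //.
by apply: eq_nsum => k; rewrite Fl.
Qed.

Lemma scale_linear (F : fock -> U) c : linear F -> linear (fun y => c *: F y).
Proof. by move=> Fl d x y /=; rewrite Fl scalerDr !scalerA mulrC. Qed.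

(** The product (1 - w/z)^a (1 - w/z)^b when the first factor comes from moving E(z)
    past t(w), hence lowers the index of t, and the second multiplies the rest. *)
Lemma nsum_cre_conv a b N (Psi : nat -> nat -> U) :
  (forall l i, (N <= l + i)%N -> Psi l i = 0) ->
  nsum (fun l => \sum_(i < l.+1) sbin a i *:
     nsum (fun i' => sbin b i' *: Psi (l - i)%N (i + i')%N)) =
  nsum (fun l => nsum (fun i => sbin (a + b) i *: Psi l i)).
Proof.
move=> P0.
rewrite (@nsum_antidiag _ N (fun i l => sbin a i *: nsum (fun i' =>
   sbin b i' *: Psi l (i + i')%N))); last first.
  by move=> i l h; rewrite nsum0 ?scaler0 // => i'; rewrite P0 ?scaler0 //; lia.
rewrite (@nsum_exchange _ N) => [|i l h]; last first.
  by rewrite nsum0 ?scaler0 // => i'; rewrite P0 ?scaler0 //; lia.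
apply: eq_nsum => l; rewrite -(@nsum_vandermonde _ _ (@sbin K)); first last.
- by exists N => i Ni; apply: P0; lia.
- exact: sbin_vandermonde.
apply: eq_nsum => i; rewrite -nsumZ.
  by apply: eq_nsum => i'; rewrite scalerA.
by apply: evzZ; exists N => i' h; apply: P0; lia.
Qed.

End LinearSums.

Section Exchange.
Variables (K : numFieldType) (g : K).
Local Notation fock := (fock K).
Local Notation fld := (fld g).
Local Notation ann := (ann g).
Implicit Types (x y u v : fock) (mu n : K).

Lemma cre_fld_evz mu u n x : evz (fun l => cre l (fld mu u (n + l%:R) x)).
Proof.
have [N h] := fld_trunc g mu u x n.
by exists N => l Nl; rewrite h ?linear0.
Qed.

Lemma fld_creN N mu a u n x : annle N x -> fld mu (cre a u) n x =
  \sum_(k < N) nsum (fun l => fbin (mu + l%:R - k%:R) a *: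
    cre l (fld mu u (n + mu - a%:R - k%:R + l%:R) (ann k x))).
Proof.
move=> hx; rewrite fld_cre (@nsumE _ N) => [|k Nk]; last first.
  by rewrite nsum0 // => l; rewrite hx // !linear0 ?scaler0.
by apply: eq_bigr => k _; apply: eq_nsum => l; rewrite [_ - k%:R + l%:R]addrAC.
Qed.

Lemma fld_cre0N N mu u n x : annle N x -> fld mu (cre 0 u) n x =
  \sum_(k < N) nsum (fun l => cre l (fld mu u (n + mu - k%:R + l%:R) (ann k x))).
Proof.
move=> hx; rewrite (fld_creN _ _ _ _ hx); apply: eq_bigr => k _.
by apply: eq_nsum => l; rewrite fbin0 scale1r subr0.
Qed.

(** The exchange rule E(z) Y(v, w) = (1 - w/z)^{g s} Y(E(z-w) v, w) E(z) for v of
    degree s, coefficientwise and tested against Phi.  The bound N only serves to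
    make the sums over j and k finite, and any larger one will do. *)
Definition ann_fld_at s v := exists N0, forall N, (N0 <= N)%N ->
  forall mu q x (Phi : nat -> fock -> fock),
  annle N x -> (forall k, linear (Phi k)) ->
  nsum (fun k => Phi k (ann k (fld mu v q x))) =
  \sum_(j < N) \sum_(k < N) nsum (fun i => sbin (g * s%:R - j%:R) i *:
    Phi (i + j + k)%N (fld mu (ann j v) (q + i%:R) (ann k x))).

Let term_evz mu j k q x v (c : nat -> K) (Phi : nat -> fock -> fock) :
  (forall k, linear (Phi k)) ->
  evz (fun i => c i *: Phi (i + j + k)%N (fld mu v (q + i%:R) x)).
Proof.
move=> Pl; have [N h] := fld_trunc g mu v x q.
by exists N => i Ni; rewrite h // (linear_0 (Pl _)) scaler0.
Qed.

Let term_linear mu j k q x (c : nat -> K) (Phi : nat -> fock -> fock) :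
  (forall k, linear (Phi k)) ->
  linear (fun v => nsum (fun i => c i *: Phi (i + j + k)%N (fld mu v (q + i%:R) x))).
Proof.
move=> Pl; apply: nsum_linear => [i|y]; last exact: term_evz.
by apply: scale_linear => d y y'; rewrite (@fld_linearl _ g) Pl.
Qed.

Lemma ann_fld_lclosed s : lclosed (ann_fld_at s).
Proof.
split=> [|c u v [N1 h1] [N2 h2]].
  exists 0%N => N _ mu q x Phi _ Pl; rewrite nsum0 => [|k]; last first.
    by rewrite (linear_0 (@fld_linearl _ g _ _ _)) linear0 (linear_0 (Pl _)).
  rewrite big1 // => j _; rewrite big1 // => k _; rewrite nsum0 // => i.
  by rewrite linear0 (linear_0 (@fld_linearl _ g _ _ _)) (linear_0 (Pl _)) scaler0.
exists (N1 + N2)%N => N hN mu q x Phi hx Pl.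
rewrite (@fld_linearl _ g) (nsum_ann_linear g Pl).
rewrite (h1 N) ?(h2 N) //; try lia.
rewrite scaler_sumr -big_split; apply: eq_bigr => j _ /=.
rewrite scaler_sumr -big_split; apply: eq_bigr => k _ /=.
by rewrite linearP (term_linear _ _ _ _ _ _ Pl).
Qed.

Lemma ann_fld_nil : ann_fld_at 0 (mon K [::]).
Proof.
exists 1%N => N N1 mu q x Phi hx Pl; case: N N1 hx => // N _ hx.
rewrite big_ord_recl [X in _ + X]big1 ?addr0 => [|j _]; last first.
  rewrite big1 // => k _; rewrite nsum0 // => i; rewrite ann_nil /=.
  by rewrite (linear_0 (@fld_linearl _ g _ _ _)) (linear_0 (Pl _)) scaler0.
rewrite (@nsumE _ N.+1) => [|k Nk]; last first.
  rewrite fld_nil; case: ifP => _; first by rewrite hx // (linear_0 (Pl _)).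
  by rewrite linear0 (linear_0 (Pl _)).
apply: eq_bigr => k _; rewrite (@nsum1 _ 0%N) => [|i /negPf i0]; last first.
  by rewrite mulr0 subr0 sbin0n i0 scale0r.
rewrite sbin0 scale1r !add0n addr0 ann_nil /= !fld_nil.
by case: ifP => _; rewrite ?linear0.
Qed.

(** Commute E(z) successively past t(w), Y(v, w) and E(w): the new t(w)
    contributes (1 - w/z)^g, which combines with the power of (1 - w/z) for v. *)
Lemma ann_fld_cre0 s v : ann_fld_at s v -> ann_fld_at s.+1 (cre 0 v).
Proof.
move=> [N0 IH]; exists N0 => N hN mu q x Phi hx Pl.
rewrite (fld_cre0N _ _ _ hx).
have L := nsum_ann_linear g Pl; rewrite (linear_sumr L).
transitivity (\sum_(k' < N) nsum (fun l => \sum_(i < l.+1) sbin g i *: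
   (\sum_(j < N) \sum_(k < N) nsum (fun i' => sbin (g * s%:R - j%:R) i' *:
    Phi (i' + j + k + i)%N (cre (l - i) (fld mu (ann j v)
     (q + mu - k'%:R + l%:R + i'%:R) (ann k (ann k' x)))))))).
  apply: eq_bigr => k' _; rewrite (linear_nsum L); last exact: cre_fld_evz.
  apply: eq_nsum => l; rewrite nsum_ann_cre //; apply: eq_bigr => i _.
  congr (_ *: _).
  rewrite (@IH N hN _ _ _ (fun k y => Phi (k + i)%N (cre (l - i) y))) //.
    exact: annle_ann.
  by move=> k c y y'; rewrite linearP Pl.
have [M hM] : exists M, forall (t : 'I_N * 'I_N * 'I_N) m, (M <= m)%N ->
    fld mu (ann t.1.1 v) (q + mu - t.2%:R + m%:R) (ann t.1.2 (ann t.2 x)) = 0.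
  by apply: fin_bound => t; apply: fld_trunc.
have hM' (k' j k : 'I_N) (l i : nat) : (M <= l + i)%N ->
    fld mu (ann j v) (q + mu - k'%:R + l%:R + i%:R) (ann k (ann k' x)) = 0.
  by move=> h; rewrite -addrA -natrD (hM (j, k, k')).
transitivity (\sum_(k' < N) \sum_(j < N) \sum_(k < N) nsum (fun l => nsum (fun i =>
   sbin (g * s.+1%:R - j%:R) i *: Phi (i + j + k)%N (cre l (fld mu (ann j v)
     (q + mu - k'%:R + l%:R + i%:R) (ann k (ann k' x))))))).
  apply: eq_bigr => k' _.
  transitivity (nsum (fun l => \sum_(j < N) \sum_(k < N) \sum_(i < l.+1)
    sbin g i *: nsum (fun i' => sbin (g * s%:R - j%:R) i' *:
    Phi (i' + j + k + i)%N (cre (l - i) (fld mu (ann j v)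
     (q + mu - k'%:R + l%:R + i'%:R) (ann k (ann k' x))))))).
    apply: eq_nsum => l.
    under eq_bigr => i _ do rewrite scaler_sumr.
    rewrite exchange_big; apply: eq_bigr => j _.
    under eq_bigr => i _ do rewrite scaler_sumr.
    by rewrite exchange_big.
  have ez (j k : 'I_N) : evz (fun l => \sum_(i < l.+1)
    sbin g i *: nsum (fun i' => sbin (g * s%:R - j%:R) i' *:
    Phi (i' + j + k + i)%N (cre (l - i) (fld mu (ann j v)
     (q + mu - k'%:R + l%:R + i'%:R) (ann k (ann k' x)))))).
    exists M => l Ml; rewrite big1 // => i _; rewrite nsum0 ?scaler0 // => i'.
    by rewrite hM' ?linear0 ?(linear_0 (Pl _)) ?scaler0 //; lia.
  rewrite -nsum_exchange_big => [|j]; last by apply: evz_sum.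
  apply: eq_bigr => j _; rewrite -nsum_exchange_big //; apply: eq_bigr => k _.
  have := @nsum_cre_conv _ _ g (g * s%:R - j%:R) M (fun l i => Phi (i + j + k)%N (cre l
    (fld mu (ann j v) (q + mu - k'%:R + l%:R + i%:R) (ann k (ann k' x))))).
  have -> : g + (g * s%:R - j%:R) = g * s.+1%:R - j%:R.
    by rewrite -[s.+1]addn1 natrD; ring.
  move=> <- => [|l i h]; last by rewrite hM' ?linear0 ?(linear_0 (Pl _)).
  apply: eq_nsum => l; apply: eq_bigr => i _; congr (_ *: _).
  apply: eq_nsum => i'; congr (_ *: Phi _ (cre _ (fld _ _ _ _))); first lia.
  rewrite (natrB _ (ltnSE (ltn_ord i))) (natrD _ i i'); ring.
rewrite exchange_big; apply: eq_bigr => j _ /=.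
rewrite exchange_big; apply: eq_bigr => k _ /=.
transitivity (\sum_(k' < N) nsum (fun i => sbin (g * s.+1%:R - j%:R) i *:
   Phi (i + j + k)%N (nsum (fun l => cre l (fld mu (ann j v)
     (q + i%:R + mu - k'%:R + l%:R) (ann k' (ann k x))))))).
  apply: eq_bigr => k' _; rewrite (@nsum_exchange _ M) => [|l i h]; last first.
    by rewrite hM' ?linear0 ?(linear_0 (Pl _)) ?scaler0 //; lia.
  apply: eq_nsum => i; rewrite (linear_nsum (Pl _)); last exact: cre_fld_evz.
  rewrite -nsumZ; last by apply: (evz_linear (Pl _)); apply: cre_fld_evz.
  apply: eq_nsum => l; rewrite annC; congr (_ *: Phi _ (cre _ (fld _ _ _ _))); ring.
rewrite nsum_exchange_big => [|k']; last first.
  exists M => i Mi; rewrite nsum0 ?(linear_0 (Pl _)) ?scaler0 // => l.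
  rewrite annC -[RHS](linear0 (cre l)) -[in RHS](hM' k' j k i l); last by lia.
  by congr (cre _ (fld _ _ _ _)); ring.
apply: eq_nsum => i; rewrite -scaler_sumr; congr (_ *: _).
rewrite -(linear_sumr (Pl _)) ann_cre0; congr (Phi _ _).
by rewrite (fld_cre0N _ _ _ (annle_ann g k hx)).
Qed.

(** Differentiate the rule for v in w: the derivative of (1 - w/z)^{g s} is absorbed by
    the commutator of D with E(z-w), through ann_tder. *)
Lemma ann_fld_tder s v : fdeg s v -> ann_fld_at s v -> ann_fld_at s (tder v).
Proof.
move=> vs [N1 IH]; have [N2 hv] := annle_ex v.
exists (N1 + N2).+1 => N hN mu q x Phi hx Pl.
case: N hN hx => // N hN hx.
have L := nsum_ann_linear g Pl.
rewrite fld_tder (linear_Z L) (IH N.+1) //; last by lia.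
pose X j w i := \sum_(k < N.+1) sbin (g * s%:R - j%:R) i *:
  Phi (i + j + k)%N (fld mu w (q + i%:R) (ann k x)).
pose Y j i := \sum_(k < N.+1)
  Phi (i + j + k)%N (fld mu (ann j v) (q + i%:R - 1) (ann k x)).
have eY j i : Y j i = \sum_(k < N.+1)
  Phi (i + j + k)%N (fld mu (ann j v) (q - 1 + i%:R) (ann k x)).
  apply: eq_bigr => k _; congr (Phi _ (fld _ _ _ _)); ring.
have Yz j : evz (Y j).
  rewrite /Y; apply: evz_sum => k.
  have [M hM] := fld_trunc g mu (ann j v) (ann k x) (q - 1).
  by exists M => i Mi; rewrite addrAC hM ?(linear_0 (Pl _)).
have Xz j w : evz (X j w) by rewrite /X; apply: evz_sum => k; apply: term_evz.
have XE j w : \sum_(k < N.+1) nsum (fun i => sbin (g * s%:R - j%:R) i *: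
  Phi (i + j + k)%N (fld mu w (q + i%:R) (ann k x))) = nsum (X j w).
  by rewrite nsum_exchange_big // => k; apply: term_evz.
under [RHS]eq_bigr => j _ do rewrite XE.
transitivity (\sum_(j < N.+1) - q *: nsum (fun i => sbin (g * s%:R - j%:R) i *: Y j i)).
  rewrite scaler_sumr; apply: eq_bigr => j _; congr (_ *: _).
  rewrite nsum_exchange_big => [|k]; last exact: term_evz.
  apply: eq_nsum => i; rewrite eY scaler_sumr //.
have Xl j i : linear (fun w => X j w i).
  by apply: sum_linear => k; apply: scale_linear => d y y'; rewrite (@fld_linearl _ g) Pl.
have XD j i : X j (tder (ann j v)) i =
    (- (q + i%:R) * sbin (g * s%:R - j%:R) i) *: Y j i.
  rewrite scaler_sumr; apply: eq_bigr => k _.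
  by rewrite fld_tder (linear_Z (Pl _)) scalerA mulrC.
have XS j i : (g * s%:R - j%:R) *: X j.+1 (ann j v) i =
    - (i.+1%:R * sbin (g * s%:R - j%:R) i.+1) *: Y j i.+1.
  rewrite !scaler_sumr; apply: eq_bigr => k _.
  rewrite scalerA sbinS1 mulNr opprK.
  have -> : g * s%:R - j.+1%:R = g * s%:R - j%:R - 1.
    by rewrite -[j.+1]addn1 natrD; ring.
  congr (_ *: Phi _ (fld _ _ _ _)); first lia.
  by rewrite -[i.+1]addn1 natrD addrA addrK.
have nXl j : linear (fun w => nsum (X j w)) by exact: (@nsum_linear _ _ (fun i w => X j w i) (Xl j) (Xz j)).
have step j : (g * s%:R - j%:R) *: nsum (X j.+1 (ann j v)) =
    - nsum (fun i => (i%:R * sbin (g * s%:R - j%:R) i) *: Y j i).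
  rewrite -nsumZ // [in RHS]nsum_recl; last exact: evzZ.
  rewrite mul0r scale0r add0r -[in RHS]scaleN1r -nsumZ; last first.
    apply: (@evz_S _ (fun i => (i%:R * sbin (g * s%:R - j%:R) i) *: Y j i)).
    exact: evzZ.
  apply: eq_nsum => i; rewrite XS scalerA mulN1r //.
transitivity (\sum_(j < N.+1) (nsum (X j (tder (ann j v)))
   - (g * s%:R - j%:R) *: nsum (X j.+1 (ann j v)))).
  apply: eq_bigr => j _; rewrite step opprK -nsumZ; last exact: evzZ.
  rewrite -(@nsum_add fock) //; last exact: evzZ.
  apply: eq_nsum => i; rewrite XD !scalerA -scalerDl; congr (_ *: _); ring.
rewrite sumrB big_ord_recl [in RHS]big_ord_recl !ann_id.
rewrite [X in _ - X]big_ord_recr /= hv; last by lia.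
rewrite [X in _ *: X](linear_0 (nXl N.+1)) scaler0 addr0 -addrA -sumrB; congr (_ + _).
apply: eq_bigr => j _; rewrite /bump /= add1n.
rewrite (ann_tder g j vs) (linear_B (nXl _)) (linear_Z (nXl _)) //.
Qed.

Lemma ann_fld s v : fdeg s v -> ann_fld_at s v.
Proof.
move: s v; apply: fock_t0D_ind.
- exact: ann_fld_lclosed.
- exact: ann_fld_nil.
- by move=> r x _; apply: ann_fld_cre0.
- exact: ann_fld_tder.
Qed.

End Exchange.

Section Exchange2.
Variables (K : numFieldType) (g : K).
Local Notation fock := (fock K).
Local Notation fld := (fld g).
Local Notation ann := (ann g).
Implicit Types (x y u v : fock) (mu n : K).

(** The exchange rule Y(v, w) t(z) = (w - z)^{g s} t(z) Y(E(z-w) v, w) for v of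
    degree s, with E(z-w) expanded in |w| > |z|, which explains the signs.  The
    parameter mu changes by g because t(z) raises the degree of its argument. *)
Definition fld_cre_at s v := exists N0, forall N, (N0 <= N)%N -> forall mu n a x,
  fld (mu + g) v n (cre a x) =
  \sum_(j < N) \sum_(i < a.+1) ((-1) ^+ j * sbin (g * s%:R - j%:R) i) *:
    cre (a - i) (fld mu (ann j v) (n + (g * s%:R - j%:R) - i%:R) x).

Lemma fld_cre_lclosed s : lclosed (fld_cre_at s).
Proof.
split=> [|c u v [N1 h1] [N2 h2]].
  exists 0%N => N _ mu n a x; rewrite (linear_0 (@fld_linearl _ g _ _ _)).
  rewrite big1 // => j _; rewrite big1 // => i _.
  by rewrite linear0 (linear_0 (@fld_linearl _ g _ _ _)) linear0 scaler0.
exists (N1 + N2)%N => N hN mu n a x.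
rewrite (@fld_linearl _ g) (h1 N) ?(h2 N) //; try lia.
rewrite scaler_sumr -big_split; apply: eq_bigr => j _ /=.
rewrite scaler_sumr -big_split; apply: eq_bigr => i _ /=.
rewrite (linearP (ann j)) (@fld_linearl _ g) (linearP (cre (a - i))).
by rewrite scalerDr !scalerA [c * _]mulrC.
Qed.

Lemma fld_cre_nil : fld_cre_at 0 (mon K [::]).
Proof.
exists 1%N => -[//|N] _ mu n a x.
rewrite big_ord_recl [X in _ = _ + X]big1 ?addr0 => [|j _]; last first.
  rewrite big1 // => i _; rewrite ann_nil /=.
  by rewrite (linear_0 (@fld_linearl _ g _ _ _)) linear0 scaler0.
rewrite big_ord_recl [X in _ = _ + X]big1 ?addr0 => [|i _]; last first.
  by rewrite mulr0 subr0 sbin0n mulr0 scale0r.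
rewrite mulr0 subr0 sbin0 mulr1 scale1r ann_nil /= !fld_nil addr0 subr0 subn0.
by case: ifP => _; rewrite ?linear0.
Qed.

(** Commute t(z) successively past E(w), Y(v, w) and t(w): the factor (1 - z/w)^g
    from E(w) raises the exponent for v by g. *)
Lemma fld_cre_cre0 s v : fld_cre_at s v -> fld_cre_at s.+1 (cre 0 v).
Proof.
move=> [N0 IH]; exists N0 => N hN mu n a x.
have [Nx hx0] := annle_ex x; pose M := (Nx + a)%N.
have hx : annle M x by apply: annle_leq hx0; rewrite leq_addr.
have hax : annle M (cre a x) by apply: annle_cre.
rewrite (fld_cre0N _ _ _ _ hax).
pose Phi (k : nat) y := nsum (fun l => cre l (fld (mu + g) v (n + (mu + g) - k%:R + l%:R) y)).
have Pl k : linear (Phi k).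
  apply: nsum_linear => [l|y]; last exact: cre_fld_evz.
  by move=> c y y'; rewrite (linearP (fld _ _ _)) (linearP (cre l)).
rewrite -[LHS](@nsumE _ M (fun k => Phi k (ann k (cre a x)))); last first.
  by move=> k Mk; rewrite hax // (linear_0 (Pl k)).
rewrite nsum_ann_cre //.
pose c j i := n + (g * s.+1%:R - j%:R) - i%:R.
transitivity (\sum_(i < a.+1) sbin g i *: \sum_(k < M) \sum_(j < N)
  \sum_(i' < (a - i).+1) ((-1) ^+ j * sbin (g * s%:R - j%:R) i') *:
   cre (a - i - i') (nsum (fun l => cre l (fld mu (ann j v)
     (c j (i + i')%N + mu - k%:R + l%:R) (ann k x))))).
  apply: eq_bigr => i _; congr (_ *: _).
  rewrite (@nsumE _ M) => [|k Mk]; last by rewrite hx // linear0 (linear_0 (Pl _)).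
  apply: eq_bigr => k _.
  transitivity (nsum (fun l => \sum_(j < N) \sum_(i' < (a - i).+1)
    ((-1) ^+ j * sbin (g * s%:R - j%:R) i') *: cre (a - i - i')
      (cre l (fld mu (ann j v) (c j (i + i')%N + mu - k%:R + l%:R) (ann k x))))).
    apply: eq_nsum => l; rewrite (IH N) // linear_sum; apply: eq_bigr => j _.
    rewrite linear_sum; apply: eq_bigr => i' _ /=.
    rewrite (linearZ_LR (cre l)) creC /c; congr (_ *: cre _ (cre _ (fld _ _ _ _))).
    rewrite (natrD _ i i') (natrD _ k i) -[s.+1]addn1 (natrD _ s 1); ring.
  have ez j (i' : 'I_(a - i).+1) : evz (fun l => ((-1) ^+ j * sbin (g * s%:R - j%:R) i') *:
      cre (a - i - i') (cre l (fld mu (ann j v)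
        (c j (i + i')%N + mu - k%:R + l%:R) (ann k x)))).
    by apply: (@evzZ _ _ (fun _ => _)); apply: evz_linear; [exact: linearP|exact: cre_fld_evz].
  rewrite -nsum_exchange_big => [|j]; last by apply: evz_sum.
  apply: eq_bigr => j _; rewrite -nsum_exchange_big //; apply: eq_bigr => i' _.
  rewrite nsumZ; last by apply: evz_linear; [exact: linearP|exact: cre_fld_evz].
  by congr (_ *: _); rewrite linear_nsum //; [exact: linearP|exact: cre_fld_evz].
under eq_bigr => i _.
  rewrite exchange_big scaler_sumr; under eq_bigr => j _.
    rewrite exchange_big /= scaler_sumr; under eq_bigr => i' _.
      rewrite -scaler_sumr -(linear_sum (cre _)) -(fld_cre0N _ _ _ _ hx) -ann_cre0 scalerA mulrCA.
      rewrite -scalerA -subnDA.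
      over.
    rewrite -scaler_sumr.
    over.
  over.
rewrite exchange_big; apply: eq_bigr => j _ /=.
have -> : g * s.+1%:R - j%:R = g + (g * s%:R - j%:R).
  by rewrite -[s.+1]addn1 (natrD _ s 1); ring.
rewrite -scaler_sumr (@sum_vandermonde _ _ (@sbin K) _ _ a (fun i =>
   cre (a - i) (fld mu (ann j (cre 0 v)) (c j i) x))); last exact: sbin_vandermonde.
rewrite scaler_sumr; apply: eq_bigr => i _; rewrite scalerA; congr (_ *: cre _ (fld _ _ _ _)).
by rewrite /c -[s.+1]addn1 (natrD _ s 1); ring.
Qed.

(** As for the other exchange rule, differentiating in w. *)
Lemma fld_cre_tder s v : fdeg s v -> fld_cre_at s v -> fld_cre_at s (tder v).
Proof.
move=> vs [N1 IH]; have [N2 hv] := annle_ex v.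
exists (N1 + N2).+1 => -[//|N] hN mu n a x.
rewrite fld_tder (IH N.+1); last lia.
pose X j w := \sum_(i < a.+1) ((-1) ^+ j * sbin (g * s%:R - j%:R) i) *:
    cre (a - i) (fld mu w (n + (g * s%:R - j%:R) - i%:R) x).
have Xl j : linear (X j).
  apply: sum_linear => i; apply: scale_linear => d y y'.
  by rewrite (@fld_linearl _ g) (linearP (cre _)).
rewrite -[RHS]/(\sum_(j < N.+1) X j (ann j (tder v))).
transitivity (\sum_(j < N.+1) (X j (tder (ann j v))
   - (g * s%:R - j%:R) *: X j.+1 (ann j v))).
  rewrite scaler_sumr; apply: eq_bigr => j _; rewrite /X !scaler_sumr -sumrB.
  apply: eq_bigr => i _; rewrite fld_tder (linearZ_LR (cre _)) /=.
  have -> : g * s%:R - j.+1%:R = g * s%:R - j%:R - 1.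
    by rewrite -[j.+1]addn1 (natrD _ j 1); ring.
  set c := g * s%:R - j%:R.
  have -> : n + c - i%:R - 1 = n - 1 + c - i%:R by ring.
  have -> : n + (c - 1) - i%:R = n - 1 + c - i%:R by ring.
  rewrite !scalerA -scalerBl; congr (_ *: _).
  have h : c * sbin (c - 1) i = (c - i%:R) * sbin c i.
    by have := sbinS c i; rewrite sbinS1 !mulNr => /oppr_inj.
  have -> : c * ((-1) ^+ j.+1 * sbin (c - 1) i) = - (-1) ^+ j * (c * sbin (c - 1) i).
    by rewrite exprS; ring.
  by rewrite h; ring.
rewrite sumrB big_ord_recl [in RHS]big_ord_recl !ann_id.
rewrite [X in _ - X]big_ord_recr /= hv; last by lia.
rewrite (linear_0 (Xl N.+1)) scaler0 addr0 -addrA -sumrB; congr (_ + _).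
apply: eq_bigr => j _; rewrite /bump /= add1n.
by rewrite (ann_tder g j vs) (linear_B (Xl _)) (linear_Z (Xl _)).
Qed.

Lemma fld_cre_exchange s v : fdeg s v -> fld_cre_at s v.
Proof.
move: s v; apply: fock_t0D_ind.
- exact: fld_cre_lclosed.
- exact: fld_cre_nil.
- by move=> r x _; apply: fld_cre_cre0.
- exact: fld_cre_tder.
Qed.

End Exchange2.

(** * The Borcherds identity *)

Section CreationDistribution.
Variables (K : numFieldType).
Local Notation fock := (fock K).
Implicit Types (H : K -> K -> fock) (n c p q : K).

(** Multiplication by t(z) in the first variable. *)
Definition creL H p q : fock := nsum (fun l => cre l (H (p + l%:R) q)).

Lemma zwp_truncr c H : truncr H -> truncr (zwp c H).
Proof.
move=> Ht q; have [N h] := Ht q; exists N => i p Ni; rewrite /zwp nsum0 // => j.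
by rewrite -[q + _ + _]addrA -natrD h ?scaler0 //; lia.
Qed.

Lemma zwp_trunc c H : truncr H -> (forall q, trunc (H^~ q)) ->
  forall q, trunc (zwp c H ^~ q).
Proof.
move=> Hr Ht q p; have [N h] := Hr q.
have [M hM] := @fin_bound _ (fun (i : 'I_N) m =>
   H (p + c - i%:R + m%:R) (q + i%:R) = 0) (fun i => Ht _ _).
exists M => m Mm; rewrite /zwp nsum0 // => i.
have [iN|Ni] := ltnP i N; last by rewrite h ?scaler0.
have -> : p + m%:R + c - i%:R = p + c - (Ordinal iN)%:R + m%:R by rewrite /=; ring.
by rewrite (hM (Ordinal iN)) ?scaler0.
Qed.

Lemma wzp_truncl c H : truncl H -> truncl (wzp c H).
Proof. by move=> Ht; apply: (@zwp_truncr c (fun p q => H q p)). Qed.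

Lemma zwp_creL n H p q : truncr H -> (forall q, trunc (H^~ q)) ->
  zwp n (creL H) p q = creL (zwp n H) p q.
Proof.
move=> Hr Ht; have [N h] := Hr q.
have [M hM] := @fin_bound _ (fun (i : 'I_N) m =>
   H (p + n - i%:R + m%:R) (q + i%:R) = 0) (fun i => Ht _ _).
have hH (i l : nat) : (N + M <= i)%N || (N + M <= l)%N ->
    H (p + n - i%:R + l%:R) (q + i%:R) = 0.
  have [iN|Ni] := ltnP i N; last by rewrite h.
  by move=> il; rewrite (hM (Ordinal iN)) //; lia.
transitivity (nsum (fun i => nsum (fun l => sbin n i *:
   cre l (H (p + n - i%:R + l%:R) (q + i%:R))))).
  apply: eq_nsum => i; rewrite nsumZ //; exists (N + M)%N => l hl.
  by rewrite hH ?linear0 // hl orbT.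
rewrite (@nsum_exchange _ (N + M)) => [|i l hil]; last by rewrite hH ?linear0 ?scaler0.
apply: eq_nsum => l; rewrite linear_nsum; first last.
- by exists N => i Ni; rewrite h ?scaler0.
- exact: linearP.
apply: eq_nsum => i; rewrite (linearZ_LR (cre l)) /=; congr (_ *: cre l (H _ _)); ring.
Qed.

Lemma wzp_creL n H p q : truncl H ->
  wzp n (creL H) p q = creL (wzp n H) p q.
Proof.
move=> Hl; have [N h] := Hl p.
have h' (i l : nat) q' : (N <= i + l)%N -> H (p + i%:R + l%:R) q' = 0.
  by move=> il; rewrite -[p + _ + _]addrA -natrD h.
transitivity (nsum (fun i => nsum (fun l => sbin n i *:
   cre l (H (p + i%:R + l%:R) (q + n - i%:R))))).
  apply: eq_nsum => i; rewrite nsumZ //; exists N => l hl.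
  by rewrite h' ?linear0 //; lia.
rewrite (@nsum_exchange _ N) => [|i l hil]; last first.
  by rewrite h' ?linear0 ?scaler0 //; lia.
apply: eq_nsum => l; rewrite linear_nsum; first last.
- by exists N => i Ni; rewrite addrAC h' ?scaler0 //; lia.
- exact: linearP.
by apply: eq_nsum => i; rewrite (linearZ_LR (cre l)) /= [p + _ + _]addrAC.
Qed.

End CreationDistribution.

Section Borcherds.
Variables (K : numFieldType) (g : K).
Local Notation fock := (fock K).
Local Notation fld := (fld g).
Local Notation ann := (ann g).
Implicit Types (x y u v : fock) (mu n p q : K).

Lemma fld_fld_truncr nu mu u v x : truncr (fun p q => fld nu u p (fld mu v q x)).
Proof.
move=> q; have [N h] := fld_trunc g mu v x q.
by exists N => i p Ni; rewrite h // linear0.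
Qed.

Lemma fld_fld_truncl nu mu u v x : truncl (fun p q => fld nu v q (fld mu u p x)).
Proof.
move=> p; have [N h] := fld_trunc g mu u x p.
by exists N => i q Ni; rewrite h // linear0.
Qed.

(** The Borcherds identity for u in every pair (u, v).  On a vector x in degree l of
    the module of order -m one has mu = m + g l, and applying v, resp. u, first adds
    g s, resp. g r, to it. *)
Definition borcherds_at r u := forall s v, fdeg s v -> forall mu (N P : int) q x,
  let n := N%:~R - g * r%:R * s%:R in
  let p := P%:~R - mu * r%:R in
  zwp n (fun p q => fld (mu + g * s%:R) u p (fld mu v q x)) p q -
  sgnz K N *: wzp n (fun p q => fld (mu + g * r%:R) v q (fld mu u p x)) p q =
  nsum (fun j => fbin p j *: fld mu (fld (g * s%:R) u (n + j%:R) v) (p + q - j%:R) x).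

Lemma borcherds_rhs_evz (c : nat -> K) nu mu u v n x k :
  evz (fun j => c j *: fld mu (fld nu u (n + j%:R) v) (k - j%:R) x).
Proof.
have [N h] := fld_trunc g nu u v n; exists N => j Nj.
by rewrite h // (linear_0 (@fld_linearl _ g _ _ _)) scaler0.
Qed.

Lemma borcherds_lclosed r : lclosed (borcherds_at r).
Proof.
split=> [|c u u' hu hu'] s v vs mu N P q x n p.
  rewrite /zwp /wzp !nsum0 ?scaler0 ?subr0 // => i.
  - by rewrite (linear_0 (@fld_linearl _ g _ _ _)) (linear_0 (@fld_linearl _ g _ _ _)) scaler0.
  - by rewrite (linear_0 (@fld_linearl _ g _ _ _)) linear0 scaler0.
  - by rewrite (linear_0 (@fld_linearl _ g _ _ _)) scaler0.
have -> : zwp n (fun p q => fld (mu + g * s%:R) (c *: u + u') p (fld mu v q x)) p q =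
   c *: zwp n (fun p q => fld (mu + g * s%:R) u p (fld mu v q x)) p q +
   zwp n (fun p q => fld (mu + g * s%:R) u' p (fld mu v q x)) p q.
  rewrite /zwp -nsumP; [|exact: (zwp_evz _ _ _ (@fld_fld_truncr _ _ _ _ _))..].
  apply: eq_nsum => i.
  by rewrite (@fld_linearl _ g) scalerDr !scalerA mulrC.
have -> : wzp n (fun p q => fld (mu + g * r%:R) v q (fld mu (c *: u + u') p x)) p q =
   c *: wzp n (fun p q => fld (mu + g * r%:R) v q (fld mu u p x)) p q +
   wzp n (fun p q => fld (mu + g * r%:R) v q (fld mu u' p x)) p q.
  rewrite /wzp -nsumP; [|exact: (wzp_evz _ _ _ (@fld_fld_truncl _ _ _ _ _))..].
  apply: eq_nsum => i.
  by rewrite (@fld_linearl _ g) linearP scalerDr !scalerA mulrC.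
have := hu _ _ vs mu N P q x; have := hu' _ _ vs mu N P q x.
rewrite -/n -/p => h' h.
rewrite scalerDr scalerA [sgnz K N * c]mulrC -scalerA opprD addrACA -scalerBr h h'.
rewrite -nsumP; [|exact: borcherds_rhs_evz..].
apply: eq_nsum => j.
by rewrite !(@fld_linearl _ g) scalerDr !scalerA mulrC.
Qed.

(** Only one index contributes; the two variants extract it on either side of the
    residue identity. *)
Lemma nsum_pick_sub (z : int) (c : nat -> K) (f : nat -> fock) :
  nsum (fun i => c i *: (if z%:~R - i%:R == -1 :> K then f i else 0)) =
  if 0 <= z + 1 then c (absz (z + 1)) *: f (absz (z + 1)) else 0.
Proof.
have e (i : nat) : (z%:~R - i%:R == -1 :> K) = (z + 1 == i%:Z).
  rewrite -subr_eq0 opprK -(eqr_int K) -[RHS]subr_eq0 intrD -pmulrn.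
  by congr (_ == 0); ring.
case: ifP => h.
  rewrite (@nsum1 _ (absz (z + 1))) => [|i hi]; rewrite e.
    by rewrite gez0_abs ?eqxx.
  case: eqP => [hz|_]; last by rewrite scaler0.
  by rewrite hz eqxx in hi.
apply: nsum0 => i; rewrite e; case: eqP => [hz|_]; last by rewrite scaler0.
by rewrite hz in h.
Qed.

Lemma nsum_pick_add (z : int) (c : nat -> K) (f : nat -> fock) :
  nsum (fun i => c i *: (if z%:~R + i%:R == -1 :> K then f i else 0)) =
  if z < 0 then c (absz (z + 1)) *: f (absz (z + 1)) else 0.
Proof.
have e (i : nat) : (z%:~R + i%:R == -1 :> K) = (z + 1 == - i%:Z).
  rewrite -subr_eq0 opprK -(eqr_int K) -[RHS]subr_eq0 intrD rmorphN /= -pmulrn opprK.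
  by congr (_ == 0); ring.
case: ifP => h.
  rewrite (@nsum1 _ (absz (z + 1))) => [|i hi]; rewrite e.
    have -> : (z + 1 == - (absz (z + 1))%:Z) by lia.
    by [].
  case: eqP => [hz|_]; last by rewrite scaler0.
  by rewrite hz abszN eqxx in hi.
apply: nsum0 => i; rewrite e; case: eqP => [hz|_]; last by rewrite scaler0.
lia.
Qed.

Lemma borcherds_nil : borcherds_at 0 (mon K [::]).
Proof.
move=> s v vs mu N P q x n p.
have -> : n = N%:~R by rewrite /n mulr0 mul0r subr0.
have -> : p = P%:~R by rewrite /p mulr0 subr0.
rewrite !mulr0 addr0.
have -> : zwp N%:~R (fun p q => fld (mu + g * s%:R) (mon K [::]) p (fld mu v q x)) P%:~R q =
  (if 0 <= P + N + 1 then sbin N%:~R (absz (P + N + 1)) else 0)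
    *: fld mu v (P%:~R + q + N%:~R + 1) x.
  transitivity (nsum (fun i => sbin (K := K) N%:~R i *: (if (P + N)%:~R - i%:R == -1 :> K
     then fld mu v (q + i%:R) x else 0))).
    by apply: eq_nsum => i; rewrite fld_nil intrD.
  rewrite nsum_pick_sub; case: ifP => h; last by rewrite scale0r.
  congr (_ *: fld _ _ _ _); rewrite pmulrn gez0_abs // !intrD; ring.
have -> : wzp N%:~R (fun p q => fld mu v q (fld mu (mon K [::]) p x)) P%:~R q =
  (if P < 0 then sbin N%:~R (absz (P + 1)) else 0)
    *: fld mu v (P%:~R + q + N%:~R + 1) x.
  transitivity (nsum (fun i => sbin (K := K) N%:~R i *: (if P%:~R + i%:R == -1 :> K
     then fld mu v (q + N%:~R - i%:R) x else 0))).
    by apply: eq_nsum => i; rewrite fld_nil; case: ifP; rewrite ?linear0.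
  rewrite nsum_pick_add; case: ifP => h; last by rewrite scale0r.
  congr (_ *: fld _ _ _ _); rewrite pmulrn.
  have -> : (absz (P + 1))%:Z = - (P + 1) by lia.
  rewrite rmorphN /= intrD; ring.
rewrite scalerA -scalerBl residue_binomial.
transitivity (nsum (fun j => fbin (K := K) P%:~R j *: (if N%:~R + j%:R == -1 :> K
     then fld mu v (P%:~R + q - j%:R) x else 0))); last first.
  apply: eq_nsum => j; rewrite fld_nil; case: ifP => //.
  by rewrite (linear_0 (@fld_linearl _ g _ _ _)).
rewrite nsum_pick_add; case: ifP => h; last by rewrite scale0r.
congr (_ *: fld _ _ _ _); rewrite pmulrn.
have -> : (absz (N + 1))%:Z = - (N + 1) by lia.
rewrite rmorphN /= intrD; ring.
Qed.

(** Differentiate the identity for u in z: on the left the derivative also hits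
    (z - w)^n, which gives the identity at exponent n - 1. *)
Lemma borcherds_tder r u : borcherds_at r u -> borcherds_at r (tder u).
Proof.
move=> IH s v vs mu N P q x n p.
have := IH _ _ vs mu N (P - 1) q x; have := IH _ _ vs mu (N - 1) P q x.
have -> : (P - 1)%:~R - mu * r%:R = p - 1 by rewrite /p intrB; ring.
have -> : (N - 1)%:~R - g * r%:R * s%:R = n - 1 by rewrite /n intrB; ring.
rewrite -/n -/p; have -> : sgnz K (N - 1) = - sgnz K N.
  by rewrite (sgnzD K N 1) expr1 mulN1r.
set G := fun p q => fld _ u p _; set H := fun p q => fld _ v q _ => h1 h2.
have -> : zwp n (fun p q => fld (mu + g * s%:R) (tder u) p (fld mu v q x)) p q =
    - p *: zwp n G (p - 1) q + (- n *: zwp (n - 1) G p q).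
  rewrite -(nsumZ (- n)); last exact: (zwp_evz _ _ _ (@fld_fld_truncr _ _ _ _ _)).
  rewrite -nsumP; first last.
  - by apply: (@evzZ _ _ (fun _ => _)); apply: (zwp_evz _ _ _ (@fld_fld_truncr _ _ _ _ _)).
  - exact: (zwp_evz _ _ _ (@fld_fld_truncr _ _ _ _ _)).
  apply: eq_nsum => i; rewrite fld_tder /G.
  have -> : p + n - i%:R - 1 = p + (n - 1) - i%:R by ring.
  have -> : p - 1 + n - i%:R = p + (n - 1) - i%:R by ring.
  rewrite !scalerA -scalerDl; congr (_ *: _).
  have h : n * sbin (n - 1) i = (n - i%:R) * sbin n i.
    by have := sbinS n i; rewrite sbinS1 !mulNr => /oppr_inj.
  by rewrite !mulNr h; ring.
have -> : wzp n (fun p q => fld (mu + g * r%:R) v q (fld mu (tder u) p x)) p q =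
    - p *: wzp n H (p - 1) q + n *: wzp (n - 1) H p q.
  rewrite -(nsumZ n); last exact: (wzp_evz _ _ _ (@fld_fld_truncl _ _ _ _ _)).
  have -> : nsum (fun i => n *: (sbin (n - 1) i *: H (p + i%:R) (q + (n - 1) - i%:R))) =
     nsum (fun i => (- i%:R * sbin n i) *: H (p - 1 + i%:R) (q + n - i%:R)).
    rewrite [RHS]nsum_recl; last first.
      have := wzp_evz n (p - 1) q (@fld_fld_truncl (mu + g * r%:R) mu u v x).
      by move=> [M h]; exists M => i Mi; rewrite -scalerA h ?scaler0.
    rewrite oppr0 mul0r scale0r add0r; apply: eq_nsum => i.
    rewrite scalerA mulNr sbinS1 mulNr opprK -[i.+1]addn1 (natrD _ i 1).
    by congr (_ *: H _ _); ring.
  rewrite -nsumP; first last.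
  - have [M h] := wzp_evz n (p - 1) q (@fld_fld_truncl (mu + g * r%:R) mu u v x).
    by exists M => i Mi; rewrite -scalerA h ?scaler0.
  - exact: (wzp_evz _ _ _ (@fld_fld_truncl _ _ _ _ _)).
  apply: eq_nsum => i; rewrite fld_tder /H (linearZ_LR (fld _ _ _)) /=.
  have -> : p + i%:R - 1 = p - 1 + i%:R by ring.
  by rewrite !scalerA -scalerDl; congr (_ *: _); ring.
transitivity (- p *: (zwp n G (p - 1) q - sgnz K N *: wzp n H (p - 1) q) +
   (- n) *: (zwp (n - 1) G p q - (- sgnz K N) *: wzp (n - 1) H p q)).
  rewrite (scaleNr (sgnz K N)) opprK (scalerDr (sgnz K N)) [- (_ *: _ + _)]opprD addrACA.
  congr (_ + _); first by rewrite scalerBr !scalerA mulrC.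
  by rewrite scalerDr !scalerA mulNr scaleNr mulrC.
rewrite h1 h2 -(nsumZ (- n)); last exact: borcherds_rhs_evz.
have -> : - p *: nsum (fun j => fbin (p - 1) j *:
     fld mu (fld (g * s%:R) u (n + j%:R) v) (p - 1 + q - j%:R) x) =
   nsum (fun j => (- j%:R * fbin p j) *:
     fld mu (fld (g * s%:R) u (n - 1 + j%:R) v) (p + q - j%:R) x).
  rewrite -nsumZ; last exact: borcherds_rhs_evz.
  rewrite [RHS]nsum_recl; last exact: borcherds_rhs_evz.
  rewrite oppr0 mul0r scale0r add0r; apply: eq_nsum => j.
  rewrite scalerA [in RHS]mulNr fbinS1 mulNr -[j.+1]addn1 (natrD _ j 1).
  by congr (_ *: fld _ (fld _ _ _ _) _ _); ring.
rewrite -(@nsum_add fock); first last.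
- by apply: (@evzZ _ _ (fun _ => _)); apply: borcherds_rhs_evz.
- exact: borcherds_rhs_evz.
apply: eq_nsum => j; rewrite fld_tder (linear_Z (@fld_linearl _ g _ _ _)) !scalerA.
rewrite addrAC -scalerDl; congr (_ *: fld _ (fld _ _ _ _) _ _); ring.
Qed.

End Borcherds.

Section BorcherdsCreation.
Variables (K : numFieldType) (g : K).
Local Notation fock := (fock K).
Local Notation fld := (fld g).
Local Notation ann := (ann g).
Implicit Types (x y u v : fock) (mu n p q : K).

(** The operator Y(t_0 u, z) Y(v, w) is z^mu t(z) (z - w)^{g s} Y(u, z) Y(E(z-w) v, w) E(z),
    by moving E(z) to the right. *)
Lemma fld_cre0_fld s v : fdeg s v -> exists M0, forall M, (M0 <= M)%N ->
  forall mu u x p q, annle M x ->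
  fld (mu + g * s%:R) (cre 0 u) p (fld mu v q x) =
  \sum_(j < M) \sum_(k < M) creL (zwp (g * s%:R - j%:R)
    (fun p q => fld (mu + g * s%:R) u p (fld mu (ann j v) q (ann k x))))
    (p + mu - k%:R) q.
Proof.
move=> vs; have [M0 h] := ann_fld g vs; exists M0 => M hM mu u x p q hx.
set nu := mu + g * s%:R.
pose Phi (k : nat) y := nsum (fun l => cre l (fld nu u (p + nu - k%:R + l%:R) y)).
have Pl k : linear (Phi k).
  apply: nsum_linear => [l|y]; last exact: cre_fld_evz.
  by move=> c y y'; rewrite (linearP (fld _ _ _)) (linearP (cre l)).
transitivity (nsum (fun k => Phi k (ann k (fld mu v q x)))).
  rewrite fld_cre0; apply: eq_nsum => k; apply: eq_nsum => l.
  by congr (cre l (fld _ _ _ _)); ring.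
rewrite (h M) //; apply: eq_bigr => j _; apply: eq_bigr => k _.
set c := g * s%:R - j%:R.
pose G p q := fld nu u p (fld mu (ann j v) q (ann k x)).
have Gr : truncr G by apply: fld_fld_truncr.
have [N hN] := Gr q.
have [T hT] := @fin_bound _ (fun (i : 'I_N) m =>
   G (p + mu - k%:R + c - i%:R + m%:R) (q + i%:R) = 0) (fun i => fld_trunc _ _ _ _ _).
have hG (i l : nat) : (N + T <= i)%N || (N + T <= l)%N ->
    G (p + mu - k%:R + l%:R + c - i%:R) (q + i%:R) = 0.
  have [iN|Ni] := ltnP i N; last by rewrite hN.
  move=> il; rewrite -[RHS](hT (Ordinal iN) l); last by lia.
  by congr (G _ _); rewrite /=; ring.
transitivity (nsum (fun i => nsum (fun l => sbin c i *: cre l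
    (G (p + mu - k%:R + l%:R + c - i%:R) (q + i%:R))))).
  apply: eq_nsum => i; rewrite nsumZ; last first.
    by exists (N + T)%N => l hl; rewrite hG ?linear0 // hl orbT.
  congr (_ *: _); apply: eq_nsum => l; congr (cre l (fld _ _ _ _)).
  by rewrite /nu /c (natrD _ (i + j) k) (natrD _ i j); ring.
rewrite (@nsum_exchange _ (N + T)) => [|i l il]; last by rewrite hG ?linear0 ?scaler0.
apply: eq_nsum => l; rewrite [in RHS]linear_nsum; first last.
- by exists N => i Ni; rewrite /= -/(G _ _) hN ?scaler0.
- exact: linearP.
by apply: eq_nsum => i; rewrite (linearZ_LR (cre l)).
Qed.

(** The operator Y(v, w) Y(t_0 u, z) is z^mu t(z) (w - z)^{g s} Y(E(z-w) v, w) Y(u, z) E(z),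
    by moving t(z) to the left. *)
Lemma fld_fld_cre0 s v : fdeg s v -> exists M0, forall M, (M0 <= M)%N ->
  forall mu nu u x p q, annle M x ->
  fld (nu + g) v q (fld mu (cre 0 u) p x) =
  \sum_(j < M) \sum_(k < M) (-1) ^+ j *: creL (wzp (g * s%:R - j%:R)
    (fun p q => fld nu (ann j v) q (fld mu u p (ann k x))))
    (p + mu - k%:R) q.
Proof.
move=> vs; have [M0 h] := fld_cre_exchange g vs; exists M0 => M hM mu nu u x p q hx.
rewrite (fld_cre0N _ _ _ _ hx) linear_sum exchange_big; apply: eq_bigr => k _ /=.
rewrite linear_nsum; [|exact: linearP|exact: cre_fld_evz].
pose F j i l := ((-1) ^+ j * sbin (g * s%:R - j%:R) i) *: cre l
   (fld nu (ann j v) (q + (g * s%:R - j%:R) - i%:R)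
     (fld mu u (p + mu - k%:R + l%:R + i%:R) (ann k x))).
have [T hT] := fld_trunc g mu u (ann k x) (p + mu - k%:R).
have F0 j i l : (T <= i + l)%N -> F j i l = 0.
  by move=> il; rewrite /F -[_ + l%:R + _]addrA -natrD hT ?linear0 ?scaler0 //; lia.
transitivity (nsum (fun l => \sum_(j < M) \sum_(i < l.+1) F j i (l - i)%N)).
  apply: eq_nsum => l; rewrite (h M) //; apply: eq_bigr => j _; apply: eq_bigr => i _.
  by rewrite /F -[_ + _ + i%:R]addrA -natrD subnK // -ltnS.
rewrite -nsum_exchange_big => [|j]; last first.
  exists T => l hl; apply: big1 => i _; rewrite F0 // subnKC // -ltnS //.
apply: eq_bigr => j _; rewrite (@nsum_antidiag _ T _ (F0 j)).
rewrite (@nsum_exchange _ T) => [|i l il]; last by rewrite F0 //; lia.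
rewrite /creL -nsumZ; last first.
  exists T => l hl; rewrite /wzp nsum0 ?linear0 // => i.
  by rewrite -[_ + l%:R + _]addrA -natrD hT ?linear0 ?scaler0 //; lia.
apply: eq_nsum => l; rewrite /wzp linear_nsum; first last.
- exists T => i Ti; rewrite -[_ + l%:R + _]addrA -natrD hT ?linear0 ?scaler0 //; lia.
- exact: linearP.
rewrite -nsumZ; last first.
  exists T => i Ti; rewrite -[_ + l%:R + _]addrA -natrD hT ?linear0 ?scaler0 ?linear0 //; lia.
by apply: eq_nsum => i; rewrite (linearZ_LR (cre l)) scalerA.

Qed.

(** The products (t_0 u)(n) v and the operators Y(y, w) of the resulting vectors
    expand through t(z) twice; the two binomials that appear recombine by
    Vandermonde into the one for the shifted exponent. *)
Lemma borcherds_rhs_cre0 s v : fdeg s v -> forall mu nu u x n p q M,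
  annle M v -> annle M x ->
  nsum (fun J => fbin p J *: fld mu (fld nu (cre 0 u) (n + J%:R) v) (p + q - J%:R) x) =
  \sum_(j < M) \sum_(k < M) nsum (fun l => cre l (nsum (fun J =>
    fbin (p + mu - k%:R + l%:R) J *:
    fld mu (fld nu u (n + nu - j%:R + J%:R) (ann j v))
      (p + mu - k%:R + l%:R + q - J%:R) (ann k x)))).
Proof.
move=> vs mu nu u x n p q M hv hx.
pose Z j k t l := fld mu (fld nu u (n + nu - j%:R + t%:R) (ann j v))
      (p + mu - k%:R + l%:R + q - t%:R) (ann k x).
have [T hT] := @fin_bound _ (fun (j : 'I_M) m =>
   fld nu u (n + nu - j%:R + m%:R) (ann j v) = 0) (fun j => fld_trunc _ _ _ _ _).
have [L hL] := @fin_bound _ (fun (a : 'I_M * 'I_M * 'I_T) m =>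
   fld mu (fld nu u (n + nu - a.1.1%:R + a.2%:R) (ann a.1.1 v))
      (p + mu - a.1.2%:R + q - a.2%:R + m%:R) (ann a.1.2 x) = 0)
   (fun j => fld_trunc _ _ _ _ _).
pose B := (T + L)%N.
have Z0 (j k : 'I_M) (t l : nat) : (B <= t)%N || (B <= l)%N -> Z j k t l = 0.
  have [tT|Tt] := ltnP t T; last first.
    by rewrite /Z hT // (linear_0 (@fld_linearl _ g _ _ _)).
  move=> h; rewrite -[RHS](hL (j, k, Ordinal tT) l) /=; last by lia.
  by congr (fld _ _ _ _); ring.
pose F J (j k : 'I_M) l' l := (fbin p J * fbin (mu + l%:R - k%:R) l') *:
   cre l (Z j k (J + l')%N l).
have F0 J (j k : 'I_M) l' l : [|| (B <= J)%N, (B <= l')%N | (B <= l)%N] -> F J j k l' l = 0.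
  by move=> h; rewrite /F Z0 ?linear0 ?scaler0 //; lia.
transitivity (nsum (fun J => \sum_(j < M) \sum_(k < M)
    nsum (fun l' => nsum (F J j k l')))).
  apply: eq_nsum => J; rewrite (fld_cre0N _ _ _ _ hv).
  have lin k := @fld_linearl _ g mu k x.
  rewrite (linear_sumr (lin _)) scaler_sumr; apply: eq_bigr => j _.
  rewrite (linear_nsum (lin _)); last exact: cre_fld_evz.
  rewrite -nsumZ; last by apply: (evz_linear (lin _)); apply: cre_fld_evz.
  rewrite nsum_exchange_big => [|k]; last first.
    by exists B => l' hl'; apply: nsum0 => l; rewrite F0 // hl' orbT.
  apply: eq_nsum => l'; rewrite (fld_creN _ _ _ _ _ hx) scaler_sumr.
  apply: eq_bigr => k _; rewrite -nsumZ; last first.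
    by apply: (@evzZ _ _ (fun l => fbin (mu + l%:R - k%:R) l')); apply: cre_fld_evz.
  apply: eq_nsum => l; rewrite /F /Z scalerA (natrD _ J l').
  congr (_ *: cre l (fld _ (fld _ _ _ _) _ _)); ring.
have ez (j k : 'I_M) : evz (fun J => nsum (fun l' => nsum (F J j k l'))).
  by exists B => J hJ; apply: nsum0 => l'; apply: nsum0 => l; rewrite F0 // hJ.
rewrite -nsum_exchange_big => [|j]; last by apply: evz_sum.
apply: eq_bigr => j _; rewrite -nsum_exchange_big //; apply: eq_bigr => k _.
transitivity (nsum (fun J => nsum (fun l => nsum (fun l' => F J j k l' l)))).
  apply: eq_nsum => J; apply: (@nsum_exchange _ B) => l' l h; apply: F0; lia.
rewrite (@nsum_exchange _ B) => [|J l h]; last first.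
  by apply: nsum0 => l'; apply: F0; lia.
apply: eq_nsum => l; rewrite linear_nsum; first last.
- by exists B => J hJ; rewrite -/(Z j k J l) Z0 ?hJ ?scaler0.
- exact: linearP.
have -> : p + mu - k%:R + l%:R = p + (mu + l%:R - k%:R) by ring.
transitivity (nsum (fun J => fbin (p + (mu + l%:R - k%:R)) J *: cre l (Z j k J l))).
  rewrite -(@nsum_vandermonde _ _ (@fbin K)) //; first exact: fbin_vandermonde.
  by exists B => J hJ; rewrite Z0 ?hJ ?linear0.
apply: eq_nsum => J; rewrite (linearZ_LR (cre l)) /Z /=.
by congr (_ *: cre l (fld _ _ _ _)); ring.
Qed.

(** Both sides are brought to the form sum over j and k of t(z) (...) E_k applied to
    the identity for u, E_j v and E_k x: the exchange rules do this on the left, where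
    the exponent n = N - g (r+1) s becomes N - j - g r s after the factor
    (z - w)^{g s - j} is absorbed, and the expansion of (t_0 u)(n) v on the right. *)
Lemma borcherds_cre0 r u : borcherds_at g r u -> borcherds_at g r.+1 (cre 0 u).
Proof.
move=> IH s v vs mu N P q x n p.
have nE : n = N%:~R - g * r.+1%:R * s%:R by [].
have pE : p = P%:~R - mu * r.+1%:R by [].
clearbody n p.
have [M1 h1] := fld_cre0_fld vs; have [M2 h2] := fld_fld_cre0 vs.
have [M3 hv0] := annle_ex v; have [M4 hx0] := annle_ex x.
have [M [hM1 hM2 hM3 hM4]] : exists M, [/\ M1 <= M, M2 <= M, M3 <= M & M4 <= M]%N.
  by exists (M1 + M2 + M3 + M4)%N; split; lia.
have hv : annle M v by apply: annle_leq hv0.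
have hx : annle M x by apply: annle_leq hx0.
pose c (j : nat) := g * s%:R - j%:R.
pose G (j k : nat) p q := fld (mu + g * s%:R) u p (fld mu (ann j v) q (ann k x)).
pose H (j k : nat) p q := fld (mu + g * r%:R) (ann j v) q (fld mu u p (ann k x)).
have Gr j k : truncr (G j k) by apply: fld_fld_truncr.
have Gt j k q' : trunc (G j k ^~ q') by apply: fld_trunc.
have Hl j k : truncl (H j k) by apply: fld_fld_truncl.
(* The powers of z - w multiply to the exponent n + c j, and likewise in E2. *)
have E1 : zwp n (fun p q => fld (mu + g * s%:R) (cre 0 u) p (fld mu v q x)) p q =
   \sum_(j < M) \sum_(k < M) creL (zwp (n + c j) (G j k)) (p + mu - k%:R) q.
  transitivity (zwp n (fun p q => \sum_(j < M) \sum_(k < M)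
      creL (zwp (c j) (G j k)) (p + mu - k%:R) q) p q).
    apply: eq_nsum => i; rewrite (h1 M) //.
  have tr j k : truncr (creL (zwp (c j) (G j k))).
    move=> q'; have [T hT] := zwp_truncr (c j) (Gr j k) q'.
    by exists T => i p' Ti; apply: nsum0 => l; rewrite hT ?linear0.
  rewrite /zwp; under eq_nsum => i.
    rewrite scaler_sumr; under eq_bigr => j _ do rewrite scaler_sumr. over.
  have ez j k : evz (fun i => sbin n i *: creL (zwp (c j) (G j k))
      (p + n - i%:R + mu - k%:R) (q + i%:R)).
    by have [T hT] := tr j k q; exists T => i Ti; rewrite hT ?scaler0.
  rewrite -nsum_exchange_big => [|j]; last by apply: evz_sum => k; exact: ez.
  apply: eq_bigr => j _; rewrite -nsum_exchange_big => [|k]; last exact: ez.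
  apply: eq_bigr => k _.
  transitivity (zwp n (creL (zwp (c j) (G j k))) (p + mu - k%:R) q).
    apply: eq_nsum => i; congr (_ *: _).
    by have -> : p + n - i%:R + mu - k%:R = p + mu - k%:R + n - i%:R by ring.
  rewrite zwp_creL; [|exact: zwp_truncr|exact: zwp_trunc].
  by apply: eq_nsum => l; rewrite zwp_comp.
have E2 : wzp n (fun p q => fld (mu + g * r.+1%:R) v q (fld mu (cre 0 u) p x)) p q =
   \sum_(j < M) \sum_(k < M) (-1) ^+ j *: creL (wzp (n + c j) (H j k)) (p + mu - k%:R) q.
  have -> : mu + g * r.+1%:R = mu + g * r%:R + g.
    by rewrite -[r.+1]addn1 (natrD _ r 1); ring.
  transitivity (wzp n (fun p q => \sum_(j < M) \sum_(k < M)
      (-1) ^+ j *: creL (wzp (c j) (H j k)) (p + mu - k%:R) q) p q).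
    by apply: eq_nsum => i; rewrite (h2 M) //.
  have tr j k : truncl (creL (wzp (c j) (H j k))).
    move=> p'; have [T hT] := wzp_truncl (c j) (Hl j k) p'.
    exists T => i q' Ti; apply: nsum0 => l.
    by rewrite -[_ + i%:R + _]addrA -natrD hT ?linear0 //; lia.
  rewrite /wzp; under eq_nsum => i.
    rewrite scaler_sumr; under eq_bigr => j _ do rewrite scaler_sumr. over.
  have ez j k : evz (fun i => sbin n i *: ((-1) ^+ j *: creL (wzp (c j) (H j k))
      (p + i%:R + mu - k%:R) (q + n - i%:R))).
    have [T hT] := tr j k (p + mu - k%:R); exists T => i Ti.
    have -> : p + i%:R + mu - k%:R = p + mu - k%:R + i%:R by ring.
    by rewrite hT ?scaler0.
  rewrite -nsum_exchange_big => [|j]; last by apply: evz_sum => k; exact: ez.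
  apply: eq_bigr => j _; rewrite -nsum_exchange_big => [|k]; last exact: ez.
  apply: eq_bigr => k _.
  transitivity ((-1) ^+ j *: wzp n (creL (wzp (c j) (H j k))) (p + mu - k%:R) q).
    rewrite -nsumZ; last exact: wzp_evz.
    apply: eq_nsum => i; rewrite !scalerA mulrC; congr (_ *: _).
    by have -> : p + i%:R + mu - k%:R = p + mu - k%:R + i%:R by ring.
  rewrite wzp_creL; last exact: wzp_truncl.
  by congr (_ *: _); apply: eq_nsum => l; rewrite wzp_comp.
rewrite E1 E2 (borcherds_rhs_cre0 vs _ _ _ _ _ _ hv hx).
rewrite scaler_sumr -sumrB; apply: eq_bigr => j _.
rewrite scaler_sumr -sumrB; apply: eq_bigr => k _.
have ezH : evz (fun l => cre l (wzp (n + c j) (H j k) (p + mu - k%:R + l%:R) q)).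
  have [T hT] := wzp_truncl (n + c j) (Hl j k) (p + mu - k%:R).
  by exists T => l Tl; rewrite hT ?linear0.
have ezG : evz (fun l => cre l (zwp (n + c j) (G j k) (p + mu - k%:R + l%:R) q)).
  have [T hT] := @zwp_trunc _ (n + c j) _ (Gr j k) (Gt j k) q (p + mu - k%:R).
  by exists T => l Tl; rewrite hT ?linear0.
rewrite scalerA /creL -scaleNr addrC -nsumP //; apply: eq_nsum => l.
rewrite -linearP /= addrC scaleNr; congr (cre l _).
(* The exponents N - j and P - k + l are those with the same n + c j and power of z. *)
have := IH s (ann j v) (fdeg_ann g j vs) mu (N - j%:Z) (P - k%:Z + l%:Z) q (ann k x).
have -> : (N - j%:Z)%:~R - g * r%:R * s%:R = n + c j.
  by rewrite nE /c intrB -pmulrn -[r.+1]addn1 (natrD _ r 1); ring.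
have -> : (P - k%:Z + l%:Z)%:~R - mu * r%:R = p + mu - k%:R + l%:R.
  by rewrite pE intrD intrB -!pmulrn -[r.+1]addn1 (natrD _ r 1); ring.
rewrite sgnzD [(-1) ^+ j * _]mulrC => ->.
by apply: eq_nsum => J; congr (_ *: fld _ (fld _ _ _ _) _ _); rewrite /c; ring.
Qed.

Theorem fld_borcherds r u : fdeg r u -> borcherds_at g r u.
Proof.
move: r u; apply: fock_t0D_ind.
- exact: borcherds_lclosed.
- exact: borcherds_nil.
- by move=> r u _; apply: borcherds_cre0.
- by move=> r u _; apply: borcherds_tder.
Qed.

End BorcherdsCreation.

(** * Generation by b, the vacuum and locality *)

Notation fock_ann := ann.

Section Vacuum.
Variables (K : numFieldType) (g : K).
Local Notation fock := (fock K).
Local Notation fld := (fld g).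
Local Notation ann := (ann g).
Implicit Types (x y u v : fock) (mu n p q : K).

Definition vac1 : fock := mon K [::].
Definition bvec : fock := cre 0 vac1.

Lemma fdeg_vac : fdeg 0 vac1. Proof. exact: (fdeg_mon K [::]). Qed.
Lemma fdeg_b : fdeg 1 bvec. Proof. exact/fdeg_cre/fdeg_vac. Qed.

Lemma fld_b mu n x : fld mu bvec n x =
  nsum (fun k => nsum (fun l => cre l (if n + mu + l%:R - k%:R == -1 then ann k x else 0))).
Proof.
by rewrite fld_cre0; apply: eq_nsum => k; apply: eq_nsum => l; rewrite fld_nil.
Qed.

(** Solving b(z) = z^mu t(z) E(z) for t(z), as E^g(z) has inverse E^{-g}(z). *)
Lemma cre_fld_b mu (a : nat) x : cre a x =
  nsum (fun k => fld mu bvec (-1 - a%:R - mu - k%:R) (fock_ann (- g) k x)).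
Proof.
pose Phi (k : nat) y := cre (a + k) y : fock.
have <- : Phi 0%N x = cre a x by rewrite /Phi addn0.
rewrite -(@nsum_ann_inv _ _ g x Phi) => [|k]; last exact: linearP.
have [N hN] := annle_ex x.
rewrite (@nsum_exchange _ N) => [|i j /orP[h|h]]; last first.
- by rewrite /Phi hN // !linear0.
- by rewrite /Phi (annle_ann _ _ hN) // linear0.
apply: eq_nsum => j; rewrite fld_b; apply: eq_nsum => i.
rewrite (@nsum1 _ (a + (i + j))%N) => [|l hl].
  have h : -1 - a%:R - mu - j%:R + mu + (a + (i + j))%:R - i%:R = -1 :> K.
    by rewrite (natrD _ a) (natrD _ i); ring.
  by rewrite h eqxx.
rewrite ifF ?linear0 //; apply: contraNF hl => /eqP h.
rewrite -(eqr_nat K) !natrD -subr_eq0; apply/eqP.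
transitivity ((-1 - a%:R - mu - j%:R + mu + l%:R - i%:R) - (-1) : K); first by ring.
by rewrite h subrr.
Qed.

(** By the preceding formula each t_a is a combination of modes of b. *)
Lemma fock_b_ind (m : K) (W : fock -> Prop) : lclosed W -> W vac1 ->
  (forall s x n, fdeg s x -> W x -> W (fld (m + g * s%:R) bvec n x)) -> forall x, W x.
Proof.
move=> Wl W1 Wb; suff H r x : fdeg r x -> W x.
  by apply: fock_ind => // s; apply: H (fdeg_mon K s).
elim: r x => [|r IH]; first by apply: fdeg_ind => // s /size0nil ->.
apply: fdeg_ind => // -[//|a s] [sr]; rewrite -cre_mon.
have xr : fdeg r (mon K s) by rewrite -sr; apply: fdeg_mon.
rewrite (cre_fld_b (m + g * r%:R)); apply: lclosed_nsum => //.
  have [N h] := annle_ex (mon K s).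
  by exists N => k Nk; rewrite h ?linear0.
by move=> k; apply: Wb; [apply: fdeg_ann|apply/IH/fdeg_ann].
Qed.

(** D acts as a derivation of all products u(n)x, provided that the parameter mu is
    g times the degree of x.  For t_0 u, the derivative of z^mu is what the
    commutator of D with E(z) leaves over. *)
Lemma fld_derivation s x : fdeg s x -> forall u n,
  tder (fld (g * s%:R) u n x) =
  fld (g * s%:R) (tder u) n x + fld (g * s%:R) u n (tder x).
Proof.
set mu := g * s%:R => xs u n; move: (u) n x xs.
suff H r v : fdeg r v -> forall n x, fdeg s x ->
  tder (fld mu v n x) = fld mu (tder v) n x + fld mu v n (tder x).
  apply: fock_ind => [|t n x xs]; last exact: H (fdeg_mon K t) n x xs.
  split=> [|c v w hv hw] n x xs.
    by rewrite !linear0 !(linear_0 (@fld_linearl _ g _ _ _)) addr0 linear0.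
  rewrite linearP !(@fld_linearl _ g) linearP /= hv // hw //.
  by rewrite scalerDr addrACA.
move: r v; apply: fock_t0D_ind.
- move=> r; split=> [n x xs|c v w hv hw n x xs].
    by rewrite !linear0 !(linear_0 (@fld_linearl _ g _ _ _)) addr0 linear0.
  rewrite linearP !(@fld_linearl _ g) linearP /= hv // hw //.
  by rewrite scalerDr addrACA.
- move=> n x xs; rewrite tder_nil (linear_0 (@fld_linearl _ g _ _ _)) add0r !fld_nil.
  by case: ifP => _; rewrite ?linear0.
- move=> r v vr IH n x xs.
  have [N0 h0] := annle_ex x.
  have hx : annle N0.+1 x by apply: annle_leq h0.
  have hx' : annle N0.+1 (tder x).
    move=> c [//|k] Nk; rewrite (ann_tder c k xs) (h0 c k.+1) ?(h0 c k) ?linear0 //.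
      by rewrite ?scaler0 ?subr0 ?addr0 ?oppr0.
    exact: ltnW.
  rewrite fld_tder (fld_cre0N _ _ _ _ hx) (fld_cre0N _ _ _ _ hx').
  rewrite (fld_cre0N _ _ _ _ hx) linear_sum.
  pose Z k l := cre l (fld mu v (n - 1 + mu - k%:R + l%:R) (ann k x)).
  have Zz k : evz (Z k) by apply: cre_fld_evz.
  have cz (c : nat -> K) k : evz (fun l => c l *: Z k l) by apply: evzZ.
  have E1 k : tder (nsum (fun l => cre l (fld mu v (n + mu - k%:R + l%:R) (ann k x)))) =
     nsum (fun l => (l%:R - (n + mu - k%:R + l%:R)) *: Z k l) +
     nsum (fun l => cre l (fld mu v (n + mu - k%:R + l%:R) (tder (ann k x)))).
    rewrite linear_nsum; [|exact: linearP|exact: cre_fld_evz].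
    transitivity (nsum (fun l => l.+1%:R *: Z k l.+1 +
       (- (n + mu - k%:R + l%:R) *: Z k l +
       cre l (fld mu v (n + mu - k%:R + l%:R) (tder (ann k x)))))).
      apply: eq_nsum => l; rewrite /= tder_cre (IH _ _ (fdeg_ann g k xs)) fld_tder.
      rewrite linearD (linearZ_LR (cre l)) /= /Z; congr (_ *: cre _ (fld _ _ _ _) + (_ *: cre _ (fld _ _ _ _) + _)).
        by rewrite -[l.+1]addn1 (natrD _ l 1); ring.
      by ring.
    rewrite (@nsum_add fock); first last.
    - by apply: evz_add; [exact: cz|exact: cre_fld_evz].
    - exact: (evz_S (cz (fun l => l%:R) k)).
    rewrite (@nsum_add fock); [|exact: cz|exact: cre_fld_evz].
    rewrite addrA; congr (_ + _).
    have -> : nsum (fun l => l.+1%:R *: Z k l.+1) = nsum (fun l => l%:R *: Z k l).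
      by rewrite [RHS]nsum_recl // scale0r add0r.
    rewrite -(@nsum_add fock) //.
    by apply: eq_nsum => l; rewrite -scalerDl.
  rewrite (eq_bigr _ (fun (k : 'I_N0.+1) _ => E1 k)) big_split /=.
  pose X k := nsum (fun l => cre l (fld mu v (n + mu - k%:R + l%:R) (ann k (tder x)))).
  have lin (k : nat) : linear (fun y => nsum (fun l => cre l (fld mu v (n + mu - k%:R + l%:R) y))).
    apply: nsum_linear => [l|y]; last exact: cre_fld_evz.
    by move=> c y y'; rewrite (linearP (fld _ _ _)) (linearP (cre l)).
  have E2 : \sum_(k < N0.+1) nsum (fun l => cre l (fld mu v (n + mu - k%:R + l%:R)
       (tder (ann k x)))) = \sum_(k < N0.+1) X k +
     \sum_(k < N0.+1) nsum (fun l => (mu - k%:R) *: Z k l).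
    rewrite big_ord_recl [X in _ = X + _]big_ord_recl [X in _ = _ + X]big_ord_recr /=.
    rewrite [X in _ = _ + (_ + X)]nsum0 ?addr0 => [|l]; last first.
      by rewrite /Z h0 // !linear0 ?scaler0.
    rewrite /X !ann_id -[RHS]addrA; congr (_ + _); rewrite -big_split; apply: eq_bigr => k _ /=.
    rewrite /bump /= add1n.
    have -> : tder (ann k.+1 x) = ann k.+1 (tder x) + (mu - k%:R) *: ann k x.
      by rewrite (ann_tder g k xs) subrK.
    rewrite (linear_D (lin k.+1)) (linear_Z (lin k.+1)); congr (_ + _).
    rewrite nsumZ //; congr (_ *: _); apply: eq_nsum => l; congr (cre _ (fld _ _ _ _)).
    by rewrite -[k.+1]addn1 (natrD _ k 1); ring.
  rewrite E2 [X in _ + X]addrC addrA; congr (_ + _).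
  rewrite -big_split scaler_sumr; apply: eq_bigr => k _ /=.
  rewrite -(@nsum_add fock); first last.
  - exact: (cz (fun _ => mu - k%:R)).
  - exact: (cz (fun l => l%:R - (n + mu - k%:R + l%:R))).
  rewrite -nsumZ; last exact: (Zz k).
  apply: eq_nsum => l; rewrite -scalerDl; congr (_ *: _); ring.
- move=> r v vr IH n x xs; rewrite !fld_tder linearZ /= IH // fld_tder.
  by rewrite scalerDr !scalerA.
Qed.

(** On 1 the E_k with k > 0 vanish and mu = 0, so no negative power of z
    arises, and the value u at z = 0 follows from the induction by t_0 and D. *)
Lemma fld_vac r u : fdeg r u ->
  (forall n, (forall k : nat, n <> - k.+1%:R) -> fld 0 u n vac1 = 0) /\
  fld 0 u (-1) vac1 = u.
Proof.
have annv k : ann k.+1 vac1 = 0 by rewrite ann_nil.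
have e0 : g * 0%:R = 0 :> K by rewrite mulr0.
move: r u; apply: fock_t0D_ind.
- move=> r; split=> [|c u v [u0 u1] [v0 v1]].
    by split=> [n _|]; rewrite (linear_0 (@fld_linearl _ g _ _ _)).
  split=> [n hn|]; rewrite (@fld_linearl _ g).
    by rewrite u0 // v0 // scaler0 addr0.
  by rewrite u1 v1.
- split=> [n hn|]; rewrite fld_nil ?eqxx //.
  by case: eqP => // n1; case: (hn 0%N).
- move=> r u _ [u0 u1].
  have E n : fld 0 (cre 0 u) n vac1 = nsum (fun l => cre l (fld 0 u (n + l%:R) vac1)).
    rewrite fld_cre0 (@nsum1 _ 0%N) => [|[//|k] _]; last first.
      by apply: nsum0 => l; rewrite annv !linear0.
    by apply: eq_nsum => l; rewrite ann_id subr0 addr0.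
  split=> [n hn|]; rewrite E.
    apply: nsum0 => l; rewrite u0 ?linear0 // => k hk; apply: (hn (k + l)%N).
    rewrite -[n](addrK l%:R) hk -addSn natrD; ring.
  rewrite (@nsum1 _ 0%N) => [|[//|l] _]; first by rewrite addr0 u1.
  rewrite u0 ?linear0 // => k /eqP; rewrite -subr_eq0 opprK -[l.+1]addn1 (natrD _ l 1).
  have -> : -1 + (l%:R + 1) + k.+1%:R = (l + k.+1)%:R :> K by rewrite natrD; ring.
  by rewrite pnatr_eq0; lia.
- move=> r u ur [u0 u1]; split=> [n hn|]; rewrite fld_tder.
    have [->|n0] := eqVneq n 0; first by rewrite oppr0 scale0r.
    rewrite u0 ?scaler0 // => -[|k] hk.
      by case/eqP: n0; rewrite -[n](subrK 1) hk; ring.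
    by apply: (hn k); rewrite -[n](subrK 1) hk -[k.+2]addn1 (natrD _ k.+1 1); ring.
  have := fld_derivation fdeg_vac u (-1); rewrite e0 tder_nil linear0 addr0 u1 fld_tder.
  by move=> <-.
Qed.

Lemma fld_b_b n : (forall k : nat, n <> - g - k.+1%:R) -> fld g bvec n bvec = 0.
Proof.
move=> hn; rewrite fld_b (@nsum1 _ 0%N) => [|[//|k] _]; last first.
  by apply: nsum0 => l; case: ifP => _; rewrite ?ann_cre0 ?ann_nil ?linear0.
apply: nsum0 => l; case: eqP => h; rewrite ?linear0 //.
case: (hn l); transitivity (n + g + l%:R - 0%:R - g - l%:R); first by ring.
by rewrite h -[l.+1]addn1 (natrD _ l 1); ring.
Qed.

Definition in_coset p (c : K) := exists j : int, p = j%:~R + c.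

(** Unlike in fld_borcherds, p is arbitrary: when it is outside the coset in which the
    modes of u act, all terms on the left vanish, and the delta function on the right
    as well. *)
Lemma fld_borcherds_coset r s u v mu (N : int) p q x : fdeg r u -> fdeg s v ->
  let n := N%:~R - g * r%:R * s%:R in
  zwp n (fun p q => fld (mu + g * s%:R) u p (fld mu v q x)) p q -
  sgnz K N *: wzp n (fun p q => fld (mu + g * r%:R) v q (fld mu u p x)) p q =
  nsum (fun j => if `[< in_coset p (- (mu * r%:R)) >] then
    fbin p j *: fld mu (fld (g * s%:R) u (n + j%:R) v) (p + q - j%:R) x else 0).
Proof.
move=> ur vs n; have [[P ->]|hp] := pselect (in_coset p (- (mu * r%:R))).
  rewrite (fld_borcherds g ur vs); apply: eq_nsum => j.
  by rewrite asboolT //; exists P.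
rewrite [RHS]nsum0 => [|j]; last by rewrite asboolF.
rewrite /zwp /wzp !nsum0 ?scaler0 ?subr0 // => i.
- rewrite [fld mu u _ _](@fld_support _ g _ _ _ _ _ ur) ?linear0 ?scaler0 // => j hj.
  apply: hp; exists (j - i%:Z); rewrite intrB -pmulrn -[p](addrK i%:R) hj; ring.
- rewrite (@fld_support _ g _ _ _ _ _ ur) ?scaler0 // => j hj.
  apply: hp; exists (j - N + i%:Z); rewrite intrD intrB -pmulrn.
  rewrite -[p](addrK n) -[p + n](subrK i%:R) hj /n; ring.
Qed.

End Vacuum.

(** * The algebra and the modules of polynomials *)

Section GradedFields.
Variables (K : numFieldType) (g : K).
Local Notation fock := (fock K).
Implicit Types (x y u v : fock) (m n p q : K).

Lemma proj_supported (Q Q' : pred (seq nat)) x :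
  (forall s s', perm_eq s s' -> Q s = Q s') -> supported Q' x ->
  (forall s, Q' s -> Q s) -> proj Q x = x.
Proof.
move=> Qp [h] QQ'; apply: (h (fun y => proj Q y = y)) => [|s Qs]; last first.
  by rewrite proj_mon // QQ'.
by split=> [|c y z hy hz]; rewrite ?linear0 // linearP /= hy hz.
Qed.

Lemma proj_disjoint (Q Q' : pred (seq nat)) x :
  (forall s s', perm_eq s s' -> Q s = Q s') -> supported Q' x ->
  (forall s, Q' s -> ~~ Q s) -> proj Q x = 0.
Proof.
move=> Qp [h] QQ'; apply: (h (fun y => proj Q y = 0)) => [|s Qs]; last first.
  by rewrite proj_mon // (negPf (QQ' _ Qs)).
by split=> [|c y z hy hz]; rewrite ?linear0 // linearP /= hy hz scaler0 addr0.
Qed.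

(** The action on the module of order -m: on polynomials of degree s the parameter is
    m + g s. *)
Definition Ymod m u n (x : fock) : fock :=
  linext (fun s => fld g (m + g * (size s)%:R) u n (mon K s)) x.
HB.instance Definition _ m u n :=
  GRing.isLinear.Build K fock fock _ (Ymod m u n) (flinext_linear _).

Lemma Ymod_fdeg m s u n x : fdeg s x -> Ymod m u n x = fld g (m + g * s%:R) u n x.
Proof.
move: x; apply: fdeg_ind => [|t <-].
  by split=> [|c x y hx hy]; rewrite ?linear0 // !linearP /= hx hy.
rewrite /Ymod linext_mon // => s1 s2 h; by rewrite (perm_size h) (mon_perm _ h).
Qed.

Lemma Ymod_linearl m n x : linear (fun u => Ymod m u n x).
Proof.
move=> c u v; move: x; apply: fock_ind => [|s].
  split=> [|d x y hx hy]; first by rewrite !linear0 ?scaler0 ?addr0.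
  rewrite (linearP (Ymod m (c *: u + v) n)) (linearP (Ymod m u n)).
  by rewrite (linearP (Ymod m v n)) /= hx hy !scalerDr !scalerA [c * d]mulrC addrACA.
by rewrite !(Ymod_fdeg _ _ _ (fdeg_mon K s)) (@fld_linearl _ g).
Qed.

Lemma Ymod0l m n x : Ymod m 0 n x = 0.
Proof. exact: (linear_0 (@Ymod_linearl m n x)). Qed.

Lemma Ymod_trunc m u x : trunc (Ymod m u ^~ x).
Proof.
move: x; apply: fock_ind => [|s].
  split=> [n|c x y hx hy n]; first by exists 0%N => i _; rewrite linear0.
  have [N hN] := hx n; have [M hM] := hy n; exists (N + M)%N => i Ni.
  by rewrite linearP /= hN ?hM ?scaler0 ?addr0 //; lia.
move=> n; have [N h] := fld_trunc g (m + g * (size s)%:R) u (mon K s) n.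
by exists N => i Ni; rewrite (Ymod_fdeg _ _ _ (fdeg_mon K s)) h.
Qed.

End GradedFields.

Section ModelBasics.
Local Open Scope classical_set_scope.
Local Open Scope ring_scope.
Variable R : realType.
Local Notation K := R[i].
Variable g : K.
Local Notation fock := (fock K).
Local Notation Ymod := (Ymod g).
Implicit Types (x y u v : fock) (m n p q : K).

Lemma epi0 : epi 0 = 1 :> K.
Proof. by rewrite /epi mulr0 expc0. Qed.

Lemma epi1 : epi 1 = -1 :> K.
Proof.
rewrite /epi mulr1 /expc /= expR0 cospi sinpi mulr0 mul1r.
by apply/eqP; rewrite eq_complex /= oppr0 !eqxx.
Qed.

Lemma epi_nat (k : nat) : epi (k%:R : K) = (-1) ^+ k.
Proof.
elim: k => [|k IH]; first by rewrite epi0.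
by rewrite -addn1 natrD epiD IH epi1 addn1 exprSr.
Qed.

Lemma epi_int (k : int) : epi (k%:~R : K) = sgnz K k.
Proof.
case: k => k; first by rewrite -pmulrn epi_nat.
have h : epi ((Negz k)%:~R : K) * (-1) ^+ k.+1 = 1.
  by rewrite -epi_nat -epiD NegzE mulrNz addNr epi0.
transitivity (epi ((Negz k)%:~R : K) * (-1) ^+ k.+1 * (-1) ^+ k.+1).
  by rewrite -mulrA -expr2 sqrr_sign mulr1.
by rewrite h mul1r.
Qed.

(** Monomials form a basis, so any labelling of them is a grading; the projections
    onto the labels separate the components. *)
Lemma supported_direct_sum (I : Type) (Q : I -> pred (seq nat)) :
  (forall i s s', perm_eq s s' -> Q i s = Q i s') ->
  (forall s, exists i, Q i s) -> (forall i j s, Q i s -> Q j s -> i = j) ->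
  direct_sum (fun i => [set x : fock | supported (Q i) x]).
Proof.
move=> Qp Qc Qd; split=> [i|x|k i f ii fW f0 j].
- exact: (supported_lclosed K (Q i)).
- move: x; apply: fock_ind => [|s].
    split=> [|c x y [k1 [i1 [f1 [h1 ->]]]] [k2 [i2 [f2 [h2 ->]]]]].
      have [i _] := Qc [::]; exists 1%N, (fun=> i), (fun=> 0); split=> [_|].
        by case: (supported_lclosed K (Q i)).
      by rewrite big_ord1.
    exists (k1 + k2)%N, (fun j : 'I_(k1 + k2) => match fintype.split j with inl a => i1 a | inr b => i2 b end),
      (fun j : 'I_(k1 + k2) => match fintype.split j with inl a => c *: f1 a | inr b => f2 b end); split.
      move=> j; case: (fintype.split j) => a; last exact: h2.
      exact: (lclosedZ c (supported_lclosed K _) (h1 a)).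
    rewrite big_split_ord scaler_sumr; congr (_ + _); apply: eq_bigr => j _.
      by rewrite (unsplitK (inl _ j)).
    by rewrite (unsplitK (inr _ j)).
  have [i Qi] := Qc s; exists 1%N, (fun=> i), (fun=> mon K s); split=> [_|].
    exact: supported_mon.
  by rewrite big_ord1.
- have := congr1 (proj (Q (i j))) f0; rewrite linear0 linear_sum (bigD1 j) //=.
  rewrite big1 => [|j' j'j]; last first.
    apply: proj_disjoint (fW j') _; first exact: Qp.
    move=> s Qs; apply/negP => Qs'; case/eqP: j'j; apply: ii; exact: Qd Qs Qs'.
  by rewrite addr0 (proj_supported (Qp _) (fW j)).
Qed.

(** Indexed by all integers, with zero components in negative degrees. *)
Definition fgr (a : int) : set fock :=
  [set x | supported (fun s => (size s)%:Z == a) x].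

Lemma fgr_pos (r : nat) x : fgr r x <-> fdeg r x.
Proof. by []. Qed.

Lemma fgr_neg (r : nat) x : fgr (Negz r) x -> x = 0.
Proof. by move=> [h]; apply: (h (fun y => y = 0)) => //; split=> // c y z -> ->; rewrite scaler0 addr0. Qed.

Lemma fgr0 a : fgr a 0. Proof. by case: (supported_lclosed K (fun s => (size s)%:Z == a)). Qed.

Lemma fgr_direct : direct_sum fgr.
Proof.
apply: (@supported_direct_sum int (fun a s => (size s)%:Z == a)).
- by move=> a s s' /perm_size ->.
- by move=> s; exists (size s).
- by move=> i j s /eqP <- /eqP.
Qed.

Lemma fgr_Ymod m a l u n x : fgr a u -> fgr l x -> fgr (a + l) (Ymod m u n x).
Proof.
case: a => a; last by move=> /fgr_neg ->; rewrite Ymod0l => _; apply: fgr0.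
case: l => l; last by move=> _ /fgr_neg ->; rewrite linear0; apply: fgr0.
move=> /fgr_pos au /fgr_pos lx; rewrite -PoszD; apply/fgr_pos.
by rewrite (Ymod_fdeg _ _ _ _ lx); apply: fdeg_fld.
Qed.

Lemma Ymod_laurent m a l u x : fgr a u -> fgr l x ->
  in_laurent (fgr (a + l)) (Delta1Z g m a l) (fun n => Ymod m u n x).
Proof.
move=> au lx; split=> [n|n hn|]; first exact: fgr_Ymod.
- case: a au hn => a; last by move=> /fgr_neg -> _; rewrite Ymod0l.
  case: l lx => l; last by move=> /fgr_neg -> _ _; rewrite linear0.
  move=> /fgr_pos lx /fgr_pos au hn; rewrite (Ymod_fdeg _ _ _ _ lx).
  apply: (@fld_support _ g _ a) => // j hj; apply: hn; exists j.
  by rewrite hj /Delta1Z -!pmulrn; ring.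
- have [N h] := Ymod_trunc g m u x (Delta1Z g m a l); exists N => -[k Nk|k //].
  exact: h.
Qed.

(** The identity fld_borcherds_coset in the form required of modules: on homogeneous
    vectors the phase eta e^{pi i n} is the sign of N. *)
Lemma Ymod_borcherds m a b l u v x : fgr a u -> fgr b v -> fgr l x ->
  forall n, eqmodZ n (DeltaZ g a b) -> forall p q,
  zw_pow n (fun p q => Ymod m u p (Ymod m v q x)) p q -
  (etaZ g a b * epi n) *: wz_pow n (fun p q => Ymod m v q (Ymod m u p x)) p q =
  \sum_(j \in [set: nat]) delta_mul (Delta1Z g m a l) j
    (fun k => Ymod m (Ymod 0 u (n + j%:R) v) k x) p q.
Proof.
move=> au bv lx n [N hN] p q.
suff : zwp n (fun p q => Ymod m u p (Ymod m v q x)) p q -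
    (etaZ g a b * epi n) *: wzp n (fun p q => Ymod m v q (Ymod m u p x)) p q =
    nsum (fun j => delta_mul (Delta1Z g m a l) j
      (fun k => Ymod m (Ymod 0 u (n + j%:R) v) k x) p q) by [].
have triv : u = 0 \/ v = 0 \/ x = 0 ->
    zwp n (fun p q => Ymod m u p (Ymod m v q x)) p q -
    (etaZ g a b * epi n) *: wzp n (fun p q => Ymod m v q (Ymod m u p x)) p q =
    nsum (fun j => delta_mul (Delta1Z g m a l) j
      (fun k => Ymod m (Ymod 0 u (n + j%:R) v) k x) p q).
  move=> h; rewrite /zwp /wzp !nsum0 ?scaler0 ?subr0 // => i.
  - rewrite /delta_mul; case: ifP => _ //.
    by case: h => [|[|]] ->; rewrite ?Ymod0l ?linear0 ?Ymod0l ?scaler0.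
  - by case: h => [|[|]] ->; rewrite ?Ymod0l ?linear0 ?Ymod0l ?linear0 ?scaler0.
  - by case: h => [|[|]] ->; rewrite ?Ymod0l ?linear0 ?Ymod0l ?linear0 ?scaler0.
case: a au hN triv => r au hN triv; last by apply: triv; left; apply: fgr_neg au.
case: b bv hN triv => s bv hN triv; last by apply: triv; right; left; apply: fgr_neg bv.
case: l lx triv => l lx triv; last by apply: triv; right; right; apply: fgr_neg lx.
move: au bv lx => /fgr_pos au /fgr_pos bv /fgr_pos lx {triv}.
have nE : n = N%:~R - g * r%:R * s%:R.
  by rewrite -hN /DeltaZ -!pmulrn opprK addrK.
have -> : etaZ g r s * epi n = sgnz K N.
  by rewrite /etaZ -epiD nE -!pmulrn addrC subrK epi_int.
have := fld_borcherds_coset g (m + g * l%:R) N p q x au bv; rewrite -nE /=.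
have e1 : m + g * l%:R + g * s%:R = m + g * (s + l)%:R by rewrite natrD; ring.
have e2 : m + g * l%:R + g * r%:R = m + g * (r + l)%:R by rewrite natrD; ring.
rewrite e1 e2 => h.
transitivity (zwp n (fun p0 q0 => fld g (m + g * (s + l)%:R) u p0
      (fld g (m + g * l%:R) v q0 x)) p q - sgnz K N *:
    wzp n (fun p0 q0 => fld g (m + g * (r + l)%:R) v q0
      (fld g (m + g * l%:R) u p0 x)) p q).
  congr (_ - _ *: _); apply: eq_nsum => i.
    rewrite (Ymod_fdeg _ _ _ _ lx) (@Ymod_fdeg _ g m (s + l)) //; exact: fdeg_fld.
  rewrite (Ymod_fdeg _ _ _ _ lx) (@Ymod_fdeg _ g m (r + l)) //; exact: fdeg_fld.
rewrite h; apply: eq_nsum => j; rewrite /delta_mul (Ymod_fdeg _ _ _ _ lx).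
rewrite (Ymod_fdeg _ _ _ _ bv) add0r.
have -> : `[< in_coset p (- ((m + g * l%:R) * r%:R)) >] = `[< eqmodZ p (Delta1Z g m r l) >].
  have e : Delta1Z g m r l = - ((m + g * l%:R) * r%:R).
    by rewrite /Delta1Z -!pmulrn; ring.
  by rewrite e; apply/asboolP/asboolP => -[k hk]; exists k; rewrite ?hk ?addrK // -hk subrK.
by [].
Qed.

End ModelBasics.

Section ModelGva.
Local Open Scope classical_set_scope.
Local Open Scope ring_scope.
Variable R : realType.
Local Notation K := R[i].
Variable g : K.
Local Notation fock := (fock K).
Local Notation Ymod := (Ymod g).
Local Notation fgr := (@fgr R).
Local Notation vac1 := (vac1 K).
Local Notation bvec := (bvec K).
Implicit Types (x y u v : fock) (m n p q : K).

Lemma Ymod_Ymod_truncr m u v x : truncr (fun p q => Ymod m u p (Ymod m v q x)).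
Proof.
move=> q; have [N h] := Ymod_trunc g m v x q.
by exists N => i p Ni; rewrite h // linear0.
Qed.

Lemma Ymod_Ymod_truncl m u v x : truncl (fun p q => Ymod m v q (Ymod m u p x)).
Proof.
move=> p; have [N h] := Ymod_trunc g m u x p.
by exists N => i q Ni; rewrite h // linear0.
Qed.

Lemma Ymod_local_lclosed m u v N c p q : lclosed (fun x =>
  zw_pow N (fun p q => Ymod m u p (Ymod m v q x)) p q =
  c *: wz_pow N (fun p q => Ymod m v q (Ymod m u p x)) p q).
Proof.
suff : lclosed (fun x => zwp N (fun p q => Ymod m u p (Ymod m v q x)) p q =
  c *: wzp N (fun p q => Ymod m v q (Ymod m u p x)) p q) by [].
split=> [|d x y hx hy].
  by rewrite /zwp /wzp !nsum0 ?scaler0 // => i; rewrite !linear0 ?scaler0.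
transitivity (d *: zwp N (fun p q => Ymod m u p (Ymod m v q x)) p q +
   zwp N (fun p q => Ymod m u p (Ymod m v q y)) p q).
  rewrite /zwp -nsumP; [|exact: (zwp_evz _ _ _ (@Ymod_Ymod_truncr _ _ _ _))..].
  apply: eq_nsum => i; rewrite (linearP (Ymod m v _)) (linearP (Ymod m u _)).
  by rewrite scalerDr !scalerA mulrC.
rewrite hx hy scalerA [d * c]mulrC -scalerA -scalerDr; congr (_ *: _).
rewrite /wzp -nsumP; [|exact: (wzp_evz _ _ _ (@Ymod_Ymod_truncl _ _ _ _))..].
apply: eq_nsum => i; rewrite (linearP (Ymod m u _)) (linearP (Ymod m v _)).
by rewrite scalerDr !scalerA mulrC.
Qed.

(** Locality from the Borcherds identity, at an exponent where all the
   products u(n+j)v vanish. *)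
Lemma Ymod_local_at m a b u v n : fgr a u -> fgr b v -> eqmodZ n (DeltaZ g a b) ->
  (forall j : nat, Ymod 0 u (n + j%:R) v = 0) -> forall x p q,
  zw_pow n (fun p q => Ymod m u p (Ymod m v q x)) p q =
  (etaZ g a b * epi n) *: wz_pow n (fun p q => Ymod m v q (Ymod m u p x)) p q.
Proof.
move=> au bv hn h0 x p q; move: x; apply: fock_ind => [|s].
  exact: Ymod_local_lclosed.
have sx : fgr (size s) (mon K s) by exact: (fdeg_mon K s).
apply/eqP; rewrite -subr_eq0; apply/eqP.
rewrite (Ymod_borcherds _ au bv sx hn); apply: (@nsum0 fock) => j.
by rewrite /delta_mul h0 Ymod0l scaler0; case: ifP.
Qed.

Lemma fock_local a b u v : fgr a u -> fgr b v ->
  exists2 N : K, eqmodZ N (DeltaZ g a b) & forall x p q,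
    zw_pow N (fun p q => Ymod 0 u p (Ymod 0 v q x)) p q =
    (etaZ g a b * epi N) *:
      wz_pow N (fun p q => Ymod 0 v q (Ymod 0 u p x)) p q.
Proof.
move=> au bv; have [J hJ] := Ymod_trunc g 0 u v (DeltaZ g a b).
have hN : eqmodZ (DeltaZ g a b + J%:R) (DeltaZ g a b).
  by exists J; rewrite addrC addKr.
exists (DeltaZ g a b + J%:R) => //; apply: Ymod_local_at => // j.
by rewrite -addrA -natrD hJ // leq_addr.
Qed.

Lemma fock_der u n v :
  tder (Ymod 0 u n v) - Ymod 0 u n (tder v) = - n *: Ymod 0 u (n - 1) v.
Proof.
move: v; apply: fock_ind => [|s].
  split=> [|c x y hx hy]; first by rewrite !linear0 ?subr0 ?addr0.
  rewrite !(linearP (Ymod 0 u _)) !(linearP (@tder K)) (linearP (Ymod 0 u _)) /=.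
  by rewrite opprD addrACA -scalerBr hx hy scalerDr !scalerA mulrC.
rewrite !(Ymod_fdeg _ _ _ _ (fdeg_mon K s)).
rewrite (Ymod_fdeg _ _ _ _ (fdeg_tder (fdeg_mon K s))) add0r.
by rewrite (fld_derivation g (fdeg_mon K s)) addrK fld_tder.
Qed.

Lemma fock_vac u : (forall n, ~ negZ n -> Ymod 0 u n vac1 = 0) /\ Ymod 0 u (-1) vac1 = u.
Proof.
have E n v : Ymod 0 v n vac1 = fld g 0 v n vac1.
  by rewrite (Ymod_fdeg _ _ _ _ (fdeg_vac K)) mulr0 addr0.
move: u; apply: fock_ind => [|s].
  split=> [|c u v [u0 u1] [v0 v1]]; first by split=> [n _|]; rewrite Ymod0l.
  split=> [n hn|]; rewrite (@Ymod_linearl _ g); first by rewrite u0 // v0 // scaler0 addr0.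
  by rewrite u1 v1.
have [h0 h1] := fld_vac g (fdeg_mon K s); rewrite E; split=> // n hn.
by rewrite E h0 // => k nk; apply: hn; exists k.
Qed.

Lemma fgr_tder a u : fgr a u -> fgr a (tder u).
Proof.
case: a => a; last by move=> /fgr_neg ->; rewrite linear0; apply: fgr0.
by move=> /fgr_pos au; apply/fgr_pos/fdeg_tder.
Qed.

(** The module of order 0 acting on itself. *)
Definition fock_gva : gva (phaseZ g).
Proof.
refine (@Gva R int (phaseZ g) fock fgr (fun u n v => Ymod 0 u n v) vac1 (@tder K)
  _ _ _ _ _ _ _ _ _ _ _ _ _).
- exact: fgr_direct.
- by move=> n v; apply: Ymod_linearl.
- by move=> u n; apply: linearP.
- exact: linearP.
- exact: (fdeg_vac K).
- exact: fgr_tder.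
- move=> n v; move: v; apply: fock_ind => [|s].
    split=> [|c x y hx hy]; first by rewrite linear0; case: ifP.
    by rewrite linearP /= hx hy; case: ifP; rewrite ?scaler0 ?addr0.
  by rewrite (Ymod_fdeg _ _ _ _ (fdeg_mon K s)) fld_nil.
- by move=> u; case: (fock_vac u).
- by move=> u; case: (fock_vac u).
- exact: tder_nil.
- exact: fock_der.
- move=> a b u v au bv; have := Ymod_laurent g 0 au bv.
  by rewrite /Delta1Z mul0r oppr0 add0r.
- exact: fock_local.
Defined.

Lemma bvec_b_0 (j : nat) : Ymod 0 bvec (- g + j%:R) bvec = 0.
Proof.
rewrite (Ymod_fdeg _ _ _ _ (fdeg_b K)) add0r mulr1; apply: fld_b_b => k.
move=> /eqP; rewrite -subr_eq0.
have -> : - g + j%:R - (- g - k.+1%:R) = (j + k.+1)%:R :> K by rewrite natrD; ring.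
by rewrite pnatr_eq0 addnS.
Qed.

Lemma fgr_b : fgr 1 bvec. Proof. exact: (fdeg_b K). Qed.

Lemma etaZ_b : etaZ g 1 1 * epi (- g) = 1.
Proof. by rewrite /etaZ -epiD !mulr1 subrr epi0. Qed.

Lemma fock_b_local m x p q :
  zw_pow (- g) (fun p q => Ymod m bvec p (Ymod m bvec q x)) p q =
  wz_pow (- g) (fun p q => Ymod m bvec q (Ymod m bvec p x)) p q.
Proof.
rewrite (Ymod_local_at (a := 1) (b := 1) m fgr_b fgr_b) ?etaZ_b ?scale1r //.
  by exists 0; rewrite /DeltaZ !mulr1 subrr.
exact: bvec_b_0.
Qed.

(** The form of fock_b_ind for the total operators on the module. *)
Lemma fock_bmode_ind m (W : fock -> Prop) : lclosed W -> W vac1 ->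
  (forall x n, W x -> W (Ymod m bvec n x)) -> forall x, W x.
Proof.
move=> Wl W1 Wb; apply: (@fock_b_ind _ g m) => // s x n xs Wx.
by rewrite -(Ymod_fdeg _ _ _ _ xs); apply: Wb.
Qed.

(** Locality of b with itself at exponent -g holds because Y(b, z)b lies in z^g V[[z]],
    and generation because the t_a are recovered from the modes of b. *)
Lemma fock_gva_cat : gva_cat (V := fock_gva) bvec.
Proof.
split; first exact: fgr_b.
  apply/seteqP; split=> // x _ W [[[W0 Wl] W1 WY] Wb].
  apply: (@fock_bmode_ind 0 W (conj W0 Wl) W1 _ x) => y n Wy.
  by apply: (WY bvec n y) => //; apply: Wb.
move=> x p q; exact: (fock_b_local 0 x p q).
Qed.

Section Modules.
Variables (F : gva (phaseZ g)) (h : F -> fock_gva).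
Hypothesis hom_h : gva_hom h.
Variable m : K.

(** Through h, the polynomials carry an action of F for every order. *)
Definition fock_mod : gva_mod F (gradingZ g m).
Proof.
refine (@GvaMod R int (phaseZ g) F (gradingZ g m) fock fgr
  (fun w n x => Ymod m (h w) n x) _ _ _ _ _ _).
- exact: fgr_direct.
- by move=> n x c u v; case: hom_h => hl _ _ _; rewrite hl; apply: Ymod_linearl.
- by move=> u n; apply: linearP.
- move=> n x; case: hom_h => _ -> _ _; move: x; apply: fock_ind => [|s].
    split=> [|c x y hx hy]; first by rewrite linear0; case: ifP.
    by rewrite linearP /= hx hy; case: ifP; rewrite ?scaler0 ?addr0.
  by rewrite (Ymod_fdeg _ _ _ _ (fdeg_mon K s)) fld_nil.
- by move=> a l u x au lx; case: hom_h => _ _ _ hg; apply: Ymod_laurent => //; apply: hg.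
- move=> a b l u v x au bv lx n hn p q; case: hom_h => _ _ hY hg.
  rewrite (Ymod_borcherds m (hg _ _ au) (hg _ _ bv) lx hn).
  by apply: eq_nsum => j; rewrite hY.
Defined.

End Modules.
End ModelGva.

(** * The universal property of the polynomial modules *)

(** Given operators b(n) that are local with exponent -g on a graded space M with a
    vector vM of order -m, the map theta from polynomials to M is forced by the formula
    t(z) = z^{-mu} b(z) E^{-g}(z). *)
Section Universality.
Variables (K : numFieldType) (g m : K) (M : lmodType K).
Variables (bM : K -> M -> M) (vM : M) (G : nat -> M -> Prop).
Local Notation fock := (fock K).
Local Notation ann := (ann (- g)).
Hypotheses (bM_lin : forall n, linear (bM n))
  (G_lclosed : forall s, lclosed (G s)) (G_v : G 0 vM)
  (G_b : forall s n x, G s x -> G s.+1 (bM n x))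
  (b_supp : forall s n x, G s x -> ~ in_coset n (- (m + g * s%:R)) -> bM n x = 0)
  (b_trunc : forall s x, G s x -> trunc (bM ^~ x))
  (b_loc : forall s x, G s x -> forall p q,
     zwp (- g) (fun p q => bM p (bM q x)) p q = wzp (- g) (fun p q => bM q (bM p x)) p q)
  (b_vac : forall n, (forall k : nat, n <> - k.+1%:R) -> bM (- m + n) vM = 0).
Implicit Types (x y : fock) (p q n : K) (a c : int).

(** The coefficients of z^{-m-g r} b(z) T(E^{-g}(z) x), to become those of T(t(z) x). *)
Definition theta_coef (T : fock -> M) (r : nat) (a : int) x : M :=
  nsum (fun k => bM (-1 - a%:~R - m - g * r%:R - k%:R) (T (ann k x))).

(** On a monomial the smallest variable is split off, so that theta_deg is well
    defined; that any other variable could have been used is theta_claim. *)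
Fixpoint theta_deg (r : nat) : fock -> M :=
  if r is r'.+1 then linext (fun s => if s is a :: s' then
     theta_coef (theta_deg r') r' a (mon K s') else 0)
  else linext (fun s => if s is [::] then vM else 0).

Fact theta_deg_is_linear r : linear (theta_deg r).
Proof. by case: r => [|r]; apply: linearP. Qed.
HB.instance Definition _ r :=
  GRing.isLinear.Build K fock M _ (theta_deg r) (theta_deg_is_linear r).

Local Notation C r := (theta_coef (theta_deg r) r).

Lemma bT_linear n r : linear (fun x => bM n (theta_deg r x)).
Proof. by move=> c x y; rewrite linearP bM_lin. Qed.

Lemma theta_coef_evz r a x :
  evz (fun k : nat => bM (-1 - a%:~R - m - g * r%:R - k%:R) (theta_deg r (ann k x))).
Proof.
have [N h] := annle_ex x; exists N => k Nk.
by rewrite h ?linear0 ?(linear_0 (bM_lin _)).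
Qed.

Lemma theta_coef_linear r a : linear (C r a).
Proof.
by apply: (@nsum_ann_linear _ _ _ (fun k y => bM _ (theta_deg r y))) => k; apply: bT_linear.
Qed.

Lemma G_theta r x : fdeg r x -> G r (theta_deg r x).
Proof.
have lin r' : lclosed (fun x => G r' (theta_deg r' x)).
  split=> [|c y z hy hz]; first by rewrite linear0; case: (G_lclosed r').
  by rewrite linearP; apply: (G_lclosed r').2.
elim: r x => [|r IH]; apply: fdeg_ind => // s sr.
  by rewrite (size0nil sr) /= linext_sorted.
have -> : mon K s = mon K (sort leq s) by apply: mon_perm; rewrite perm_sym perm_sort.
move: sr; rewrite -(size_sort leq).
have: sorted leq (sort leq s) by apply/sort_sorted/leq_total.
case: (sort leq s) => [//|a t] st [tr].
rewrite [theta_deg _]/= linext_sorted //; apply: lclosed_nsum => [//||k].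
  exact: theta_coef_evz.
by apply/G_b/IH/fdeg_ann; rewrite -tr; apply: fdeg_mon.
Qed.

(** The series theta_coef must have no negative powers of z, and the coefficients must
    be the values at t_a x for every a, not only for a smaller than all variables of x. *)
Definition theta_claim r := forall a x, fdeg r x ->
  C r a x = if 0 <= a then theta_deg r.+1 (cre (absz a) x) else 0.

(** The coefficients of (z w)^{-m-g r} (z - w)^{-g} b(z) b(w) theta(E^{-g}(z) E^{-g}(w) y),
    in which locality makes the two variables interchangeable. *)
Definition theta_swap r a c y : M := nsum (fun k : nat => nsum (fun k' : nat =>
  zwp (- g) (fun p q => bM p (bM q (theta_deg r (ann k' (ann k y)))))
    (-1 - a%:~R - m - g * r%:R - k%:R) (-1 - c%:~R - m - g * r%:R - k'%:R))).

Lemma theta_swapC r a c y : fdeg r y -> theta_swap r a c y = theta_swap r c a y.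
Proof.
move=> yr; have [N h] := annle_ex y.
rewrite /theta_swap (@nsum_exchange _ N) => [|i j /orP[Ni|Nj]]; first last.
- rewrite (annle_ann _ _ h) // linear0 /zwp nsum0 // => k.
  by rewrite !(linear_0 (bM_lin _)) scaler0.
- rewrite h // !linear0 /zwp nsum0 // => k.
  by rewrite !(linear_0 (bM_lin _)) scaler0.
apply: eq_nsum => k; apply: eq_nsum => k'; rewrite annC.
by rewrite (b_loc (G_theta (fdeg_ann _ _ (fdeg_ann _ _ yr)))).
Qed.

Lemma theta_swapE r a c y : fdeg r y -> theta_swap r a c y =
  nsum (fun k : nat => nsum (fun i : nat => sbin (- g) i *:
    bM (-1 - a%:~R - m - g * r.+1%:R - k%:R - i%:R) (C r (c - i%:Z) (ann k y)))).
Proof.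
move=> yr; apply: eq_nsum => k; have [N h] := annle_ex (ann k y).
set p := -1 - a%:~R - m - g * r%:R - k%:R.
set Q := -1 - c%:~R - m - g * r%:R.
pose w k' := theta_deg r (ann k' (ann k y)).
have wG k' : G r (w k') by apply: G_theta; do 2 apply: fdeg_ann.
have [T hT] := @fin_bound _ (fun (k' : 'I_N) t => bM (Q - k'%:R + t%:R) (w k') = 0)
   (fun k' => b_trunc (wG k') _).
have w0 k' (i : nat) : (N + T <= k')%N || (N + T <= i)%N -> bM (Q - k'%:R + i%:R) (w k') = 0.
  have [kN|Nk] := ltnP k' N; last by rewrite /w h // linear0 (linear_0 (bM_lin _)).
  by move=> h'; rewrite (hT (Ordinal kN)) //; lia.
rewrite (@nsum_exchange _ (N + T)) => [|k' i hi]; last first.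
  by rewrite w0 // (linear_0 (bM_lin _)) scaler0.
apply: eq_nsum => i; rewrite nsumZ; last first.
  by exists (N + T)%N => k' hk; rewrite w0 ?hk // (linear_0 (bM_lin _)).
congr (_ *: _); rewrite /theta_coef (linear_nsum (bM_lin _)); last exact: theta_coef_evz.
apply: eq_nsum => k'; congr (bM _ (bM _ _)).
  by rewrite /p -[r.+1]addn1 (natrD _ r 1); ring.
by rewrite /Q intrB -pmulrn; ring.
Qed.

(** Moving E^{-g}(z) past t_c produces the factor (1 - w/z)^{-g} of theta_swap. *)
Lemma theta_coef_cre r a (c : nat) y : theta_claim r -> fdeg r y ->
  C r.+1 a (cre c y) = theta_swap r a c y.
Proof.
move=> IH yr; rewrite theta_swapE // {1}/theta_coef.
rewrite (@nsum_ann_cre _ _ _ c y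
  (fun k z => bM (-1 - a%:~R - m - g * r.+1%:R - k%:R) (theta_deg r.+1 z))); last first.
  by move=> k; apply: bT_linear.
have [N h] := annle_ex y.
have Cneg (i : nat) k : (c < i)%N -> C r (c%:Z - i%:Z) (ann k y) = 0.
  move=> ci; rewrite IH; last exact: fdeg_ann.
  by have -> : (0 <= c%:Z - i%:Z) = false by lia.
have C0 a' : C r a' 0 = 0 by rewrite (linear_0 (@theta_coef_linear r a')).
rewrite [RHS](@nsum_exchange _ (N + c.+1)) => [|k i h']; last first.
  have [ci|ic] := ltnP c i; first by rewrite Cneg // (linear_0 (bM_lin _)) scaler0.
  by rewrite h ?C0 ?(linear_0 (bM_lin _)) ?scaler0 //; lia.
rewrite [RHS](@nsumE _ c.+1) => [|i ci]; last first.
  by apply: nsum0 => k; rewrite Cneg // (linear_0 (bM_lin _)) scaler0.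
apply: eq_bigr => i _; rewrite nsumZ; last first.
  by exists N => k Nk; rewrite h // C0 (linear_0 (bM_lin _)).
congr (_ *: _); apply: eq_nsum => k; rewrite IH; last exact: fdeg_ann.
have ic : (i <= c)%N by rewrite -ltnS.
have -> : (0 <= c%:Z - i%:Z) by lia.
have -> : absz (c%:Z - i%:Z) = (c - i)%N by lia.
by rewrite (natrD _ k i); congr (bM _ _); ring.
Qed.

Lemma theta_claim0 : theta_claim 0.
Proof.
move=> a; apply: fdeg_ind => [|s /size0nil ->].
  split=> [|c x y hx hy].
    by rewrite (linear_0 (@theta_coef_linear 0 a)) !linear0; case: ifP.
  rewrite (@theta_coef_linear 0 a) hx hy linearP linearP.
  by case: ifP => _ //; rewrite scaler0 addr0.
have -> : C 0 a (mon K [::]) = bM (-1 - a%:~R - m) vM.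
  rewrite /theta_coef (@nsum1 _ 0%N) => [|[//|k] _]; last first.
    by rewrite ann_nil linear0 (linear_0 (bM_lin _)).
  by rewrite ann_nil mulr0 !subr0 /= linext_sorted.
case: ifP => h.
  rewrite cre_mon [theta_deg _]/= linext_sorted //.
  rewrite /theta_coef (@nsum1 _ 0%N) => [|[//|k] _]; last first.
    by rewrite ann_nil linear0 (linear_0 (bM_lin _)).
  rewrite ann_nil mulr0 !subr0 /= linext_sorted // gez0_abs //.
have -> : -1 - a%:~R - m = - m + (-1 - a%:~R) by ring.
apply: b_vac => k /eqP; rewrite -subr_eq0 opprK.
have -> : -1 - a%:~R + k.+1%:R = (k%:Z - a)%:~R :> K.
  by rewrite intrB -pmulrn -[k.+1]addn1 (natrD _ k 1); ring.
by rewrite intr_eq0; lia.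
Qed.

(** Induction on the degree.  Negative coefficients: on t_c y swap the two variables,
    and use the vanishing in the smaller degree.  Nonnegative ones: nothing to prove if
    t_a is the smallest variable of t_a x, and otherwise swap t_a with the smallest. *)
Lemma theta_claim_all r : theta_claim r.
Proof.
elim: r => [|r IH]; first exact: theta_claim0.
have neg a x : a < 0 -> fdeg r.+1 x -> C r.+1 a x = 0.
  move=> a0; move: x; apply: fdeg_ind => [|[//|c s] [sr]].
    split=> [|c x y hx hy]; rewrite ?(linear_0 (@theta_coef_linear r.+1 a)) //.
    by rewrite (@theta_coef_linear r.+1 a) hx hy scaler0 addr0.
  have yr : fdeg r (mon K s) by rewrite -sr; apply: fdeg_mon.
  rewrite -cre_mon theta_coef_cre // theta_swapC // theta_swapE //.
  apply: nsum0 => k; apply: nsum0 => i; rewrite IH; last exact: fdeg_ann.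
  have -> : (0 <= a - i%:Z) = false by lia.
  by rewrite (linear_0 (bM_lin _)) scaler0.
move=> a x xr; case: ifP => h; last by apply: neg => //; lia.
have [a' ->] : exists a' : nat, a = a' by exists (absz a); rewrite gez0_abs.
rewrite absz_nat; move: x xr; apply: fdeg_ind => [|s sr].
  split=> [|c x y hx hy].
    by rewrite (linear_0 (@theta_coef_linear r.+1 a')) !linear0.
  by rewrite (@theta_coef_linear r.+1 a') hx hy linearP linearP.
have -> : mon K s = mon K (sort leq s) by apply: mon_perm; rewrite perm_sym perm_sort.
move: sr; rewrite -(size_sort leq).
have: sorted leq (sort leq s) by apply/sort_sorted/leq_total.
case: (sort leq s) => [//|c t] st [tr].
have def b t' : sorted leq (b :: t') ->
    theta_deg r.+2 (mon K (b :: t')) = C r.+1 b (mon K t').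
  by move=> st'; rewrite [theta_deg _]/= linext_sorted.
(* If a' <= c then t_a' is split off first by definition. *)
have [ac|ca] := leqP a' c; first by rewrite cre_mon def //= ac.
have tf : fdeg r (mon K t) by rewrite -tr; apply: fdeg_mon.
rewrite -cre_mon (theta_coef_cre _ _ IH tf) // theta_swapC //.
rewrite -(theta_coef_cre _ _ IH tf) !cre_mon.
(* Otherwise t_c is the one split off. *)
have e1 : mon K [:: a', c & t] = mon K (c :: sort leq (a' :: t)).
  apply: mon_perm; apply: (@perm_trans _ [:: c, a' & t]).
    by rewrite -(cat1s a') -(cat1s c) perm_catCA.
  by rewrite perm_cons perm_sym perm_sort.
rewrite e1 def; last first.
  rewrite /= path_sortedE; last exact: leq_trans.
  rewrite sort_sorted ?andbT; last exact: leq_total.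
  rewrite all_sort /= (ltnW ca) /=.
  by move: st; rewrite /= path_sortedE; [case/andP|exact: leq_trans].
by congr (C _ _ _); apply: mon_perm; rewrite perm_sym perm_sort.
Qed.

Definition theta (x : fock) : M := linext (fun s => theta_deg (size s) (mon K s)) x.
HB.instance Definition _ := GRing.isLinear.Build K fock M _ theta (flinext_linear _).

Lemma theta_fdeg r x : fdeg r x -> theta x = theta_deg r x.
Proof.
move: x; apply: fdeg_ind => [|s <-].
  by split=> [|c x y hx hy]; rewrite ?linear0 // !linearP /= hx hy.
by rewrite /theta linext_mon // => s1 s2 h; rewrite (perm_size h) (mon_perm _ h).
Qed.

Lemma theta_vac : theta (vac1 K) = vM.
Proof. by rewrite (theta_fdeg (fdeg_vac K)) /= linext_sorted. Qed.

Lemma G_theta_fdeg r x : fdeg r x -> G r (theta x).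
Proof. by move=> xr; rewrite (theta_fdeg xr); apply: G_theta. Qed.

(** Expand b(z) = z^mu t(z) E(z), replace theta(t(z) y) by z^{-mu} b(z) theta(E^{-g}(z) y),
    and cancel E^{-g}(z) E(z). *)
Lemma theta_b r n x : fdeg r x -> theta (fld g (m + g * r%:R) (bvec K) n x) = bM n (theta x).
Proof.
move=> xr; set mu := m + g * r%:R.
have [[j nj]|hn] := pselect (in_coset n (- mu)); last first.
  rewrite (b_supp (G_theta_fdeg xr) hn) (@fld_support _ g mu 1 (bvec K)) ?linear0 //.
    exact: fdeg_b.
  by move=> j hj; apply: hn; exists j; rewrite hj mulr1.
rewrite (theta_fdeg xr) (@theta_fdeg r.+1); last by rewrite -add1n; apply: fdeg_fld; [exact: fdeg_b|].
rewrite fld_b.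
have E (k : nat) : nsum (fun l => cre l (if n + mu + l%:R - k%:R == -1 then fock_ann g k x else 0)) =
   if (0 <= k%:Z - 1 - j)%R then cre (absz (k%:Z - 1 - j)%R) (fock_ann g k x) else 0.
  have e (l : nat) : (n + mu + l%:R - k%:R == -1) = (k%:Z - 1 - j == l%:Z)%R.
    have -> : n + mu + l%:R - k%:R = (j + l%:Z - k%:Z)%:~R by rewrite !intrD rmorphN /= -!pmulrn nj; ring.
    by rewrite -[-1]/((-1)%:~R) eqr_int; lia.
  case: ifP => h.
    rewrite (@nsum1 _ (absz (k%:Z - 1 - j)%R)) => [|l hl]; rewrite e.
      by rewrite gez0_abs ?eqxx.
    case: eqP => [hz|_]; last by rewrite linear0.
    by rewrite hz eqxx in hl.
  apply: nsum0 => l; rewrite e; case: eqP => [hz|_]; last by rewrite linear0.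
  by rewrite hz in h.
rewrite (eq_nsum E); pose Phi (k : nat) y := bM (n - k%:R) (theta_deg r y).
have Pl k : linear (Phi k) by apply: bT_linear.
have [N hN] := annle_ex x.
rewrite linear_nsum; first last.
- exists N => k Nk; case: ifP => _ //; by rewrite hN // linear0.
- exact: theta_deg_is_linear.
transitivity (nsum (fun k : nat => C r (k%:Z - 1 - j) (fock_ann g k x))).
  apply: eq_nsum => k; rewrite theta_claim_all; last exact: fdeg_ann.
  by case: ifP => _; rewrite ?linear0.
have -> : bM n (theta_deg r x) = Phi 0%N x by rewrite /Phi subr0.
rewrite -(@nsum_ann_inv _ _ (- g) x Phi) // opprK.
rewrite (@nsum_exchange _ N) => [|i k /orP[h|h]]; first last.
- by rewrite hN // linear0 (linear_0 (Pl _)).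
- by rewrite (annle_ann _ _ hN) // (linear_0 (Pl _)).
apply: eq_nsum => k; apply: eq_nsum => i; congr (bM _ _).
by rewrite nj /mu (natrD _ i k) !intrB -pmulrn; ring.
Qed.

Theorem fock_universal : exists T : fock -> M, [/\ linear T, T (vac1 K) = vM,
  forall r x, fdeg r x -> G r (T x) & forall n x, T (Ymod g m (bvec K) n x) = bM n (T x)].
Proof.
exists theta; split; [exact: linearP|exact: theta_vac|exact: G_theta_fdeg|].
move=> n x; move: x; apply: fock_ind => [|s].
  split=> [|c x y hx hy]; first by rewrite !linear0 (linear_0 (bM_lin n)).
  by rewrite (linearP (Ymod g m _ n)) !(linearP theta) bM_lin /= hx hy.
by rewrite (Ymod_fdeg _ _ _ _ (fdeg_mon K s)) (theta_b _ (fdeg_mon K s)).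
Qed.

End Universality.

(** * The free algebra *)

Section Transport.
Variable K : numFieldType.

(** (z - w)^n has an inverse on distributions truncated in w: descend on the
    exponent of w. *)
Lemma zwp_eq0 (U : lmodType K) n (A : K -> K -> U) : truncr A ->
  (forall p q, zwp n A p q = 0) -> forall p q, A p q = 0.
Proof.
move=> tA A0 p q; have [N hN] := tA q.
suff H k i : (N <= i + k)%N -> forall p, A p (q + i%:R) = 0.
  by have := H N 0%N (leq_addl _ _) p; rewrite addr0.
elim: k i => [|k IH] i h p'; first by apply: hN; rewrite addn0 in h.
have := A0 (p' - n) (q + i%:R); rewrite /zwp (@nsum1 _ 0%N).
  by rewrite sbin0 scale1r subrK subr0 addr0.
move=> [//|j] _; have -> : q + i%:R + j.+1%:R = q + (i + j.+1)%:R by rewrite natrD addrA.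
by rewrite IH ?scaler0 //; lia.
Qed.

Lemma zwp_linear (U W : lmodType K) (L : U -> W) n (A : K -> K -> U) p q :
  linear L -> truncr A -> L (zwp n A p q) = zwp n (fun p q => L (A p q)) p q.
Proof.
move=> Ll tA; rewrite /zwp (linear_nsum Ll (zwp_evz _ _ _ tA)).
by apply: eq_nsum => i; rewrite (linear_Z Ll).
Qed.

Lemma wzp_linear (U W : lmodType K) (L : U -> W) n (A : K -> K -> U) p q :
  linear L -> truncl A -> L (wzp n A p q) = wzp n (fun p q => L (A p q)) p q.
Proof.
move=> Ll tA; rewrite /wzp (linear_nsum Ll (wzp_evz _ _ _ tA)).
by apply: eq_nsum => i; rewrite (linear_Z Ll).
Qed.

Lemma zwpB (U : lmodType K) n (A B : K -> K -> U) p q : truncr A -> truncr B ->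
  zwp n (fun p q => A p q - B p q) p q = zwp n A p q - zwp n B p q.
Proof.
move=> tA tB; rewrite -scaleN1r addrC /zwp -nsumP; [|exact: zwp_evz..].
by apply: eq_nsum => i; rewrite scalerBr scalerA mulN1r scaleNr addrC.
Qed.

End Transport.

(** The map T extends b |-> b from the polynomial algebra to F, and f goes back. *)
Section FreeGva.
Local Open Scope classical_set_scope.
Local Open Scope ring_scope.
Variable R : realType.
Local Notation K := R[i].
Variable g : K.
Local Notation fock := (fock K).
Local Notation Ymod := (Ymod g).
Local Notation fgr := (@fgr R).
Local Notation vac1 := (vac1 K).
Local Notation bvec := (bvec K).
Implicit Types (x y : fock) (m n p q : K).

Lemma eqmodZ_coset n (c : K) : eqmodZ n c <-> in_coset n c.
Proof. by split=> -[k hk]; exists k; [rewrite -hk subrK|rewrite hk addrK]. Qed.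

Lemma laurent_trunc (U : lmodType K) (W : set U) c f : in_laurent W c f -> trunc f.
Proof.
case=> _ h0 [N hN] n; have [[k hk]|hn] := pselect (eqmodZ n c); last first.
  exists 0%N => i _; apply: h0 => -[k hk]; apply: hn; exists (k - i%:Z).
  by rewrite intrB -hk -pmulrn; ring.
exists (absz (N - k)%R) => i hi; have -> : n + i%:R = c + (k + i%:Z)%:~R.
  by rewrite intrD -hk -pmulrn; ring.
by apply: hN; lia.
Qed.

Variables (F : gva (phaseZ g)) (b : F).
Hypothesis b_cat : gva_cat b.
Variable f : F -> fock_gva g.
Hypotheses (f_hom : gva_hom f) (f_b : f b = bvec).

Let fl : linear f. Proof. by case: f_hom. Qed.
Let fv : f (vac F) = vac1. Proof. by case: f_hom. Qed.
Let fY u n w : f (gva_Y u n w) = Ymod 0 (f u) n (f w). Proof. by case: f_hom. Qed.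
Lemma gva_theta : exists T : fock -> F, [/\ linear T, T vac1 = vac F,
  forall r x, fdeg r x -> gva_gr (Posz r) (T x) &
  forall n x, T (Ymod 0 bvec n x) = gva_Y b n (T x)].
Proof.
have [bg bgen bloc] := b_cat.
apply: (@fock_universal _ g 0 F (gva_Y b) (vac F) (fun s => gva_gr (Posz s))).
- exact: gva_linr.
- by move=> s; case: (@gva_direct _ _ _ F) => h _ _; case: (h (Posz s)).
- exact: vac_gr.
- by move=> s n x xs; have [h _ _] := gva_laurent bg xs; rewrite -add1n PoszD.
- move=> s n x xs hn; have [_ h _] := gva_laurent bg xs; apply: h => /eqmodZ_coset hc.
  by apply: hn; move: hc; rewrite /= /DeltaZ mulr1 add0r -pmulrn.
- by move=> s x xs; apply: laurent_trunc (gva_laurent bg xs).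
- by move=> s x xs p q; apply: bloc.
- by move=> n hn; rewrite oppr0 add0r; apply: gva_vacr0 => -[k hk]; apply: (hn k).
Qed.

Variable T : fock -> F.
Hypotheses (Tl : linear T) (Tv : T vac1 = vac F)
  (Tg : forall r x, fdeg r x -> gva_gr (Posz r) (T x))
  (Tb : forall n x, T (Ymod 0 bvec n x) = gva_Y b n (T x)).

Lemma gva_thetaK x : f (T x) = x.
Proof.
move: x; apply: (@fock_bmode_ind _ g 0) => [||x n IH].
- by split=> [|c x y hx hy]; rewrite ?(linear_0 Tl) ?(linear_0 fl) // Tl fl hx hy.
- by rewrite Tv fv.
- by rewrite Tb fY f_b IH.
Qed.

Lemma gva_theta_der x : T (tder x) = der (T x).
Proof.
move: x; apply: (@fock_bmode_ind _ g 0) => [||x n IH].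
- split=> [|c x y hx hy]; first by rewrite linear0 !(linear_0 Tl) (linear_0 (@der_lin _ _ _ F)).
  by rewrite linearP !Tl (@der_lin _ _ _ F) hx hy.
- by rewrite tder_nil Tv (linear_0 Tl) der_vac.
have -> : tder (Ymod 0 bvec n x) = Ymod 0 bvec n (tder x) + (- n *: Ymod 0 bvec (n - 1) x).
  by rewrite -fock_der addrC subrK.
rewrite (linear_D Tl) (linear_Z Tl) !Tb IH -der_Y addrC subrK //.
Qed.

(** By the translation axiom, Y(w, z)1 is e^{z d} w, and T commutes with the
    derivations. *)
Lemma gva_theta_vac y n : gva_Y (T y) n (vac F) = T (Ymod 0 y n vac1).
Proof.
have [y0 y1] := fock_vac g y.
have [[k ->]|hn] := pselect (negZ n); last by rewrite gva_vacr0 // y0 // (linear_0 Tl).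
elim: k => [|k IH]; first by rewrite gva_vacr y1.
have e : - k.+1%:R - 1 = - k.+2%:R :> K by rewrite -[k.+2]addn1 natrD opprD.
have k0 : k.+1%:R != 0 :> K by rewrite pnatr_eq0.
have h1 := @der_Y _ _ _ F (T y) (- k.+1%:R) (vac F).
have h2 := fock_der g y (- k.+1%:R) vac1.
rewrite der_vac (linear_0 (gva_linr _ _)) subr0 IH -gva_theta_der opprK e in h1.
rewrite tder_nil linear0 subr0 opprK e in h2.
rewrite h2 (linear_Z Tl) in h1.
by have := congr1 (fun z => k.+1%:R^-1 *: z) h1; rewrite !scalerA mulVf // !scale1r.
Qed.

(** Uniqueness in the style of Goddard: for fixed y, the identity holds on the vacuum,
    and passes from x to b(q)x because Y(T y, z) is local with b.  Applying T f to that
    locality shows that the right-hand side is local with b at the same exponent, so the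
    difference of the two sides is killed by a power of z - w. *)
Lemma gva_theta_hom y n x : gva_Y (T y) n (T x) = T (Ymod 0 y n x).
Proof.
have [bg _ _] := b_cat.
move: y n x; suff H t y : fdeg t y -> forall x n, gva_Y (T y) n (T x) = T (Ymod 0 y n x).
  move=> y n x; move: y; apply: fock_ind => [|s]; last exact: H (fdeg_mon K s) _ _.
  split=> [|c y z hy hz].
    by rewrite Ymod0l (linear_0 Tl) (linear_0 (gva_linl _ _)).
  by rewrite (@Ymod_linearl _ g) !Tl gva_linl hy hz.
move=> yt; apply: (@fock_bmode_ind _ g 0) => [||x k IH n].
- split=> [n|c x z hx hz n].
    by rewrite (linear_0 Tl) linear0 (linear_0 Tl) (linear_0 (gva_linr _ _)).
  by rewrite linearP !Tl gva_linr hx hz.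
- by move=> n; rewrite Tv gva_theta_vac.
pose A p q := gva_Y (T y) p (gva_Y b q (T x)).
pose B p q := T (Ymod 0 y p (Ymod 0 bvec q x)).
have tB : truncr B.
  move=> q; have [N h] := Ymod_Ymod_truncr g 0 y bvec x q.
  by exists N => i p Ni; rewrite /B h // (linear_0 Tl).
have tA : truncr A.
  move=> q; have [N h] := Ymod_trunc g 0 bvec x q.
  by exists N => i p Ni; rewrite /A -Tb h // (linear_0 Tl) (linear_0 (gva_linr _ _)).
rewrite Tb; apply/eqP; rewrite -subr_eq0; apply/eqP.
have [N _ loc] := gva_local (Tg yt) bg.
apply: (@zwp_eq0 _ _ N (fun p q => A p q - B p q)) => [q|p q].
  have [N1 h1] := tA q; have [N2 h2] := tB q; exists (N1 + N2)%N => i p h.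
  by rewrite h1 ?h2 ?subr0 //; lia.
rewrite zwpB //; apply/eqP; rewrite subr_eq0; apply/eqP.
pose A' p q := gva_Y b q (gva_Y (T y) p (T x)).
pose B' p q := Ymod 0 bvec q (Ymod 0 y p x).
have A'E p' q' : A' p' q' = T (B' p' q') by rewrite /A' IH -Tb.
have tB' : truncl B' by apply: Ymod_Ymod_truncl.
have tA' : truncl A'.
  by move=> p'; have [M h] := tB' p'; exists M => i q' Mi; rewrite A'E h // (linear_0 Tl).
have {}loc : zwp N A p q = (etaZ g t 1 * epi N) *: wzp N A' p q by apply: loc.
(* The same locality for the polynomial fields, by applying f; then T brings it back. *)
have fA : f (zwp N A p q) = zwp N (fun p q => Ymod 0 y p (Ymod 0 bvec q x)) p q.
  rewrite zwp_linear //; apply: eq_nsum => i.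
  by rewrite /A !fY f_b !gva_thetaK.
have fA' : f (wzp N A' p q) = wzp N B' p q.
  by rewrite wzp_linear //; apply: eq_nsum => i; rewrite A'E gva_thetaK.
have := congr1 f loc; rewrite fA (linear_Z fl) fA' => /(congr1 T).
rewrite (linear_Z Tl) (zwp_linear _ _ _ Tl) ?(wzp_linear _ _ _ Tl) //; last exact: Ymod_Ymod_truncr.
rewrite -[zwp N (fun p q => T _) p q]/(zwp N B p q) => ->; rewrite loc; congr (_ *: _).
by apply: eq_nsum => i; rewrite A'E.
Qed.

Lemma gva_theta_b : T bvec = b.
Proof.
have [_ <-] := fock_vac g bvec.
by rewrite Tb Tv gva_vacr.
Qed.

(** The range of T is closed under all products and contains b, which generates F. *)
Lemma gva_fK w : T (f w) = w.
Proof.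
have [_ bgen _] := b_cat.
suff : [set x | exists y, x = T y] w by case=> y ->; rewrite gva_thetaK.
have : [set: F] w by [].
rewrite -bgen; apply; split; last by move=> _ ->; exists bvec; rewrite gva_theta_b.
split=> [||_ n _ [y ->] [x ->]].
- split=> [|c _ _ [y ->] [z ->]]; first by exists 0; rewrite (linear_0 Tl).
  by exists (c *: y + z); rewrite Tl.
- by exists vac1; rewrite Tv.
- by exists (Ymod 0 y n x); rewrite gva_theta_hom.
Qed.

End FreeGva.

(** * The free modules *)

Section FreeModule.
Local Open Scope classical_set_scope.
Local Open Scope ring_scope.
Variable R : realType.
Local Notation K := R[i].
Variable g : K.
Local Notation fock := (fock K).
Local Notation Ymod := (Ymod g).
Local Notation fgr := (@fgr R).
Local Notation vac1 := (vac1 K).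
Local Notation bvec := (bvec K).
Implicit Types (x y : fock) (m n p q : K).

Lemma free_gva_model (F : gva (phaseZ g)) (b : F) : free_gva b ->
  exists (f : F -> fock_gva g) (T : fock_gva g -> F),
    [/\ gva_hom f, gva_hom T, T bvec = b, cancel f T & cancel T f].
Proof.
move=> [b_cat /(_ _ _ (fock_gva_cat g))] [f [[f_hom f_b] _]].
have [T [Tl Tv Tg Tb]] := gva_theta b_cat.
exists f, T; split=> //.
- split=> // [u n w|[a|a] u]; first exact/esym/(gva_theta_hom b_cat f_hom f_b).
  + exact: Tg.
  + move=> /fgr_neg ->; rewrite (linear_0 Tl).
    by case: (@gva_direct _ _ _ F) => h _ _; case: (h (Negz a)).
- exact: gva_theta_b Tv Tb.
- by move=> w; apply: (gva_fK b_cat f_hom f_b).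
- by move=> x; apply: (gva_thetaK f_hom f_b).
Qed.

Variables (F : gva (phaseZ g)) (b : F).
Variables (f : F -> fock_gva g) (T : fock_gva g -> F).
Hypotheses (f_hom : gva_hom f) (T_hom : gva_hom T) (T_b : T bvec = b).
Hypotheses (fK : cancel f T) (Tf : cancel T f).

Let f_b : f b = bvec. Proof. by rewrite -T_b Tf. Qed.
Let b_gr : gva_gr (1 : int) b.
Proof. by case: T_hom => _ _ _ h; rewrite -T_b; apply: h; apply: fgr_b. Qed.
Let Tl : linear T. Proof. by case: T_hom. Qed.
Let Tv : T vac1 = vac F. Proof. by case: T_hom. Qed.
Let TY u n w : T (Ymod 0 u n w) = gva_Y (T u) n (T w). Proof. by case: T_hom => _ _ h _; apply: h. Qed.
Let Tg r u : fdeg r u -> gva_gr (Posz r) (T u). Proof. by case: T_hom => _ _ _ h hu; apply: h. Qed.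

Lemma b_b_0 (j : nat) : gva_Y b (- g + j%:R) b = 0.
Proof. by rewrite -T_b -TY bvec_b_0 (linear_0 Tl). Qed.

Variable m : K.

Section Theta.
Variables (M : gva_mod F (gradingZ g m)) (v : M).

(** The Borcherds identity at exponent -g, where b(-g+j)b = 0. *)
Lemma mod_b_local s (x : M) : @mod_gr _ _ _ _ _ M s x -> forall p q,
  zwp (- g) (fun p q => mod_Y b p (mod_Y b q x)) p q =
  wzp (- g) (fun p q => mod_Y b q (mod_Y b p x)) p q.
Proof.
move=> xs p q.
have nD : eqmodZ (- g) (DeltaZ g 1 1) by exists 0; rewrite /DeltaZ !mulr1 subrr.
have := mod_borcherds b_gr b_gr xs nD p q.
rewrite /= etaZ_b scale1r [X in _ = X](_ : _ = 0) => [/eqP|].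
  by rewrite subr_eq0 => /eqP.
apply: (@nsum0 M) => j; rewrite /delta_mul b_b_0 (linear_0 (mod_linl _ _)) scaler0.
by case: ifP.
Qed.

Lemma mod_theta : mod_of_order b v -> exists Th : fock -> M, [/\ linear Th, Th vac1 = v,
  forall r x, fdeg r x -> @mod_gr _ _ _ _ _ M (Posz r) (Th x) &
  forall n x, Th (Ymod m bvec n x) = mod_Y b n (Th x)].
Proof.
move=> [v0 _ vn].
apply: (@fock_universal _ g m M (mod_Y b) v (fun s => @mod_gr _ _ _ _ _ M (Posz s))) => //.
- exact: mod_linr.
- by move=> s; case: (@mod_direct _ _ _ _ _ M) => h _ _; case: (h (Posz s)).
- by move=> s n x xs; have [h _ _] := mod_laurent b_gr xs; apply: h.
- move=> s n x xs hn; have [_ h _] := mod_laurent b_gr xs; apply: h => /eqmodZ_coset hc.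
  by apply: hn; move: hc; rewrite /= /Delta1Z !mulr1 -pmulrn -opprD.
- by move=> s x xs; apply: laurent_trunc (mod_laurent b_gr xs).
- by move=> s x xs p q; apply: mod_b_local xs _ _.
- by move=> n hn; apply: vn => -[k hk]; apply: (hn k).
Qed.

Variable Th : fock -> M.
Hypotheses (Thl : linear Th) (Thv : Th vac1 = v)
  (Thg : forall r x, fdeg r x -> @mod_gr _ _ _ _ _ M (Posz r) (Th x))
  (Thb : forall n x, Th (Ymod m bvec n x) = mod_Y b n (Th x)).

(** At exponent n the delta functions involve E at n, n + 1, ..., and the term in E n
    can be read off; descend from the exponents at which E vanishes. *)
Lemma delta_triangular (U : lmodType K) (E : K -> K -> U) (d D : K) :
  (exists J : nat, forall j : nat, (J <= j)%N -> forall k, E (D + j%:R) k = 0) ->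
  (forall n, eqmodZ n D -> forall p q,
     nsum (fun j => delta_mul d j (E (n + j%:R)) p q) = 0) ->
  forall n, eqmodZ n D -> forall k, E n k = 0.
Proof.
move=> [J hJ] hE.
suff H (k : nat) (n : int) : J%:Z <= n + k%:Z -> forall l, E (D + n%:~R) l = 0.
  move=> n [a ha] l; have -> : n = D + a%:~R by rewrite -ha addrC subrK.
  by apply: (H (absz (J%:Z - a)%R)); lia.
elim: k n => [|k IH] n h l.
  have -> : n = (absz n)%:Z by lia.
  by rewrite -pmulrn; apply: hJ; lia.
have hn : eqmodZ (D + n%:~R) D by exists n; rewrite addrC addKr.
(* At p = d the term j = 0 has coefficient 1 and involves E at exactly this exponent. *)
have := hE _ hn d (l - d); rewrite (@nsum1 _ 0%N) => [|[//|j] _].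
  rewrite /delta_mul (asboolT (eqmodZ_refl (erefl d))) /gbin big_ord0 divr1 scale1r.
  by rewrite !addr0 subr0 [d + _]addrC subrK.
rewrite /delta_mul; case: ifP => // _.
have -> : D + n%:~R + j.+1%:R = D + (n + j.+1%:Z)%:~R by rewrite intrD -[j.+1%:Z%:~R]pmulrn addrA.
by rewrite IH ?scaler0 //; lia.
Qed.

(** Theta commutes with the modes of b; the Borcherds identity for b and u then
    gives the modes of all b(k)u from those of b and u. *)
Lemma mod_theta_Y y n x : mod_Y (T y) n (Th x) = Th (Ymod m y n x).
Proof.
move: y n x; apply: (@fock_b_ind _ g 0) => [||t u k ut IH].
- split=> [n x|c y z hy hz n x].
    by rewrite Ymod0l (linear_0 Tl) (linear_0 (mod_linl _ _)) (linear_0 Thl).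
  by rewrite (@Ymod_linearl _ g) Tl Thl mod_linl hy hz.
- move=> n x; rewrite Tv mod_vac; move: x; apply: fock_ind => [|s].
    split=> [|c x y hx hy]; first by rewrite linear0 !(linear_0 Thl); case: ifP.
    rewrite linearP !Thl -hx -hy; by case: ifP => _ //; rewrite scaler0 addr0.
  by rewrite (Ymod_fdeg _ _ _ _ (fdeg_mon K s)) fld_nil; case: ifP => _; rewrite ?(linear_0 Thl).
rewrite -(Ymod_fdeg _ _ _ _ ut) => n x.
move: x; apply: fock_ind => [|s].
  split=> [|c x y hx hy]; first by rewrite linear0 !(linear_0 Thl) (linear_0 (mod_linr _ _)).
  by rewrite linearP !Thl mod_linr hx hy.
have sx := fdeg_mon K s; move: (mon K s) sx => x sx.
have utg : fgr (Posz t) u by exact: ut.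
have sxg : fgr (Posz (size s)) x by exact: sx.
have [hk|hk] := pselect (eqmodZ k (DeltaZ g 1 t)); last first.
  have [_ h0 _] := Ymod_laurent g 0 (fgr_b R) utg.
  rewrite h0; last by move=> h; apply: hk; move: h; rewrite /Delta1Z mul0r oppr0 add0r.
  by rewrite Ymod0l (linear_0 Tl) (linear_0 (mod_linl _ _)) (linear_0 Thl).
pose E j k := mod_Y (T (Ymod 0 bvec j u)) k (Th x) - Th (Ymod m (Ymod 0 bvec j u) k x).
apply/eqP; rewrite -subr_eq0; apply/eqP.
refine (@delta_triangular M E (Delta1Z g m 1 (size s)) (DeltaZ g 1 t) _ _ k hk n) => [|{hk}n nD p q].
  have [J hJ] := Ymod_trunc g 0 bvec u (DeltaZ g 1 t).
  exists J => j Jj l; rewrite /E hJ // Ymod0l (linear_0 Tl) (linear_0 Thl).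
  by rewrite (linear_0 (mod_linl _ _)) subrr.
have [J hJ] := Ymod_trunc g 0 bvec u n.
pose D1 j := delta_mul (Delta1Z g m 1 (size s)) j
  (fun k => mod_Y (T (Ymod 0 bvec (n + j%:R) u)) k (Th x)) p q.
pose D2 j := delta_mul (Delta1Z g m 1 (size s)) j
  (fun k => Ymod m (Ymod 0 bvec (n + j%:R) u) k x) p q.
have e1 : evz D1.
  exists J => j Jj; rewrite /D1 /delta_mul hJ // (linear_0 Tl) (linear_0 (mod_linl _ _)) scaler0.
  by case: ifP.
have e2 : evz D2.
  by exists J => j Jj; rewrite /D2 /delta_mul hJ // Ymod0l scaler0; case: ifP.
transitivity (-1 *: Th (nsum D2) + nsum D1).
  rewrite (linear_nsum Thl) // -nsumP //; last exact: evz_linear.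
  apply: eq_nsum => j; rewrite /D1 /D2 /delta_mul /E; case: ifP => _.
    by rewrite (linear_Z Thl) scalerBr scaleN1r addrC.
  by rewrite (linear_0 Thl) scaler0 addr0.
have h1 : zwp n (fun p q => mod_Y b p (mod_Y (T u) q (Th x))) p q -
    (etaZ g 1 t * epi n) *: wzp n (fun p q => mod_Y (T u) q (mod_Y b p (Th x))) p q = nsum D1.
  rewrite [LHS](mod_borcherds b_gr (Tg ut) (Thg sx) nD p q).
  by apply: eq_nsum => j; rewrite -T_b -TY.
have h2 := Ymod_borcherds m (fgr_b R) utg sxg nD p q.
have {}h2 : zwp n (fun p q => Ymod m bvec p (Ymod m u q x)) p q -
    (etaZ g 1 t * epi n) *: wzp n (fun p q => Ymod m u q (Ymod m bvec p x)) p q = nsum D2 by [].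
rewrite -h1 -h2 (linear_B Thl) (linear_Z Thl).
rewrite (zwp_linear _ _ _ Thl); last exact: Ymod_Ymod_truncr.
rewrite (wzp_linear _ _ _ Thl); last exact: Ymod_Ymod_truncl.
rewrite scaleN1r [X in - X + _](_ : _ = zwp n (fun p q => mod_Y b p (mod_Y (T u) q (Th x))) p q -
    (etaZ g 1 t * epi n) *: wzp n (fun p q => mod_Y (T u) q (mod_Y b p (Th x))) p q) ?addNr //.
congr (_ - _ *: _); apply: eq_nsum => i; congr (_ *: _).
  by rewrite Thb -IH.
by rewrite -IH Thb.
Qed.

Lemma mod_theta_surj : mod_generated [set v] -> forall w, exists x, w = Th x.
Proof.
move=> gen w; suff : [set w | exists x, w = Th x] w by [].
have : [set: M] w by [].
rewrite -gen; apply; split; last by move=> _ ->; exists vac1.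
split=> [|u n _ [x ->]].
  split=> [|c _ _ [y ->] [z ->]]; first by exists 0; rewrite (linear_0 Thl).
  by exists (c *: y + z); rewrite Thl.
by exists (Ymod m (f u) n x); rewrite -mod_theta_Y fK.
Qed.

End Theta.
Lemma fld_b_vac n : Ymod m bvec n vac1 =
  nsum (fun l => cre l (if n + m + l%:R == -1 then vac1 else 0)).
Proof.
rewrite (Ymod_fdeg _ _ _ _ (fdeg_vac K)) mulr0 addr0 fld_b (@nsum1 _ 0%N) => [|[//|k] _].
  by apply: eq_nsum => l; rewrite subr0 ann_nil.
by apply: (@nsum0 fock) => l; rewrite ann_nil; case: ifP; rewrite linear0.
Qed.

Lemma mon_neq0 s : mon K s <> 0.
Proof.
move=> s0; have := linext_mon (U := K^o) (h := fun=> 1) s (fun _ _ _ => erefl).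
by rewrite s0 linear0 => /esym /eqP; rewrite oner_eq0.
Qed.

Lemma fock_mod_of_order :
  @mod_of_order _ g m F b (fock_mod f_hom m) vac1.
Proof.
split; first exact: (fdeg_vac K).
  apply/seteqP; split=> // x _ W [[[W0 Wl] WY] Wv].
  apply: (@fock_bmode_ind _ g m W (conj W0 Wl)) => [|y n Wy]; first exact: Wv.
  by rewrite -f_b; apply: (WY b).
move=> n hn; rewrite /= f_b fld_b_vac; apply: (@nsum0 fock) => l.
case: eqP => [e|_]; last by rewrite linear0.
case: hn; exists l; have -> : n = (- m + n + m + l%:R) - l%:R by ring.
by rewrite e -[l.+1]addn1 natrD; ring.
Qed.

(** The universal morphism fm to the polynomial module is a left inverse of Th, and Th is
    surjective because M is generated by v.  The morphism fm preserves degrees exactly,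
    since equivalences of gradings commute with translations and v goes to 1. *)
Lemma free_mod_model (M : gva_mod F (gradingZ g m)) (v : M) : free_mod b v ->
  exists (fm : M -> fock) (Th : fock -> M),
    [/\ linear fm, linear Th, cancel fm Th & cancel Th fm] /\
    [/\ Th vac1 = v,
      forall a x, fgr a x -> @mod_gr _ _ _ _ _ M a (Th x),
      forall a w, @mod_gr _ _ _ _ _ M a w -> fgr a (fm w)
      & forall u n x, mod_Y u n (Th x) = Th (Ymod m (f u) n x)].
Proof.
move=> [v_ord /(_ _ _ fock_mod_of_order) [fm [[[fml fmY [phi [_ phiD _] fmG]] _ fmv] _]]].
have [Th [Thl Thv Thg Thb]] := mod_theta v_ord.
have ThY := mod_theta_Y Thl Thg Thb.
have ThK : cancel Th fm.
  move=> x; move: x; apply: (@fock_bmode_ind _ g m) => [||x n IH].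
  - by split=> [|c x y hx hy]; rewrite ?(linear_0 Thl) ?(linear_0 fml) // Thl fml hx hy.
  - by rewrite Thv fmv.
  - by rewrite Thb fmY IH /= f_b.
exists fm, Th; split; split=> //.
- move=> w; have [_ gen _] := v_ord.
  by have [x ->] := mod_theta_surj Thl Thv Thg Thb gen w; rewrite ThK.
- move=> [a|a] x; first exact: Thg.
  move=> /fgr_neg ->; rewrite (linear_0 Thl).
  by case: (@mod_direct _ _ _ _ _ M) => h _ _; case: (h (Negz a)).
- have phi0 : phi (0 : int) = (0 : int).
    (* The vector 1 has degree 0 and also degree phi 0, as the image of v. *)
    have h : fgr (phi (0 : int)) vac1 by rewrite -fmv; apply: fmG; case: v_ord.
    case: (eqVneq (phi (0 : int)) (0 : int)) => // ne.
    case: (@mon_neq0 [::]).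
    have Qp (s s' : seq nat) : perm_eq s s' -> (size s == 0%N) = (size s' == 0%N).
      by move=> /perm_size ->.
    have := proj_mon K (Q := fun s => size s == 0%N) [::] Qp => /= <-.
    apply: (proj_disjoint Qp h) => s /eqP e.
    by apply/eqP => s0; rewrite -e s0 eqxx in ne.
  move=> a w wa; have := fmG _ _ wa.
  by have := phiD a (0 : int); rewrite /= /actZ addr0 phi0 addr0 => ->.
by move=> u n x; rewrite -{1}[u]fK ThY.
Qed.

End FreeModule.

(** * The exact sequence of polynomials *)

Section Sequence.
Variables (K : numFieldType) (g : K).
Local Notation fock := (fock K).
Local Notation fld := (fld g).
Local Notation Ymod := (Ymod g).
Local Notation vac1 := (vac1 K).
Implicit Types (x y u v : fock) (mu m n : K).

(** E(z) fixes t_0, as (1 - x/z)^g = 1 at x = 0; so every field commutes with t_0. *)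
Lemma fld_cre0_comm mu u n x : fld mu u n (cre 0 x) = cre 0 (fld mu u n x).
Proof.
move: u; apply: fock_ind => [|s].
  split=> [|c u v hu hv].
    by rewrite !(linear_0 (@fld_linearl _ g mu n _)) linear0.
  by rewrite !(@fld_linearl _ g) (linearP (cre 0)) /= hu hv.
move: n x; have := fdeg_mon K s; move: (size s) (mon K s); apply: fock_t0D_ind.
- move=> r; split=> [n x|c u v hu hv n x].
    by rewrite !(linear_0 (@fld_linearl _ g mu n _)) linear0.
  by rewrite !(@fld_linearl _ g) (linearP (cre 0)) /= hu hv.
- by move=> n x; rewrite !fld_nil; case: ifP; rewrite ?linear0.
- move=> r u _ IH n x; rewrite !fld_cre0.
  have [N h] := fld_bound g mu u (n + mu) x.
  rewrite !(@nsum2E _ N); first last.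
  + by move=> k l kl; rewrite ann_cre0 IH h // !linear0.
  + by move=> k l kl; rewrite h // linear0.
  rewrite linear_sum; apply: eq_bigr => k _; rewrite linear_sum; apply: eq_bigr => l _ /=.
  by rewrite ann_cre0 IH creC.
- by move=> r u _ IH n x; rewrite !fld_tder IH (linearZ_LR (cre 0)).
Qed.

(** Multiplication by t_0 is the inclusion: it raises the degree by one, which accounts
    for the change of order from m + g to m. *)
Lemma Ymod_cre0 m u n x : Ymod m u n (cre 0 x) = cre 0 (Ymod (m + g) u n x).
Proof.
move: x; apply: fock_ind => [|s].
  split=> [|c x y hx hy]; first by rewrite !linear0.
  by rewrite !linearP /= hx hy.
have s1 : fdeg (size s).+1 (cre 0 (mon K s)) by apply/fdeg_cre/fdeg_mon.
rewrite (Ymod_fdeg _ _ _ _ (fdeg_mon K s)) (Ymod_fdeg _ _ _ _ s1).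
rewrite fld_cre0_comm -[(size s).+1]addn1 natrD; congr (cre 0 (fld _ _ _ _)); ring.
Qed.

Definition down_step (a : nat) (_ y : fock) : fock := if a is a'.+1 then cre a' y else 0.
(** The algebra endomorphism t(z) |-> z t(z).  It is the quotient by t_0, followed by a
    renumbering of the variables; the factor z changes mu to mu + 1. *)
Definition down : fock -> fock := frec vac1 down_step.
HB.instance Definition _ := GRing.Linear.on down.

Lemma down_vac : down vac1 = vac1. Proof. exact: frec_nil. Qed.

Lemma down_cre a x : down (cre a x) = down_step a x (down x).
Proof.
rewrite /down (@frec_cre K fock vac1 down_step (fun _ => True)) //.
- by move=> [|b] c x1 x2 y1 y2 _ _; rewrite /= ?scaler0 ?addr0 // linearP.
- by move=> [|b] [|c] y z _ //=; rewrite ?linear0 // creC.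
Qed.

(** A linear section of down. *)
Definition up : fock -> fock := frec vac1 (fun a _ y => cre a.+1 y).
HB.instance Definition _ := GRing.Linear.on up.

Lemma up_cre a x : up (cre a x) = cre a.+1 (up x).
Proof.
rewrite /up (@frec_cre K fock vac1 (fun a _ y => cre a.+1 y) (fun _ => True)) //.
- by move=> b c x1 x2 y1 y2 _ _; rewrite linearP.
- by move=> b c y z _; rewrite creC.
Qed.

Lemma up_vac : up vac1 = vac1. Proof. exact: frec_nil. Qed.

Lemma cre_ind (P : fock -> Prop) : lclosed P -> P vac1 ->
  (forall a x, P x -> P (cre a x)) -> forall x, P x.
Proof.
move=> Pl P1 Pc; apply: fock_ind => // s.
by elim: s => // a s IH; rewrite -cre_mon; apply: Pc.
Qed.

Lemma upK : cancel up down.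
Proof.
move=> x; move: x; apply: cre_ind => [||a x IH].
- split=> [|c x y hx hy]; first by rewrite !linear0.
  by rewrite (linearP up) (linearP down) /= hx hy.
- by rewrite up_vac down_vac.
- by rewrite up_cre down_cre /= IH.
Qed.

Lemma down_cre0 x : down (cre 0 x) = 0.
Proof. by rewrite down_cre. Qed.

(** The polynomial ring is the sum of t_0 V and the polynomials in t_1, t_2, .... *)
Lemma down_ker x : down x = 0 -> exists y, x = cre 0 y.
Proof.
suff [y h] : exists y, x = up (down x) + cre 0 y.
  by move=> x0; exists y; rewrite h x0 linear0 add0r.
move: x; apply: cre_ind => [||[|a] x [y IH]].
- split=> [|c x x' [y hy] [y' hy']]; first by exists 0; rewrite !linear0 addr0.
  exists (c *: y + y'); rewrite {1}hy {1}hy'.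
  by rewrite (linearP down) (linearP up) (linearP (cre 0)) /= scalerDr addrACA.
- by exists 0; rewrite down_vac up_vac linear0 addr0.
- by exists x; rewrite down_cre0 linear0 add0r.
- exists (cre a.+1 y); rewrite {1}IH down_cre /= up_cre (linearD (cre a.+1)).
  by congr (_ + _); exact: creC.
Qed.

(** A retraction of the multiplication by t_0. *)
Definition div0 : fock -> fock := linext (fun s => if s is 0%N :: s' then mon K s' else 0).
HB.instance Definition _ := GRing.Linear.on div0.

Lemma cre0K : cancel (cre 0) div0.
Proof.
move=> x; move: x; apply: fock_ind => [|s].
  split=> [|c x y hx hy]; first by rewrite !linear0.
  by rewrite (linearP (cre 0)) (linearP div0) /= hx hy.
have -> : mon K s = mon K (sort leq s) by apply: mon_perm; rewrite perm_sym perm_sort.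
rewrite cre_mon /div0 linext_sorted //=.
rewrite path_sortedE; last exact: leq_trans.
by rewrite sort_sorted ?andbT; [apply/allP|exact: leq_total].
Qed.

Lemma down_low a i x : down (low a i x) = if a is a'.+1 then low a' i (down x) else 0.
Proof.
rewrite /low; case: a => [|a]; first by case: ifP => _; rewrite ?linear0 // sub0n down_cre0.
case: ifP => h; last by rewrite linear0 ifF //; lia.
rewrite down_cre; case: ifP => h'; first by rewrite subSn.
by have -> : (a.+1 - i)%N = 0%N by lia.
Qed.

Lemma down_ann c k x : down (ann c k x) = ann c k (down x).
Proof.
move: k; move: x; apply: cre_ind => [||a x IH k].
- split=> [k|d x y hx hy k]; first by rewrite !linear0.
  by rewrite (linearP (ann c k)) !(linearP down) (linearP (ann c k)) /= hx hy.
- by move=> k; rewrite ann_nil down_vac ann_nil; case: ifP; rewrite ?linear0 ?down_vac.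
rewrite ann_cre linear_sum down_cre; case: a => [|a] /=.
  by rewrite linear0 big1 // => i _; rewrite linearZ_LR /= down_low scaler0.
rewrite ann_cre; apply: eq_bigr => i _.
by rewrite linearZ_LR /= down_low IH.
Qed.

Lemma down_fld mu u n x : down (fld mu u n x) = fld (mu + 1) u n (down x).
Proof.
move: u; apply: fock_ind => [|s].
  split=> [|c u v hu hv].
    by rewrite !(linear_0 (@fld_linearl _ g _ n _)) linear0.
  by rewrite !(@fld_linearl _ g) (linearP down) /= hu hv.
move: n x; have := fdeg_mon K s; move: (size s) (mon K s); apply: fock_t0D_ind.
- move=> r; split=> [n x|c u v hu hv n x].
    by rewrite !(linear_0 (@fld_linearl _ g _ n _)) linear0.
  by rewrite !(@fld_linearl _ g) (linearP down) /= hu hv.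
- by move=> n x; rewrite !fld_nil; case: ifP; rewrite ?linear0.
- move=> r u _ IH n x; rewrite !fld_cre0.
  have [N h] := annle_ex x.
  rewrite (@nsumE _ N) => [|k Nk]; last first.
    by apply: nsum0 => l; rewrite h // !linear0.
  rewrite [RHS](@nsumE _ N) => [|k Nk]; last first.
    by apply: nsum0 => l; rewrite -down_ann h // !linear0.
  rewrite linear_sum; apply: eq_bigr => k _ /=.
  have ev : evz (fun l => cre l (fld mu u (n + mu + l%:R - k%:R) (ann g k x))).
    have [N' h'] := fld_bound g mu u (n + mu) x.
    by exists N' => l Nl; rewrite h' ?linear0 // Nl orbT.
  rewrite (linear_nsum (linearP down)) // nsum_recl; last first.
    exact: (evz_linear (linearP down)).
  rewrite [X in X + _]down_cre0 add0r; apply: eq_nsum => l; rewrite [LHS]down_cre /= IH down_ann.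
  by congr (cre l (fld _ _ _ _)); rewrite -[l.+1]addn1 natrD; ring.
- by move=> r u _ IH n x; rewrite !fld_tder -IH (linearZ_LR down).
Qed.

Lemma fdeg_down r x : fdeg r x -> fdeg r (down x).
Proof.
move: x; apply: fdeg_ind => [|s <-].
  split=> [|c x y hx hy]; first by rewrite linear0; apply: fdeg0.
  by rewrite linearP; apply: (fdeg_lclosed K r).2.
elim: s => [|a s IH] /=; first by rewrite [down _]down_vac; apply: (fdeg_mon K [::]).
by rewrite -cre_mon down_cre; case: a => [|a]; [apply: fdeg0|apply: fdeg_cre].
Qed.

Lemma down_Ymod m u n x : down (Ymod m u n x) = Ymod (m + 1) u n (down x).
Proof.
move: x; apply: fock_ind => [|s].
  split=> [|c x y hx hy]; first by rewrite !linear0.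
  by rewrite !linearP /= hx hy.
rewrite (Ymod_fdeg _ _ _ _ (fdeg_mon K s)) (Ymod_fdeg _ _ _ _ (fdeg_down (fdeg_mon K s))).
by rewrite down_fld addrAC.
Qed.

End Sequence.

Section Weights.
Variables (K : numFieldType) (g : K).
Local Notation fock := (fock K).
Local Notation fld := (fld g).
Implicit Types (x y u v : fock) (mu m n w : K).

(** The weight of t_a is a; the prescribed weight of b enters through the term r D
    of the bidegree. *)
Definition wgt (r : nat) w : fock -> Prop :=
  supported (fun s => (size s == r) && ((sumn s)%:R == w)).

Lemma wgt_lclosed r w : lclosed (wgt r w). Proof. exact: supported_lclosed. Qed.

Lemma wgt0 r w : wgt r w 0. Proof. by case: (wgt_lclosed r w). Qed.

Lemma wgt_mon s : wgt (size s) (sumn s)%:R (mon K s).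
Proof. by apply: supported_mon; rewrite !eqxx. Qed.

Lemma wgt_ind r w (P : fock -> Prop) : lclosed P ->
  (forall s, size s = r -> (sumn s)%:R = w -> P (mon K s)) -> forall x, wgt r w x -> P x.
Proof. by move=> lP Pm x [h]; apply: h => // s /andP[/eqP sr /eqP sw]; apply: Pm. Qed.

Lemma wgt_bigsum r w I (s : seq I) (P : pred I) (F : I -> fock) :
  (forall i, wgt r w (F i)) -> wgt r w (\sum_(i <- s | P i) F i).
Proof. by move=> h; exact: (@lclosed_bigsum K _ _ I s P F (wgt_lclosed r w) (fun i _ => h i)). Qed.

Lemma wgtZ r w c x : wgt r w x -> wgt r w (c *: x).
Proof. by move=> h; apply: (lclosedZ c (wgt_lclosed r w) h). Qed.

Lemma wgt_eq r w w' x : w = w' -> wgt r w x -> wgt r w' x. Proof. by move=> ->. Qed.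

Lemma wgt_cre a r w x : wgt r w x -> wgt r.+1 (a%:R + w) (cre a x).
Proof.
move: x; apply: wgt_ind => [|s <- <-].
  split=> [|c x y hx hy]; first by rewrite linear0; apply: wgt0.
  by rewrite linearP; apply: (wgt_lclosed _ _).2.
by rewrite cre_mon -natrD; apply: (wgt_mon (a :: s)).
Qed.

Lemma wgt_low a i r w x : wgt r w x -> wgt r.+1 (a%:R - i%:R + w) (low a i x).
Proof.
rewrite /low; case: ifP => h xw; last exact: wgt0.
by rewrite -natrB //; apply: wgt_cre.
Qed.

Lemma wgt_ann c k r w x : wgt r w x -> wgt r (w - k%:R) (ann c k x).
Proof.
move: x; apply: wgt_ind => [|s <- <-].
  split=> [|d x y hx hy]; first by rewrite linear0; apply: wgt0.
  by rewrite linearP; apply: (wgt_lclosed _ _).2.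
elim: s k => [|a s IH] k.
  rewrite ann_nil; case: eqP => [->|_]; last exact: wgt0.
  by rewrite subr0; apply: (wgt_mon [::]).
rewrite -cre_mon ann_cre; apply: wgt_bigsum => i.
apply: wgtZ.
apply: wgt_eq (wgt_low a i (IH (k - i)%N)).
have ik : (i <= k)%N by rewrite -ltnS.
by rewrite natrB // natrD; ring.
Qed.

(** In the field of t_a the mode t_l E_k changes the weight by l - k, matched by the power
    of z. *)
Lemma wgt_fld mu r t w w' u n x : wgt r w u -> wgt t w' x ->
  wgt (r + t) (w + w' - n - 1 - mu * r%:R) (fld mu u n x).
Proof.
move=> uw; move: u uw t w' n x; apply: wgt_ind => [|s <- <-].
  split=> [|d u v hu hv] t w' n x xw.
    by rewrite (linear_0 (@fld_linearl _ g mu n x)); apply: wgt0.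
  by rewrite (@fld_linearl _ g mu n x); apply: (wgt_lclosed _ _).2; [apply: hu|apply: hv].
elim: s => [|a s IH] t w' n x xw.
  rewrite fld_nil; case: eqP => [->|_]; last exact: wgt0.
  by apply: wgt_eq xw; rewrite /=; ring.
rewrite -cre_mon fld_cre.
have [N h] := fld_bound g mu (mon K s) (n + mu - a%:R) x.
rewrite (@nsum2E _ N) => [|k l kl]; last by rewrite h // linear0 scaler0.
apply: wgt_bigsum => k.
apply: wgt_bigsum => l.
apply: wgtZ.
have := wgt_cre l (IH _ _ (n + mu - a%:R + l%:R - k%:R) _ (wgt_ann g k xw)).
apply: wgt_eq; rewrite /= -[(size s).+1]addn1 !natrD; ring.
Qed.

End Weights.

(** * The bigradings *)

Section Bigradings.
Local Open Scope classical_set_scope.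
Local Open Scope ring_scope.
Variable R : realType.
Local Notation K := R[i].
Variable g : K.
Local Notation fock := (fock K).
Local Notation Ymod := (Ymod g).
Local Notation vac1 := (vac1 K).
Local Notation bvec := (bvec K).
Local Notation span := Defs.span.
Implicit Types (x y u v : fock) (m n p q C D S E : K).

(** The bidegree of a monomial of degree r and weight w.  Writing b(-n_r)...b(-n_1)v in the
    t_a, the i-th mode b(-n_i) contributes n_i - 1 - m - g (i - 1) to the weight, whence
    the term g r (r - 1)/2. *)
Definition bideg m C D S E (r : nat) (w : K) : K * K :=
  (S + C * r%:R, E + w + m * r%:R + g * 'C(r, 2)%:R + r%:R * D).

Definition mgr m C D S E (h : K * K) : set fock :=
  [set x | supported (fun s => h == bideg m C D S E (size s) (sumn s)%:R) x].

Lemma mgr_lclosed m C D S E h : lclosed (mgr m C D S E h).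
Proof. exact: supported_lclosed. Qed.

Lemma mgr_wgt m C D S E r w x : wgt r w x -> mgr m C D S E (bideg m C D S E r w) x.
Proof.
move: x; apply: wgt_ind => [|s <- <-]; first exact: mgr_lclosed.
by apply: supported_mon; rewrite eqxx.
Qed.

Lemma mgr_ind m C D S E h (P : fock -> Prop) : lclosed P ->
  (forall s, h = bideg m C D S E (size s) (sumn s)%:R -> P (mon K s)) ->
  forall x, mgr m C D S E h x -> P x.
Proof. by move=> lP Pm x [H]; apply: H => // s /eqP; apply: Pm. Qed.

Lemma bin2D (r t : nat) : 'C(r + t, 2)%:R = 'C(r, 2)%:R + 'C(t, 2)%:R + r%:R * t%:R :> K.
Proof.
elim: r => [|r IH]; first by rewrite !add0n !add0r mul0r addr0.
by rewrite addSn !binS !bin1 !natrD IH -[r.+1]addn1 !natrD; ring.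
Qed.

Lemma mgr_Ymod m C D S E h k u n x : mgr 0 C D 0 0 h u -> mgr m C D S E k x ->
  mgr m C D S E (h.1 + k.1, h.2 + k.2 - n - 1) (Ymod m u n x).
Proof.
move: u; apply: mgr_ind => [|s -> kx].
  split=> [_|c u v hu hv kx].
    by rewrite Ymod0l; case: (mgr_lclosed m C D S E (h.1 + k.1, h.2 + k.2 - n - 1)).
  by rewrite (@Ymod_linearl _ g); apply: (mgr_lclosed _ _ _ _ _ _).2; [apply: hu|apply: hv].
move: x kx; apply: mgr_ind => [|t ->].
  split=> [|c x y hx hy].
    by rewrite linear0; case: (mgr_lclosed m C D S E ((bideg 0 C D 0 0 (size s) (sumn s)%:R).1 + k.1,
      (bideg 0 C D 0 0 (size s) (sumn s)%:R).2 + k.2 - n - 1)).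
  by rewrite linearP; apply: (mgr_lclosed _ _ _ _ _ _).2.
rewrite (Ymod_fdeg _ _ _ _ (fdeg_mon K t)).
have := mgr_wgt m C D S E (wgt_fld g (m + g * (size t)%:R) n (wgt_mon K s) (wgt_mon K t)).
rewrite (_ : bideg _ _ _ _ _ _ _ = ((bideg 0 C D 0 0 (size s) (sumn s)%:R).1 +
    (bideg m C D S E (size t) (sumn t)%:R).1,
  (bideg 0 C D 0 0 (size s) (sumn s)%:R).2 +
    (bideg m C D S E (size t) (sumn t)%:R).2 - n - 1)) //.
by rewrite /bideg /= bin2D !natrD; congr (_, _); ring.
Qed.

Lemma mgr_vac m C D S E : mgr m C D S E (S, E) vac1.
Proof.
have := mgr_wgt m C D S E (wgt_mon K [::]).
by rewrite (_ : bideg _ _ _ _ _ _ _ = (S, E)) // /bideg /= bin_small //; congr (_, _); ring.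
Qed.

Lemma mgr_b C D : mgr 0 C D 0 0 (C, D) bvec.
Proof.
have := mgr_wgt 0 C D 0 0 (wgt_mon K [:: 0%N]); rewrite -cre_mon.
by rewrite (_ : bideg _ _ _ _ _ _ _ = (C, D)) // /bideg /= bin_small //; congr (_, _); ring.
Qed.

Lemma mgr_direct m C D S E : direct_sum (mgr m C D S E).
Proof.
apply: (@supported_direct_sum _ _ (fun h s => h == bideg m C D S E (size s) (sumn s)%:R)).
- by move=> h s s' ss'; rewrite (perm_size ss') (perm_sumn ss').
- by move=> s; exists (bideg m C D S E (size s) (sumn s)%:R).
- by move=> i j s /eqP -> /eqP.
Qed.

Lemma monomial_mgr m C D S E (s : seq K) : mgr m C D S E
  (S + C * (size s)%:R, E + \sum_(n <- s) n - (size s)%:R + (size s)%:R * D)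
  (monomial (Ymod m bvec) vac1 s).
Proof.
elim: s => [|n s IH]; first by rewrite big_nil /= !mulr0 mul0r subr0 !addr0; apply: mgr_vac.
have := mgr_Ymod (- n) (mgr_b C D) IH; rewrite big_cons /= opprK.
rewrite (_ : (_, _) = (S + C * (size s).+1%:R, E + (n + \sum_(j <- s) j) - (size s).+1%:R + (size s).+1%:R * D)) //.
by rewrite -[(size s).+1]addn1 natrD; congr (_, _); ring.
Qed.

Lemma spanP (V : lmodType K) (X : set V) (P : V -> Prop) :
  lclosed P -> (forall x : V, X x -> P x) -> forall x : V, span X x -> P x.
Proof. by move=> [P0 Pl] XP x; apply; split. Qed.

Lemma span_lclosed (V : lmodType K) (X : set V) : lclosed (span X).
Proof.
split=> [W [[W0 _] _] //|c x y hx hy W WX].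
by have [[_ Wl] _] := WX; apply: Wl; [apply: hx|apply: hy].
Qed.

Lemma span_sub (V : lmodType K) (X : set V) (x : V) : X x -> span X x.
Proof. by move=> Xx W [_ h]; apply: h. Qed.

Lemma bigr_lclosed (V : lmodType K) (Yb : K -> V -> V) (x0 : V) C D S E h :
  lclosed (bigr Yb x0 C D S E h).
Proof. exact: span_lclosed. Qed.

Lemma monomial_span m x :
  span [set monomial (Ymod m bvec) vac1 s | s in [set: seq K]] x.
Proof.
move: x; apply: (@fock_bmode_ind _ g m) => [||x n].
- exact: span_lclosed.
- by apply: span_sub; exists [::].
move: x; apply: spanP => [|_ [s _ <-]].
  split=> [|c x y hx hy]; first by rewrite linear0; case: (span_lclosed [set monomial (Ymod m bvec) vac1 s | s in [set: seq K]]).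
  by rewrite linearP; apply: (span_lclosed _).2.
by apply: span_sub; exists (- n :: s) => //=; rewrite opprK.
Qed.

(** One inclusion is the homogeneity of the fields.  Conversely the b-monomials span, and
    those of another bidegree are killed by the projection. *)
Lemma bigr_model m C D S E h x :
  bigr (Ymod m bvec) vac1 C D S E h x <-> mgr m C D S E h x.
Proof.
split.
  move: x; apply: spanP; first exact: mgr_lclosed.
  by move=> _ [s /= -> <-]; apply: monomial_mgr.
pose Q (k : K * K) s := k == bideg m C D S E (size s) (sumn s)%:R.
have Qp k s s' : perm_eq s s' -> Q k s = Q k s'.
  by move=> ss'; rewrite /Q (perm_size ss') (perm_sumn ss').
suff H : bigr (Ymod m bvec) vac1 C D S E h (proj (Q h) x).
  by move=> hx; move: H; rewrite (proj_supported (Qp h) hx).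
have := @monomial_span m x; move: x; apply: spanP => [|_ [s _ <-]].
  split=> [|c x y hx hy]; first by rewrite linear0; case: (bigr_lclosed (Ymod m bvec) vac1 C D S E h).
  by rewrite linearP; apply: (bigr_lclosed _ _ _ _ _ _ _).2.
have := monomial_mgr m C D S E s; set k := (_, _) => ks.
have [hk|hk] := eqVneq h k.
  rewrite hk (proj_supported (Qp k) ks) //.
  by apply: span_sub; exists s.
rewrite (proj_disjoint (Qp h) ks); first by case: (bigr_lclosed (Ymod m bvec) vac1 C D S E h).
by move=> t /eqP e; apply: contra hk => /eqP ->; rewrite e.
Qed.

Lemma bigr_transport (V W : lmodType K) (YV : K -> V -> V) (YW : K -> W -> W)
    (L : V -> W) (x0 : V) C D S E h :
  linear L -> (forall n (x : V), L (YV n x) = YW n (L x)) ->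
  forall x : V, bigr YV x0 C D S E h x -> bigr YW (L x0) C D S E h (L x).
Proof.
move=> Ll LY; apply: spanP => [|_ [s hs <-]].
  split=> [|c x y hx hy]; first by rewrite (linear_0 Ll); case: (bigr_lclosed YW (L x0) C D S E h).
  by rewrite Ll; apply: (bigr_lclosed _ _ _ _ _ _ _).2.
apply: span_sub; exists s => //.
by elim: s {hs} => //= n s ->; rewrite LY.
Qed.

Lemma direct_transport (I : Type) (V W : lmodType K) (X : I -> set V) (Y : I -> set W)
    (L : V -> W) (L' : W -> V) : linear L -> linear L' -> cancel L L' -> cancel L' L ->
  (forall i (y : W), Y i y <-> X i (L' y)) -> direct_sum X -> direct_sum Y.
Proof.
move=> Ll L'l LK L'K XY [Xs Xc Xd]; split=> [i|y|k i f ii fY f0 j].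
- have [X0 Xl] := Xs i; split=> [|c x y /XY hx /XY hy].
    by apply/XY; rewrite (linear_0 L'l).
  by apply/XY; rewrite L'l; apply: Xl.
- have [k [i [f [fX e]]]] := Xc (L' y); exists k, i, (L \o f); split.
    by move=> j; apply/XY; rewrite /= LK.
  by rewrite -[y]L'K e (linear_sumr Ll).
have := Xd k i (L' \o f) ii (fun j => (XY _ _).1 (fY j)).
rewrite -(linear_sumr L'l) f0 (linear_0 L'l) => /(_ erefl j) /= h.
by rewrite -[f j]L'K h (linear_0 Ll).
Qed.

Lemma mgr_cre0 m C D S E h x :
  mgr (m + g) C D (S + C) (E + m + D) h x -> mgr m C D S E h (cre 0 x).
Proof.
move: x; apply: mgr_ind => [|s ->].
  split=> [|c x y hx hy]; first by rewrite linear0; case: (mgr_lclosed m C D S E h).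
  by rewrite linearP; apply: (mgr_lclosed _ _ _ _ _ _).2.
have := mgr_wgt m C D S E (wgt_mon K (0%N :: s)).
rewrite cre_mon (_ : bideg _ _ _ _ _ _ _ = bideg (m + g) C D (S + C) (E + m + D) (size s) (sumn s)%:R) //.
by rewrite /bideg /= add0n binS bin1 natrD -[(size s).+1]addn1 natrD; congr (_, _); ring.
Qed.

Lemma mgr_down m C D S E h x :
  mgr m C D S E h x -> mgr (m + 1) C D S E h (down x).
Proof.
move: x; apply: mgr_ind => [|s ->].
  split=> [|c x y hx hy]; first by rewrite linear0; case: (mgr_lclosed (m + 1) C D S E h).
  by rewrite linearP; apply: (mgr_lclosed _ _ _ _ _ _).2.
suff H : wgt (size s) ((sumn s)%:R - (size s)%:R) (down (mon K s)).
  have := mgr_wgt (m + 1) C D S E H.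
  by congr (mgr _ _ _ _ _ _ _); rewrite /bideg; congr (_, _); ring.
elim: s => [|a s IH].
  by rewrite [down _]down_vac subr0; apply: (wgt_mon K [::]).
rewrite -cre_mon down_cre; case: a => [|a]; first exact: wgt0.
apply: wgt_eq (wgt_cre a IH).
by rewrite /= !natrD -[a.+1]addn1 -[(size s).+1]addn1 !natrD; ring.
Qed.

End Bigradings.

(** * Transport to the free modules *)

Section Assembly.
Local Open Scope classical_set_scope.
Local Open Scope ring_scope.
Variable R : realType.
Local Notation K := R[i].
Variable g : K.
Local Notation fock := (fock K).
Local Notation Ymod := (Ymod g).
Local Notation mgr := (mgr g).
Local Notation fgr := (@fgr R).
Local Notation vac1 := (vac1 K).
Local Notation bvec := (bvec K).
Implicit Types (x y : fock) (m n : K).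

Variables (F : gva (phaseZ g)) (b : F).
Variables (f : F -> fock_gva g) (T : fock_gva g -> F).
Hypotheses (f_hom : gva_hom f) (T_hom : gva_hom T) (T_b : T bvec = b).
Hypotheses (fK : cancel f T) (Tf : cancel T f).

Let fl : linear f. Proof. by case: f_hom. Qed.
Let Tl : linear T. Proof. by case: T_hom. Qed.
Let f_b : f b = bvec. Proof. by rewrite -T_b Tf. Qed.

Lemma bigrF_model C D h w : bigrF b C D h w <-> mgr 0 C D 0 0 h (f w).
Proof.
split=> [hw|/bigr_model hw].
  apply/bigr_model; have -> : vac1 = f (vac F) by case: f_hom => _ ->.
  apply: (@bigr_transport R F fock (gva_Y b) (Ymod 0 bvec) f) hw => // n x.
  by case: f_hom => _ _ -> _; rewrite f_b.
have Tv : T vac1 = vac F by case: T_hom.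
rewrite -[w]fK /bigrF -Tv.
apply: (@bigr_transport R fock F (Ymod 0 bvec) (gva_Y b) T) hw => // n x.
by case: T_hom => _ _ h' _; rewrite -T_b; apply: h'.
Qed.

Lemma bigrF_bigraded C D : bigraded_gva (bigrF b C D).
Proof.
split.
- apply: (@direct_transport R _ fock F (mgr 0 C D 0 0) _ T f) => //; last exact: mgr_direct.
  by move=> h w; apply: bigrF_model.
- apply/bigrF_model; have -> : f (vac F) = vac1 by case: f_hom.
  exact: mgr_vac.
- move=> h k u n w /bigrF_model hu /bigrF_model kw; apply/bigrF_model.
  by case: f_hom => _ _ -> _; apply: mgr_Ymod.
Qed.

(** The identification of M with the polynomial module, as produced by free_mod_model. *)
Definition model_iso m (M : gva_mod F (gradingZ g m)) (v : M)
    (fm : M -> fock) (Th : fock -> M) : Prop :=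
  [/\ linear fm, linear Th, cancel fm Th & cancel Th fm] /\
  [/\ Th vac1 = v,
      forall a x, fgr a x -> @mod_gr _ _ _ _ _ M a (Th x),
      forall a w, @mod_gr _ _ _ _ _ M a w -> fgr a (fm w)
    & forall u n x, mod_Y u n (Th x) = Th (Ymod m (f u) n x)].

Section OneModule.
Variables (m : K) (M : gva_mod F (gradingZ g m)) (v : M).
Variables (fm : M -> fock) (Th : fock -> M).
Hypothesis iso : model_iso v fm Th.

Lemma model_iso_Y u n (w : M) : fm (mod_Y u n w) = Ymod m (f u) n (fm w).
Proof. by have [[_ _ k1 k2] [_ _ _ h]] := iso; rewrite -{1}[w]k1 h k2. Qed.

Lemma bigrM_model C D S E h (w : M) : bigrM b v C D S E h w <-> mgr m C D S E h (fm w).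
Proof.
have [[l1 l2 k1 k2] [Thv _ _ hY]] := iso.
split=> [hw|/bigr_model hw].
  apply/bigr_model; have -> : vac1 = fm v by rewrite -Thv k2.
  apply: (@bigr_transport R M fock (mod_Y b) (Ymod m bvec) fm) hw => // n x.
  by rewrite model_iso_Y f_b.
rewrite -[w]k1 /bigrM -Thv.
apply: (@bigr_transport R fock M (Ymod m bvec) (mod_Y b) Th) hw => // n x.
by rewrite hY f_b.
Qed.

Lemma bigrM_bigraded C D S E : bigraded_mod (bigrF b C D) (bigrM b v C D S E).
Proof.
have [[l1 l2 k1 k2] _] := iso; split.
  apply: (@direct_transport R _ fock M (mgr m C D S E) _ Th fm) => //; last exact: mgr_direct.
  by move=> h w; apply: bigrM_model.
move=> h k u n w /bigrF_model hu /bigrM_model kw; apply/bigrM_model.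
by rewrite model_iso_Y; apply: mgr_Ymod.
Qed.

End OneModule.

(** A morphism of polynomial modules shifting degrees by k, allowed to change the order by
    an integer c, gives a morphism of modules whose gradings are equivalent under the
    shift by k. *)
Lemma model_map_hom m m' (M : gva_mod F (gradingZ g m)) (v : M) fm Th
    (M' : gva_mod F (gradingZ g m')) (v' : M') fm' Th' (L : fock -> fock) (k c : int) :
  model_iso v fm Th -> model_iso v' fm' Th' ->
  linear L -> (forall u n x, L (Ymod m u n x) = Ymod m' u n (L x)) ->
  (forall a x, fgr a x -> fgr (a + k) (L x)) ->
  m' + g * k%:~R - m = c%:~R -> mod_hom (Th' \o L \o fm).
Proof.
move=> iso iso' Ll LY Lg mk.
have [[l1 l2 k1 k2] [_ _ gM _]] := iso; have [[l1' l2' _ _] [_ gM' _ hY']] := iso'.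
split=> [a x y|u n x|]; first by rewrite /= l1 Ll l2'.
  by rewrite /= (model_iso_Y iso) LY hY'.
exists (fun a : int => a + k) => [|a x hx]; last by apply/gM'/Lg/gM.
split=> [|a x|a x].
- by exists (fun a : int => a - k) => x /=; rewrite ?addrK ?subrK.
- by rewrite /= /actZ addrA.
(* Delta_1(a, x + k) at order m' exceeds Delta_1(a, x) at order m by -a (m' + g k - m). *)
- exists (- (a * c)); rewrite /= /Delta1Z rmorphN rmorphM /= -mk intrD; ring.
Qed.

Lemma fgr_cre0 a x : fgr a x -> fgr (a + 1) (cre 0 x).
Proof.
case: a => a; last by move=> /fgr_neg ->; rewrite linear0; apply: fgr0.
by move=> /fgr_pos ax; rewrite -PoszD addn1; apply/fgr_pos/fdeg_cre.
Qed.

Lemma fgr_down a x : fgr a x -> fgr (a + 0) (down x).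
Proof.
rewrite addr0; case: a => a; last by move=> /fgr_neg ->; rewrite linear0; apply: fgr0.
by move=> /fgr_pos ax; apply/fgr_pos/fdeg_down.
Qed.

End Assembly.

Theorem theorem4 (R : realType) (g m C D S E : R[i]) (C_neq0 : C != 0)
    (F : gva (phaseZ g)) (b : F) (F_free : free_gva b)
    (M : forall mu : R[i], gva_mod F (gradingZ g mu))
    (v : forall mu : R[i], M mu)
    (M_free : forall mu : R[i], free_mod b (v mu)) :
  exists (iota : M (m + g) -> M m) (pi : M m -> M (m + 1)),
    [/\ mod_hom iota, mod_hom pi,
        iota (v (m + g)) = mod_Y b (- m - 1) (v m),
        pi (v m) = v (m + 1)
      & short_exact iota pi] /\
    [/\ bigraded_gva (bigrF b C D),
        bigraded_mod (bigrF b C D) (bigrM b (v (m + g)) C D (S + C) (E + m + D)),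
        bigraded_mod (bigrF b C D) (bigrM b (v m) C D S E),
        bigraded_mod (bigrF b C D) (bigrM b (v (m + 1)) C D S E)
      & (forall h x, bigrM b (v (m + g)) C D (S + C) (E + m + D) h x ->
           bigrM b (v m) C D S E h (iota x)) /\
        (forall h x, bigrM b (v m) C D S E h x ->
           bigrM b (v (m + 1)) C D S E h (pi x))].
Proof.
have [f [T [f_hom T_hom T_b fK Tf]]] := free_gva_model F_free.
have f_b : f b = bvec R[i] by rewrite -T_b Tf.
have iso mu : exists (fm : M mu -> fock R[i]) (Th : fock R[i] -> M mu),
    model_iso f (v mu) fm Th.
  exact: (free_mod_model f_hom T_hom T_b fK Tf (M_free mu)).
have [f0 [T0 i0]] := iso (m + g); have [f1 [T1 i1]] := iso m.
have [f2 [T2 i2]] := iso (m + 1).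
have [[f0l T0l f0K T0K] [T0v _ _ _]] := i0.
have [[f1l T1l f1K T1K] [T1v _ _ T1Y]] := i1.
have [[f2l T2l f2K T2K] [T2v _ _ _]] := i2.
exists (T1 \o cre 0 \o f0), (T2 \o (@down R[i]) \o f1); split; split.
- apply: (model_map_hom (k := 1) (c := 0) i0 i1) => //.
  + exact: linearP.
  + by move=> u n x; rewrite Ymod_cre0.
  + exact: fgr_cre0.
  + by rewrite mulr1 subrr.
- apply: (model_map_hom (k := 0) (c := 1) i1 i2) => //.
  + exact: linearP.
  + exact: down_Ymod.
  + exact: fgr_down.
  + by rewrite mulr0 addr0 addrAC subrr add0r.
- rewrite /= -T0v T0K -T1v T1Y f_b fld_b_vac; congr (T1 _).
  have e (l : nat) : - m - 1 + m + l%:R = -1 + l%:R by ring.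
  rewrite (@nsum1 _ 0%N) => [|l l0]; rewrite e; first by rewrite addr0 eqxx.
  by rewrite -subr_eq0 addrC addKr pnatr_eq0 (negPf l0) linear0.
- by rewrite /= -T1v T1K down_vac T2v.
- split.
  + apply: (can_inj (g := T0 \o (@div0 R[i]) \o f1)) => x /=.
    by rewrite T1K cre0K f0K.
  + apply/seteqP; split=> [_ [x _ <-]|x] /=.
      by rewrite T1K down_cre0 (linear_0 T2l).
    move=> h; have : down (f1 x) = 0 by rewrite -[LHS]T2K h (linear_0 f2l).
    move=> /down_ker [y hy]; exists (T0 y) => //=.
    by rewrite T0K -hy f1K.
  + apply/seteqP; split=> // x _; exists (T1 (@up R[i] (f2 x))) => //=.
    by rewrite T1K upK f2K.
- exact: (bigrF_bigraded f_hom T_hom T_b fK Tf).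
- exact: (bigrM_bigraded f_hom T_hom T_b fK Tf i0).
- exact: (bigrM_bigraded f_hom T_hom T_b fK Tf i1).
- exact: (bigrM_bigraded f_hom T_hom T_b fK Tf i2).
- split=> h x hx.
    apply/(bigrM_model T_b Tf i1); rewrite /= T1K.
    by apply/mgr_cre0/(bigrM_model T_b Tf i0).
  apply/(bigrM_model T_b Tf i2); rewrite /= T2K.
  by apply/mgr_down/(bigrM_model T_b Tf i1).
Qed.
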